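(* Consider the multi-antenna NOMA downlink model described in the context, with $N\ge 2$ clusters, $K\ge 2$ users per cluster, $M>(N-1)K$ transmit antennas, all powers $P_{i,j}>0$, and user $(n,k)$ allotted $B_{n,k}\ge 0$ feedback bits. Put $\delta_{n,k}=2^{-B_{n,k}/(M-1)}$, $S^{(1)}_{n,k}=\frac{d_{n,k}^{-\alpha}}{\sigma_{n,k}^2}\sum_{j=1}^{k}P_{n,j}$, $S^{(2)}_{n,k}=\frac{d_{n,k}^{-\alpha}}{\sigma_{n,k}^2}\sum_{j=1}^{k-1}P_{n,j}$, $S^{(3)}_{n,k}=\frac{d_{n,k}^{-\alpha}}{\sigma_{n,k}^2}\sum_{i=1,i\ne n}^{N}\sum_{j=1}^{K}P_{i,j}$, and $c_{n,k}=S^{(3)}_{n,k}\delta_{n,k}/(M-1)$. Then for every $n$ and $k$ the ergodic rate $R_{n,k}=\mathbb{E}[\log_2(1+\gamma_{n,k})]$ satisfies $R_{n,k}\ge R^{LB1}_{n,k}$, where $$R^{LB1}_{n,1}=\Theta\big(S^{(1)}_{n,1},\,c_{n,1}\big)-\log_2(e)\exp\!\Big(\tfrac{M-1}{S^{(3)}_{n,1}\delta_{n,1}}\Big)\sum_{q=1}^{M-1}E_q\!\Big(\tfrac{M-1}{S^{(3)}_{n,1}\delta_{n,1}}\Big),$$ $$R^{LB1}_{n,k}=\Theta\big(S^{(1)}_{n,k},c_{n,k}\big)-\Theta\big(S^{(2)}_{n,k},c_{n,k}\big)\quad (k>1),$$ with $E_q(x)=\int_1^\infty e^{-xt}t^{-q}\,dt$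 and, for $a,b>0$, $$\Theta(a,b)=\log_2(e)\Bigg[\frac{(-1)^M(M-1)}{b^{M-1}}I_1(a)+\sum_{p=1}^{M-1}\sum_{q=1}^{M-p}\frac{(-1)^{p+q+1}(M-1)}{(q-1)!\,b^p}I_2(a,b,p,q)+\sum_{p=1}^{M-1}\sum_{q=2}^{M-p}\sum_{s=0}^{q-2}\frac{(-1)^{p+s-1}(q-s-2)!\,(M-1)}{(q-1)!\,b^{p}}I_3(a,b,p,s)\Bigg],$$ $$I_1(a)=\sum_{t=0}^{M-2}\binom{M-2}{t}\frac{(-1)^t}{a^{t+1}}\tilde\Psi\Big(-M-1-t,\tfrac1a\Big),$$ $$I_2(a,b,p,q)=\sum_{r=0}^{M-2}\sum_{t=0}^{p-1+r}\binom{M-2}{r}\binom{p-1+r}{t}\frac{(-1)^{p-1-t}b^{p-1+r-t}}{a^{r+1}}\Psi\Big(q-4-t,\tfrac{1}{a+b},\tfrac1b\Big),$$ $$I_3(a,b,p,s)=\sum_{t=0}^{M-2}\binom{M-2}{t}\frac{(-1)^t a^{p-1}}{b^{s-1}(p+t)}\,{}_2F_1\Big(s-1,p+t;p+t+1;-\tfrac ab\Big),$$ where ${}_2F_1$ is the Gauss hypergeometric function, $\mathrm{Ei}(x)=-\mathrm{PV}\!\int_{-x}^{\infty}\frac{e^{-t}}{t}dt$, and for $0<u<v$ and integer $n$: for $n>0$: $\Psi(n,u,v)=\sum_{k=0}^{n}\frac{(-1)^k n!}{(n-k)!}\big[v^{n-k}e^{v}\mathrm{Ei}(-v)-u^{n-k}e^{u}\mathrm{Ei}(-u)\big]-\sum_{k=0}^{n-1}\frac{(-1)^k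 n!\,(v^{n-k}-u^{n-k})}{(n-k)(n-k)!}-(-1)^n n!\ln\frac vu$; for $n=0$: $\Psi(0,u,v)=e^v\mathrm{Ei}(-v)-e^u\mathrm{Ei}(-u)-\ln\frac vu$; for $n=-1$: $\Psi(-1,u,v)=\mathrm{Ei}(-v)\mathrm{Ei}(v)-\mathrm{Ei}(-u)\mathrm{Ei}(u)+\frac{\mathrm{Ei}^2(-u)-\mathrm{Ei}^2(-v)}{2}+\sum_{m=0}^{\infty}\sum_{l=0}^{2m}\frac{2(v^le^{-v}-u^le^{-u})}{(2m+1)^2\,l!}$; for $n\le -2$: $\Psi(n,u,v)=\sum_{k=1}^{-n-1}\frac{(-n-k-1)!}{(-n-1)!}\big[u^{n+k}e^u\mathrm{Ei}(-u)-v^{n+k}e^v\mathrm{Ei}(-v)\big]+\frac{\mathrm{Ei}(-v)\mathrm{Ei}(v)-\mathrm{Ei}(-u)\mathrm{Ei}(u)}{(-n-1)!}+\sum_{k=1}^{-n-1}\frac{(-n-k-1)!(v^{n+k}-u^{n+k})}{(-n-1)!(n+k)}+\frac{\mathrm{Ei}^2(-u)-\mathrm{Ei}^2(-v)}{2(-n-1)!}+\frac{1}{(-n-1)!}\sum_{m=0}^{\infty}\sum_{l=0}^{2m}\frac{2(v^le^{-v}-u^le^{-u})}{(2m+1)^2\,l!}$; and for $n\le-2$, $u>0$: $\tilde\Psi(n,u)=\frac{e^u\mathrm{Ei}(-u)}{(-n-1)!}\sum_{k=1}^{-n-1}(-n-k-1)!\,u^{n+k}-\frac{\mathrm{Ei}(-u)\mathrm{Ei}(u)}{(-n-1)!}-\sum_{k=1}^{-n-1}\frac{(-n-k-1)!\,u^{n+k}}{(-n-1)!(n+k)}+\frac{\mathrm{Ei}^2(-u)}{2(-n-1)!}-\frac{1}{(-n-1)!}\sum_{m=0}^{\infty}\sum_{l=0}^{2m}\frac{2u^le^{-u}}{(2m+1)^2\,l!}$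 (the limit of $\Psi(n,u,v)$ as $v\to+\infty$).
   Context: System: a base station with $M$ antennas serves $NK$ single-antenna users grouped into $N$ clusters of $K$ users; user $(n,k)$ is at distance $d_{n,k}$, path-loss exponent $\alpha>0$, noise variance $\sigma_{n,k}^2>0$, channel $d_{n,k}^{-\alpha/2}\mathbf h_{n,k}$ with $\mathbf h_{n,k}\in\mathbb C^{1\times M}$ having i.i.d. $\mathcal{CN}(0,1)$ entries. User $(n,k)$ quantizes its channel direction $\tilde{\mathbf h}_{n,k}=\mathbf h_{n,k}/\|\mathbf h_{n,k}\|$ with a random codebook of $2^{B_{n,k}}$ i.i.d. isotropic unit vectors, $\hat{\mathbf h}_{n,k}=\arg\max_{\mathbf c}|\tilde{\mathbf h}_{n,k}\mathbf c^H|$, and writes $\tilde{\mathbf h}_{n,k}=\cos\theta_{n,k}\hat{\mathbf h}_{n,k}+\sin\theta_{n,k}\tilde{\mathbf e}_{n,k}$ with $\tilde{\mathbf e}_{n,k}$ a unit vector orthogonal to $\hat{\mathbf h}_{n,k}$. The zero-forcing beamformer $\mathbf w_n$ of cluster $n$ is a unit vector orthogonal to all $\hat{\mathbf h}_{m,j}$, $m\ne n$ (uniformly random in that null space). Cluster $n$ transmits $\sum_j\sqrt{P_{n,j}}s_{n,j}$ on $\mathbf w_n$; user $(n,k)$ cancels the signals of users $(n,j)$, $j>k$, by SIC, so its SINR is $\gamma_{n,k}=\dfrac{\frac{d_{n,k}^{-\alpha}}{\sigma_{n,k}^2}P_{n,k}\,G Z}{1+S^{(2)}_{n,k}GZ+\frac{d_{n,k}^{-\alpha}}{\sigma_{n,k}^2}\,GT\sum_{i\ne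 n}V_i\sum_{l=1}^K P_{i,l}}$, where $G=\|\mathbf h_{n,k}\|^2$, $T=\sin^2\theta_{n,k}$, $Z=|\tilde{\mathbf h}_{n,k}\mathbf w_n|^2$, $V_i=|\tilde{\mathbf e}_{n,k}\mathbf w_i|^2$ ($S^{(2)}_{n,1}=0$). The analysis model for these random quantities is: with $X\sim\mathrm{Gamma}(1,1)$ and $Y\sim\mathrm{Gamma}(M-1,1)$ independent, $(GT,\,G(1-T))$ has the same joint law as $(\delta_{n,k}Y,\;X+(1-\delta_{n,k})Y)$ (quantization-cell approximation of random vector quantization); $Z\sim\mathrm{Beta}(1,M-1)$ is independent of $(G,T)$; each $V_i\sim\mathrm{Beta}(1,M-2)$ and $(V_i)_{i\ne n}$ is independent of $(G,T,Z)$. *)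

(* Defs.v *)
From HB Require Import structures.
From mathcomp Require Import all_boot all_order all_algebra.
From mathcomp Require Import all_classical all_reals all_analysis.
From mathcomp Require Import beta_distribution.

Set Implicit Arguments.
Unset Strict Implicit.
Unset Printing Implicit Defensive.

Import Order.TTheory GRing.Theory Num.Def Num.Theory.
Import numFieldTopology.Exports.

Local Open Scope classical_set_scope.
Local Open Scope ring_scope.

Section special.
Context {R : realType}.
Notation mu := (@lebesgue_measure R).

Definition log2 (x : R) : R := ln x / ln 2.

Definition Rint (D : set R) (f : R -> R) : R := fine (\int[mu]_(t in D) (f t)%:E).

Definition Gamma_fn (x : R) : R :=
  Rint `]0, +oo[ (fun t => t `^ (x - 1) * expR (- t)).

Definition Ei (x : R) : R :=
  - lim ((fun eps => Rint [set t | - x <= t /\ eps <= `|t|] (fun t => expR (- t) / t))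
           @ 0^'+).

Definition Eq_int (q : nat) (x : R) : R :=
  Rint `[1, +oo[ (fun t => expR (- (x * t)) / t ^+ q).

(* Gauss hypergeometric function 2F1(a,b;c;z), for c > b > 0 and real z < 1,
   via Euler's integral representation (principal branch, DLMF 15.6.1) *)
Definition hyp2F1 (a b c z : R) : R :=
  Gamma_fn c / (Gamma_fn b * Gamma_fn (c - b)) *
  Rint `[0, 1] (fun t => t `^ (b - 1) * (1 - t) `^ (c - b - 1) * (1 - z * t) `^ (- a)).

Definition dser (u v : R) : R :=
  limn (series (fun m : nat =>
     \sum_(0 <= l < (2 * m).+1)
        (2 * (v ^+ l * expR (- v) - u ^+ l * expR (- u)) /
         ((2 * m + 1)%:R ^+ 2 * (l`!)%:R)))).

Definition Psi (n : int) (u v : R) : R :=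
  match n with
  | Posz p.+1 =>
      let n := p.+1 in
      \sum_(0 <= k < n.+1) ((-1) ^+ k * (n`!)%:R / ((n - k)`!)%:R *
          (v ^+ (n - k) * expR v * Ei (- v) - u ^+ (n - k) * expR u * Ei (- u)))
      - \sum_(0 <= k < n) ((-1) ^+ k * (n`!)%:R * (v ^+ (n - k) - u ^+ (n - k)) /
                           ((n - k)%:R * ((n - k)`!)%:R))
      - (-1) ^+ n * (n`!)%:R * ln (v / u)
  | Posz 0 => expR v * Ei (- v) - expR u * Ei (- u) - ln (v / u)
  | Negz 0 (* n = -1 *) =>
      Ei (- v) * Ei v - Ei (- u) * Ei u + (Ei (- u) ^+ 2 - Ei (- v) ^+ 2) / 2 + dser u v
  | Negz m (* n = -(m+1) <= -2, so -n-1 = m *) =>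
      \sum_(1 <= k < m.+1) (((m - k)`!)%:R / (m`!)%:R *
          (u ^ (n + k%:Z) * expR u * Ei (- u) - v ^ (n + k%:Z) * expR v * Ei (- v)))
      + (Ei (- v) * Ei v - Ei (- u) * Ei u) / (m`!)%:R
      + \sum_(1 <= k < m.+1) (((m - k)`!)%:R * (v ^ (n + k%:Z) - u ^ (n + k%:Z)) /
                              ((m`!)%:R * (n + k%:Z)%:~R))
      + (Ei (- u) ^+ 2 - Ei (- v) ^+ 2) / (2 * (m`!)%:R)
      + dser u v / (m`!)%:R
  end.

(* the double series with the v-terms removed (limit v -> +oo) *)
Definition dser_t (u : R) : R :=
  limn (series (fun m : nat =>
     \sum_(0 <= l < (2 * m).+1)
        (2 * (u ^+ l * expR (- u)) / ((2 * m + 1)%:R ^+ 2 * (l`!)%:R)))).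

(* tilde Psi(n,u), for integer n <= -2 and u > 0 ; here m = -n-1 *)
Definition Psit (n : int) (u : R) : R :=
  let m := (`|n| - 1)%N in
  expR u * Ei (- u) / (m`!)%:R *
    \sum_(1 <= k < m.+1) (((m - k)`!)%:R * u ^ (n + k%:Z))
  - Ei (- u) * Ei u / (m`!)%:R
  - \sum_(1 <= k < m.+1) (((m - k)`!)%:R * u ^ (n + k%:Z) /
                          ((m`!)%:R * (n + k%:Z)%:~R))
  + Ei (- u) ^+ 2 / (2 * (m`!)%:R)
  - dser_t u / (m`!)%:R.

Section theta.
Variable M : nat.

Definition I1 (a : R) : R :=
  \sum_(0 <= t < (M - 2).+1)
    ('C(M - 2, t)%:R * (-1) ^+ t / a ^+ t.+1 *
     Psit (- (M%:Z) - 1 - t%:Z) (a^-1)).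

Definition I2 (a b : R) (p q : nat) : R :=
  \sum_(0 <= r < (M - 2).+1) \sum_(0 <= t < (p - 1 + r).+1)
    ('C(M - 2, r)%:R * 'C(p - 1 + r, t)%:R *
     (-1) ^ (p%:Z - 1 - t%:Z) * b ^+ (p - 1 + r - t) / a ^+ r.+1 *
     Psi (q%:Z - 4 - t%:Z) ((a + b)^-1) (b^-1)).

Definition I3 (a b : R) (p s : nat) : R :=
  \sum_(0 <= t < (M - 2).+1)
    ('C(M - 2, t)%:R * (-1) ^+ t * a ^+ (p - 1) /
     (b ^ (s%:Z - 1) * (p + t)%:R) *
     hyp2F1 (s%:R - 1) (p + t)%:R (p + t + 1)%:R (- (a / b))).

Definition Theta (a b : R) : R :=
  (ln 2)^-1 *
  ( (-1) ^+ M * (M - 1)%:R / b ^+ (M - 1) * I1 a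
  + \sum_(1 <= p < M) \sum_(1 <= q < (M - p).+1)
      ((-1) ^+ (p + q + 1) * (M - 1)%:R / (((q - 1)`!)%:R * b ^+ p) * I2 a b p q)
  + \sum_(1 <= p < M) \sum_(2 <= q < (M - p).+1) \sum_(0 <= s < (q - 1))
      ((-1) ^+ (p + s - 1) * ((q - s - 2)`!)%:R * (M - 1)%:R /
        (((q - 1)`!)%:R * b ^+ p) * I3 a b p s) ).

End theta.

Definition gamma_pdf (k : nat) (x : R) : R :=
  if 0 <= x then x ^+ (k - 1) * expR (- x) / ((k - 1)`!)%:R else 0.

End special.

Section model.
Context {R : realType}.
Variables (M N K : nat) (alpha : R) (d sigma2 P : 'I_N -> 'I_K -> R) (B : 'I_N -> 'I_K -> nat).

Definition delta (n : 'I_N) (k : 'I_K) : R := 2 `^ (- ((B n k)%:R / (M - 1)%:R)).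
Definition gain (n : 'I_N) (k : 'I_K) : R := d n k `^ (- alpha) / sigma2 n k.
Definition S1 n k : R := gain n k * \sum_(j < K | (j <= k)%N) P n j.
Definition S2 n k : R := gain n k * \sum_(j < K | (j < k)%N) P n j.
Definition S3 n k : R := gain n k * \sum_(i < N | i != n) \sum_(j < K) P i j.
Definition cnk n k : R := S3 n k * delta n k / (M - 1)%:R.

(* R^{LB1}_{n,k}; user index k is 0-based (k = 0 is the paper's k = 1) *)
Definition RLB1 (n : 'I_N) (k : 'I_K) : R :=
  if k == 0 :> nat then
    Theta M (S1 n k) (cnk n k)
    - (ln 2)^-1 * expR ((M - 1)%:R / (S3 n k * delta n k)) *
      \sum_(1 <= q < M) Eq_int q ((M - 1)%:R / (S3 n k * delta n k))
  else Theta M (S1 n k) (cnk n k) - Theta M (S2 n k) (cnk n k).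

Definition sinr (n : 'I_N) (k : 'I_K) (G T Z : R) (V : 'I_N -> R) : R :=
  gain n k * P n k * G * Z /
  (1 + S2 n k * G * Z
     + gain n k * G * T * \sum_(i < N | i != n) V i * \sum_(l < K) P i l).
End model.

(* Main.v *)
(* Conditionally on (G, T, Z), the rate is the convex function
   u |-> ln (1 + A / (xi + g u)) of U = sum_i c_i V_i, which is independent of
   (G, T, Z) and has mean u0 = S3 / (M - 1); Jensen's inequality, in the form of
   the tangent line at u0, replaces U by u0.  The rate then splits into
   E ln (1 + S1 G Z + u0 G T) minus the same expectation with S2.  By the joint
   law of (G T, G (1 - T)) the variable is a Z (X + Y) + b Y with b = u0 delta;
   writing ln (1 + w) = int_0^oo (1 - e^(-s w)) e^(-s) / s ds turns its mean given
   Z = z into an integral of the Laplace transform of a gamma sum, which partial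
   fractions reduce to exponential integrals, and integrating these against the
   Beta(1, M - 1) density of Z term by term gives exactly Theta(a, b). *)
Require Import Defs.
From HB Require Import structures.
From mathcomp Require Import all_boot all_order all_algebra.
From mathcomp Require Import all_classical all_reals all_analysis.
From mathcomp Require Import beta_distribution measurable_realfun.
From mathcomp Require Import zify ring lra.
Import Order.TTheory GRing.Theory Num.Def Num.Theory.
Import numFieldTopology.Exports numFieldNormedType.Exports.
Local Open Scope classical_set_scope.
Local Open Scope ring_scope.

Set Implicit Arguments.
Unset Strict Implicit.
Unset Printing Implicit Defensive.

(** Every closed form is checked by differentiation: [Psi] is the increment of a primitive of
    [x ^ n * expR x * Ei (- x)], and its double series is the tail integral of
    [expR (- y) * (Ei y - Ei (- y)) / y]. The binomial sums in [Theta] come from expanding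
    [(1 - z) ^ (M - 2)] and, in [I2], from writing [a z = (a z + b) - b]. The hypotheses fix laws
    only, so the random quantities are nonnegative merely almost surely. Expectations are therefore
    taken of absolute values, which makes every integrand nonnegative everywhere and Tonelli
    available; the true rate is reached at the end by an almost sure equality. For the same reason
    Jensen's inequality is kept additive: the terms of the tangent line stand on the side where they
    are positive, and the slope is bounded by [1 / u0], so its mean is finite and cancels. The
    tangent line is linear in the [V i], so only their means and their independence of the slope
    enter. *)

Section derive_rules.
Context {R : realType}.
Implicit Types (f g : R -> R) (x c df dg : R).

(** A plain proposition rather than a class instance: rules are composed by hand, and the derivative
    they produce is matched with the wanted one by [eq_has_deriv]. *)
Definition has_deriv f x df := is_derive x (1 : R) f df.

Lemma eq_has_deriv f x df dg : has_deriv f x df -> df = dg -> has_deriv f x dg.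
Proof. by move=> + <-. Qed.

Lemma has_deriv_continuous f x df : has_deriv f x df -> {for x, continuous f}.
Proof. by move=> [? _]; exact/differentiable_continuous/derivable1_diffP. Qed.

Lemma has_deriv_cst c x : has_deriv (fun=> c) x 0.
Proof. exact: is_derive_cst. Qed.

Lemma has_deriv_id x : has_deriv (fun y : R => y) x 1.
Proof. exact: is_derive_id. Qed.

Lemma has_derivN f x df : has_deriv f x df ->
  has_deriv (fun y => - f y) x (- df).
Proof. by rewrite /has_deriv => ?; exact: is_deriveN. Qed.

Lemma has_derivD f g x df dg : has_deriv f x df -> has_deriv g x dg ->
  has_deriv (fun y => f y + g y) x (df + dg).
Proof. by rewrite /has_deriv => ? ?; exact: is_deriveD. Qed.

Lemma has_derivB f g x df dg : has_deriv f x df -> has_deriv g x dg ->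
  has_deriv (fun y => f y - g y) x (df - dg).
Proof. by rewrite /has_deriv => ? ?; exact: is_deriveB. Qed.

Lemma has_derivM f g x df dg : has_deriv f x df -> has_deriv g x dg ->
  has_deriv (fun y => f y * g y) x (df * g x + f x * dg).
Proof.
rewrite /has_deriv => ? ?; rewrite addrC [df * _]mulrC; exact: is_deriveM.
Qed.

Lemma has_derivZ c f x df : has_deriv f x df ->
  has_deriv (fun y => c * f y) x (c * df).
Proof.
move=> fd; rewrite -[c * df]add0r -(mul0r (f x)).
by apply: has_derivM => //; exact: has_deriv_cst.
Qed.

Lemma has_derivZr c f x df : has_deriv f x df ->
  has_deriv (fun y => f y * c) x (df * c).
Proof.
move=> fd; rewrite mulrC (_ : (fun y => f y * c) = fun y => c * f y).
  exact: has_derivZ.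
by apply/funext => y; rewrite mulrC.
Qed.

Lemma has_derivV f x df : f x != 0 -> has_deriv f x df ->
  has_deriv (fun y => (f y)^-1) x (- df / f x ^+ 2).
Proof.
rewrite /has_deriv => fx0 fd; rewrite mulrC mulrN -mulNr; exact: is_deriveV.
Qed.

Lemma has_deriv_chain f g x df dg : has_deriv f (g x) df ->
  has_deriv g x dg -> has_deriv (fun y => f (g y)) x (df * dg).
Proof. by rewrite /has_deriv => ? ?; exact: is_derive1_comp. Qed.

Lemma has_derivX f n x df : has_deriv f x df ->
  has_deriv (fun y => f y ^+ n) x (n%:R * f x ^+ n.-1 * df).
Proof.
apply: (@has_deriv_chain (fun y => y ^+ n)).
split; first exact: exprn_derivable.
by rewrite exp_derive [_ *: _]mulr1.
Qed.

Lemma has_deriv_expR f x df : has_deriv f x df ->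
  has_deriv (fun y => expR (f y)) x (expR (f x) * df).
Proof. by apply: has_deriv_chain; exact: is_derive_expR. Qed.

Lemma has_derivXn n x : has_deriv (fun y => y ^+ n) x (n%:R * x ^+ n.-1).
Proof. by apply: eq_has_deriv (mulr1 _); apply: has_derivX; exact: has_deriv_id. Qed.

Lemma has_deriv_expRN x : has_deriv (fun y => expR (- y)) x (- expR (- x)).
Proof.
apply: (@eq_has_deriv _ _ (expR (- x) * -1)); last by rewrite mulrN1.
by apply: has_deriv_expR; apply: has_derivN; exact: has_deriv_id.
Qed.

Lemma has_deriv_inv x : x != 0 -> has_deriv (fun y => y^-1) x (- x ^- 2).
Proof.
move=> x0; apply: (@eq_has_deriv _ _ (- 1 / x ^+ 2)); last by rewrite mulN1r.
by apply: has_derivV => //; exact: has_deriv_id.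
Qed.

Lemma has_deriv_ln x : 0 < x -> has_deriv (@ln R) x x^-1.
Proof. by move=> x0; exact: is_derive1_ln. Qed.

Lemma has_deriv_near f g x df : (\near x, g x = f x) ->
  has_deriv f x df -> has_deriv g x df.
Proof.
move=> fg; apply: near_eq_is_derive.
by apply: filterS fg => y.
Qed.

End derive_rules.

(** * Integrals carrying their value, and the fundamental theorem of calculus *)

Section has_int.
Context {R : realType}.
Notation mu := (@lebesgue_measure R).
Implicit Types (D : set (measurableTypeR R)) (f g F : R -> R) (a b u v : R).

(** Bundling integrability with the value lets finite linear combinations be evaluated without
    separate integrability side conditions. *)
Definition has_int D f v :=
  mu.-integrable D (EFin \o f) /\ \int[mu]_(x in D) f x = v.

Lemma has_intE D f v : measurable D -> has_int D f v ->
  (\int[mu]_(x in D) (f x)%:E)%E = v%:E.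
Proof.
by move=> mD [fi <-]; rewrite /Rintegral fineK//; exact: integrable_fin_num.
Qed.

Lemma ge0_has_int D f v : measurable D -> measurable_fun D f ->
  (forall x, D x -> 0 <= f x) ->
  (\int[mu]_(x in D) (f x)%:E)%E = v%:E -> has_int D f v.
Proof.
move=> mD mf f0 fv; split; last by rewrite /Rintegral fv.
apply/integrableP; split; first exact/measurable_EFinP.
suff -> : (\int[mu]_(x in D) `|(EFin \o f) x| = \int[mu]_(x in D) (f x)%:E)%E.
  by rewrite fv ltry.
by apply: eq_integral => x /set_mem Dx /=; rewrite ger0_norm// f0.
Qed.

Lemma eq_has_int D g f v : measurable D -> (forall x, D x -> f x = g x) ->
  has_int D g v -> has_int D f v.
Proof.
move=> mD fg [ig <-]; split.
  by apply: eq_integrable ig => // x /set_mem Dx /=; rewrite fg.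
by apply: eq_Rintegral => x /set_mem; exact: fg.
Qed.

Lemma has_intD D f g u v : measurable D -> has_int D f u -> has_int D g v ->
  has_int D (fun x => f x + g x) (u + v).
Proof.
move=> mD [fi <-] [gi <-]; split; last by rewrite RintegralD.
by have := integrableD mD fi gi.
Qed.

Lemma has_intZ D f k v : measurable D -> has_int D f v ->
  has_int D (fun x => k * f x) (k * v).
Proof.
move=> mD [fi <-]; split; last by rewrite RintegralZl.
by have := integrableZl mD k fi.
Qed.

Lemma has_int0 D : measurable D -> has_int D (fun=> 0) 0.
Proof.
move=> mD; split; first exact: integrable0.
by rewrite /Rintegral integral0.
Qed.

Lemma has_int_sum (I : eqType) (r : seq I) D (f : I -> R -> R) (v : I -> R) :
  measurable D -> (forall i, i \in r -> has_int D (f i) (v i)) ->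
  has_int D (fun x => \sum_(i <- r) f i x) (\sum_(i <- r) v i).
Proof.
move=> mD; elim: r => [_|i r IH H].
  under eq_fun do rewrite big_nil.
  by rewrite big_nil; exact: has_int0.
under eq_fun do rewrite big_cons.
rewrite big_cons; apply: has_intD => //; first by apply: H; rewrite mem_head.
by apply: IH => j jr; apply: H; rewrite in_cons jr orbT.
Qed.

(** Only one-sided limits of [F] at the ends are asked, because the primitive met in
    [has_int_Psit_term] is singular at the left end. *)
Lemma has_int_FTC2 a b f F : a < b -> {within `[a, b], continuous f} ->
  {in `]a, b[, forall x : R, has_deriv F x (f x)} ->
  F x @[x --> a^'+] --> F a -> F x @[x --> b^'-] --> F b ->
  has_int `[a, b] f (F b - F a).
Proof.
move=> ab cf dF Fa Fb; split.
  apply: continuous_compact_integrable => //; exact: segment_compact.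
rewrite /Rintegral (@continuous_FTC2 _ f F)//.
- by split=> // x /dF; case.
- by move=> x /dF /= [_ <-]; rewrite derive1E.
Qed.

Lemma has_int_FTC a b f F : a < b ->
  (forall x, a <= x <= b -> {for x, continuous f}) ->
  (forall x : R, a <= x <= b -> has_deriv F x (f x)) ->
  has_int `[a, b] f (F b - F a).
Proof.
move=> ab cf dF; have cF x : a <= x <= b -> {for x, continuous F}.
  by move=> /dF; exact: has_deriv_continuous.
apply: has_int_FTC2 => //.
- apply: continuous_in_subspaceT => x /set_mem /=; rewrite in_itv/=; exact: cf.
- by move=> x; rewrite in_itv/= => /andP[ax xb]; apply: dF; rewrite !ltW.
- by apply: cvg_at_right_filter; apply: cF; rewrite lexx ltW.
- by apply: cvg_at_left_filter; apply: cF; rewrite lexx ltW.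
Qed.

Lemma has_int_FTCy a l f F : (forall x, a <= x -> 0 <= f x) ->
  (forall x, a <= x -> {for x, continuous f}) ->
  (forall x : R, a <= x -> has_deriv F x (f x)) ->
  F x @[x --> +oo] --> l -> has_int `[a, +oo[ f (l - F a).
Proof.
move=> f0 cf dF Fl.
have mf : measurable_fun `[a, +oo[ f.
  apply: subspace_continuous_measurable_fun => //.
  by apply: continuous_in_subspaceT => x /set_mem /=; rewrite in_itv/= andbT; exact: cf.
apply: ge0_has_int => //.
  by move=> x /=; rewrite in_itv/= andbT; exact: f0.
rewrite (@ge0_continuous_FTC2y _ f F a l)//.
- by apply: continuous_in_subspaceT => x /set_mem /=; rewrite in_itv/= andbT; exact: cf.
- by move=> x /ltW /dF [].
- by apply: cvg_at_right_filter; apply: has_deriv_continuous (dF _ (lexx a)).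
- by move=> x; rewrite in_itv/= andbT => /ltW /dF [_ <-]; rewrite derive1E.
Qed.

End has_int.

(** * Tail integrals as functions of their lower end *)

Section tail_integral.
Context {R : realType}.
Notation mu := (@lebesgue_measure R).
Implicit Types (f : R -> R) (a x y : R).

Lemma Rintegral_itvcyE f a x : a <= x ->
  mu.-integrable `[a, +oo[ (EFin \o f) ->
  \int[mu]_(t in `[x, +oo[) f t =
  \int[mu]_(t in `[a, +oo[) f t - \int[mu]_(t in `[a, x]) f t.
Proof.
move=> ax fi; rewrite Rintegral_itvB//.
rewrite Rintegral_itv_obnd_cbnd//; apply: integrableS fi => //.
by apply: subset_itvr; rewrite bnd_simp.
Qed.

Lemma has_deriv_integral_itvcc f a (x u : R) : a < x < u ->
  mu.-integrable `[a, u] (EFin \o f) -> {for x, continuous f} ->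
  has_deriv (fun y => \int[mu]_(t in `[a, y]) f t) x (f x).
Proof.
move=> /andP[ax xu] fi cf.
have [dF F_x] := continuous_FTC1_closed xu fi ax cf.
by split; [exact: dF|rewrite -derive1E; exact: F_x].
Qed.

Lemma has_deriv_integral_itvcy f a (x : R) : a < x ->
  mu.-integrable `[a, +oo[ (EFin \o f) -> {for x, continuous f} ->
  has_deriv (fun y => \int[mu]_(t in `[y, +oo[) f t) x (- f x).
Proof.
move=> ax fi cf.
apply: (@has_deriv_near _ (fun y => \int[mu]_(t in `[a, +oo[) f t -
   \int[mu]_(t in `[a, y]) f t)).
  near=> y; rewrite (@Rintegral_itvcyE f a)//.
  by apply: ltW; near: y; exact: lt_nbhsr.
have H : has_deriv (fun y => \int[mu]_(t in `[a, y]) f t) x (f x).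
  apply: (@has_deriv_integral_itvcc f a x (x + 1)) => //.
    by rewrite ax ltrDl ltr01.
  by apply: integrableS fi => //; exact: subset_itvl.
by rewrite -sub0r; apply: has_derivB => //; exact: has_deriv_cst.
Unshelve. all: by end_near. Qed.

Lemma cvg_integral_itvcy f a : mu.-integrable `[a, +oo[ (EFin \o f) ->
  \int[mu]_(t in `[y, +oo[) f t @[y --> +oo] --> (0 : R).
Proof.
move=> fi; apply/cvg_pinftyP => u uoo.
have mi y : measurable (`[y, +oo[%classic : set (measurableTypeR R)) by [].
have mf : measurable_fun (`[a, +oo[%classic : set (measurableTypeR R)) (EFin \o f).
  exact: (measurable_int mu).
(* Along a sequence [u] tending to infinity, the restrictions of [f] to the tails are dominated by
   its absolute value and eventually vanish at each point. *)
pose g n := (EFin \o f) \_ (`[u n, +oo[%classic : set (measurableTypeR R)).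
have [] := @dominated_convergence _ _ _ mu `[a, +oo[%classic (mi a) g (cst 0%E)
  (abse \o (EFin \o f)).
- move=> n; apply/measurable_restrict => //.
  by apply: measurable_funS mf => // x [].
- by [].
- apply: aeW => x _; apply: cvg_near_cst.
  move/cvgryPgt : uoo => /(_ x); apply: filterS => n xn.
  by rewrite /g patchE memNset//= in_itv/= andbT; apply/negP; rewrite -ltNge.
- by apply: integrable_abse.
- apply: aeW => x n _; rewrite /g patchE; case: ifPn => //= _.
  by rewrite lee_fin normr0 normr_ge0.
move=> _ _; rewrite integral0 => /fine_cvg /=.
apply: cvg_trans; apply: near_eq_cvg.
move/cvgryPge : uoo => /(_ a); apply: filterS => n an.
rewrite /Rintegral; congr fine; rewrite /g -integral_mkcondr; congr (integral mu _ _).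
by apply/seteqP; split=> [x []//|x /= xu]; split=> //=; move: xu; rewrite !in_itv/= !andbT; exact: le_trans.
Qed.

End tail_integral.

(** * Truncated exponentials and the incomplete gamma function *)

Section incomplete_gamma.
Context {R : realType}.
Notation mu := (@lebesgue_measure R).
Implicit Types (x c : R) (k : nat).

(** The regularized upper incomplete gamma function of order [k + 1], i.e. the tail of the
    Gamma([k + 1], 1) law. Up to constants these are the inner sums of the double series in
    [Psi]. *)
Definition exp_trunc k x : R := expR (- x) * \sum_(l < k.+1) x ^+ l / l`!%:R.

Lemma exp_truncS k x :
  exp_trunc k.+1 x = exp_trunc k x + expR (- x) * (x ^+ k.+1 / k.+1`!%:R).
Proof. by rewrite /exp_trunc big_ord_recr/= mulrDr. Qed.

Lemma fact_neq0 k : k`!%:R != 0 :> R.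
Proof. by rewrite pnatr_eq0 -lt0n fact_gt0. Qed.

(** The derivative telescopes, leaving only the last summand. *)
Lemma has_deriv_exp_trunc k x :
  has_deriv (exp_trunc k) x (- (x ^+ k * expR (- x) / k`!%:R)).
Proof.
elim: k => [|k IH].
  rewrite (_ : exp_trunc 0 = fun x => expR (- x)); last first.
    by apply/funext => y; rewrite /exp_trunc big_ord1 expr0 fact0 divr1 mulr1.
  by apply: eq_has_deriv (has_deriv_expRN x) _; rewrite expr0 fact0 divr1 mul1r.
rewrite (_ : exp_trunc k.+1 =
    fun x => exp_trunc k x + expR (- x) * (x ^+ k.+1 * (k.+1`!%:R)^-1)); last first.
  by apply/funext => y; rewrite exp_truncS.
apply: eq_has_deriv.
  apply: has_derivD IH _; apply: has_derivM; first exact: has_deriv_expRN.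
  by apply: has_derivZr; exact: has_derivXn.
rewrite /= factS natrM exprS.
have := fact_neq0 k; have : k.+1%:R != 0 :> R by rewrite pnatr_eq0.
by move: (k.+1%:R : R) (k`!%:R : R) => c e c0 e0; field; rewrite c0 e0.
Qed.

Lemma cvgy_inv : x^-1 @[x --> +oo] --> (0 : R).
Proof. by apply/gtr0_cvgV0; [exact: nbhs_pinfty_gt|exact: cvg_id]. Qed.

Lemma cvgy_powM_expRN k : x ^+ k * expR (- x) @[x --> +oo] --> (0 : R).
Proof.
(* The majorant comes from keeping the term of degree [k + 1] of the exponential series. *)
have H : (k.+1)`!%:R * x^-1 @[x --> +oo] --> (0 : R).
  rewrite -[X in _ --> X](mulr0 ((k.+1)`!%:R : R)); apply: cvgM.
    exact: cvg_cst.
  exact: cvgy_inv.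
apply: (@squeeze_cvgr _ _ _ _ (fun=> 0) (fun x => (k.+1)`!%:R * x^-1)) => //; last exact: cvg_cst.
near=> x.
have x0 : 0 < x by near: x; exact: nbhs_pinfty_gt.
rewrite mulr_ge0 ?(exprn_ge0,expR_ge0) ?(ltW x0)//=.
rewrite expRN ler_pdivlMr// mulrAC -exprSr ler_pdivrMr ?expR_gt0// mulrC.
rewrite -ler_pdivrMr ?ltr0n ?fact_gt0//.
by rewrite (le_trans _ (expR_ge1Dxn k (ltW x0)))// lerDr ler01.
Unshelve. all: by end_near. Qed.

Lemma cvgy_exp_trunc k : exp_trunc k x @[x --> +oo] --> (0 : R).
Proof.
elim: k => [|k IH].
  rewrite (_ : exp_trunc 0 = fun x => expR (- x)); first exact: cvgr_expR.
  by apply/funext => y; rewrite /exp_trunc big_ord1 expr0 fact0 divr1 mulr1.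
rewrite (_ : exp_trunc k.+1 =
    fun x => exp_trunc k x + x ^+ k.+1 * expR (- x) * (k.+1`!%:R)^-1); last first.
  by apply/funext => y; rewrite exp_truncS mulrCA mulrA.
rewrite -[X in _ --> X]addr0; apply: cvgD => //.
rewrite -[X in _ --> X](mul0r (k.+1`!%:R^-1)).
by apply: cvgM; [exact: cvgy_powM_expRN|exact: cvg_cst].
Qed.

Lemma exp_trunc0 k : exp_trunc k 0 = 1.
Proof.
rewrite /exp_trunc oppr0 expR0 mul1r big_ord_recl/= expr0 fact0 divr1.
by rewrite big1 ?addr0// => i _; rewrite expr0n/= mul0r.
Qed.

Lemma has_int_gamma_itvcy k x : 0 <= x ->
  has_int `[x, +oo[ (fun y => y ^+ k * expR (- y) / k`!%:R) (exp_trunc k x).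
Proof.
move=> x0; rewrite -[exp_trunc k x]opprK -[- - _]add0r.
apply: (@has_int_FTCy R x 0 _ (fun y => - exp_trunc k y)).
- move=> y xy; rewrite divr_ge0// mulr_ge0 ?expR_ge0// exprn_ge0//.
  exact: le_trans xy.
- move=> y _; apply: has_deriv_continuous; apply: has_derivZr.
  by apply: has_derivM; [exact: has_derivXn|exact: has_deriv_expRN].
- by move=> y _; rewrite -[X in has_deriv _ _ X]opprK; apply: has_derivN; exact: has_deriv_exp_trunc.
- by rewrite -oppr0; apply: cvgN; exact: cvgy_exp_trunc.
Qed.

Lemma exp_trunc_ge0 k x : 0 <= x -> 0 <= exp_trunc k x.
Proof.
move=> x0; rewrite mulr_ge0 ?expR_ge0//; apply: sumr_ge0 => i _.
by rewrite divr_ge0// exprn_ge0.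
Qed.

(** Part of the integral of a nonnegative density whose total mass is [exp_trunc k 0 = 1]. *)
Lemma exp_trunc_le1 k x : 0 <= x -> exp_trunc k x <= 1.
Proof.
move=> x0; rewrite -(exp_trunc0 k).
have [fi <-] := has_int_gamma_itvcy k (lexx 0).
have [_ <-] := has_int_gamma_itvcy k x0.
rewrite (@Rintegral_itvcyE _ _ 0 x)// lerBlDr lerDl.
apply: Rintegral_ge0 => y /=; rewrite in_itv/= => /andP[y0 _].
by rewrite divr_ge0// mulr_ge0 ?expR_ge0// exprn_ge0.
Qed.

Lemma has_int_gamma_rate k c : 0 < c ->
  has_int `[0, +oo[ (fun y => y ^+ k * expR (- (c * y))) (k`!%:R / c ^+ k.+1).
Proof.
move=> c0.
pose F y := - (k`!%:R / c ^+ k.+1) * exp_trunc k (c * y).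
have -> : k`!%:R / c ^+ k.+1 = 0 - F 0.
  by rewrite /F mulr0 exp_trunc0 mulr1 sub0r opprK.
apply: has_int_FTCy.
- by move=> y y0; rewrite mulr_ge0 ?expR_ge0// exprn_ge0.
- move=> y _; apply: has_deriv_continuous; apply: has_derivM.
    exact: has_derivXn.
  by apply: has_deriv_expR; apply: has_derivN; apply: has_derivZ; exact: has_deriv_id.
- move=> y _; apply: eq_has_deriv.
    apply: has_derivZ; apply: has_deriv_chain; first exact: has_deriv_exp_trunc.
    by apply: has_derivZ; exact: has_deriv_id.
  have := fact_neq0 k; have := lt0r_neq0 c0.
  move: (k`!%:R : R) => e c_neq0 e_neq0; rewrite exprMn exprS.
  by field; rewrite c_neq0 e_neq0 expf_neq0.
- rewrite -(mulr0 (- (k`!%:R / c ^+ k.+1))); apply: cvgM; first exact: cvg_cst.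
  apply: (@cvg_comp _ _ _ (fun y : R => c * y) (exp_trunc k) _ (pinfty_nbhs R)).
    by apply: gt0_cvgMry => //; exact: cvg_id.
  exact: cvgy_exp_trunc.
Qed.

Lemma has_int_itvoy (f : R -> R) (a v : R) :
  has_int `[a, +oo[ f v -> has_int `]a, +oo[ f v.
Proof.
move=> [fi <-].
have fi' : mu.-integrable `]a, +oo[ (EFin \o f).
  by apply: integrableS fi => //; apply: subset_itvr; rewrite bnd_simp.
by split=> //; rewrite Rintegral_itv_obnd_cbnd.
Qed.

(** The integrands in use may be singular, or take a default value of division, at 0; measurability
    is drawn from continuity on the open half-line. *)
Lemma measurable_fun_gt0 (f : R -> R) (D : set R) :
  (forall x, 0 < x -> {for x, continuous f}) -> D `<=` `]0, +oo[ ->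
  measurable_fun D f.
Proof.
move=> cf D0; apply: (measurable_funS (E := `]0, +oo[%classic : set R)) => //.
apply: open_continuous_measurable_fun; first exact: interval_open.
by move=> x; rewrite inE/= in_itv/= andbT; exact: cf.
Qed.

End incomplete_gamma.

(** * The exponential integral and its principal value *)

Section exponential_integral.
Context {R : realType}.
Notation mu := (@lebesgue_measure R).
Implicit Types (x y t : R).

Definition E1 x : R := \int[mu]_(t in `[x, +oo[) (expR (- t) / t).

(* The junk value [sinhc2 0 = 0] (the continuous extension is 2) is harmless:
   only integrals of [sinhc2] matter, and [shi2 y = Ei y - Ei (- y)]. *)
Definition sinhc2 t : R := (expR t - expR (- t)) / t.

Definition shi2 y : R := \int[mu]_(t in `[0, y]) sinhc2 t.

Lemma continuous_expRN_div x : 0 < x ->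
  {for x, continuous (fun t => expR (- t) / t)}.
Proof.
move=> x0; apply: has_deriv_continuous; apply: has_derivM.
  exact: has_deriv_expRN.
by apply: has_deriv_inv; rewrite gt_eqF.
Qed.

Lemma has_int_expRN x : 0 <= x -> has_int `[x, +oo[ (fun t => expR (- t)) (expR (- x)).
Proof.
move=> x0; have := has_int_gamma_itvcy 0 x0.
rewrite /exp_trunc big_ord1 expr0 fact0 divr1 mulr1.
by apply: eq_has_int => // y _; rewrite divr1 expr0 mul1r.
Qed.

Lemma integrable_E1 x : 0 < x ->
  mu.-integrable `[x, +oo[ (EFin \o (fun t => expR (- t) / t)).
Proof.
move=> x0; have [fi _] := has_intZ x^-1 (measurable_itv _) (has_int_expRN (ltW x0)).
apply: le_integrable fi => //.
  apply/measurable_EFinP; apply: measurable_fun_gt0; first exact: continuous_expRN_div.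
  by move=> t /=; rewrite !in_itv/= !andbT; exact: lt_le_trans.
move=> t /=; rewrite in_itv/= andbT => xt; have t0 := lt_le_trans x0 xt.
rewrite lee_fin !ger0_norm; last 2 first.
- by rewrite mulr_ge0 ?expR_ge0 ?invr_ge0// ltW.
- by rewrite divr_ge0 ?expR_ge0// ltW.
by rewrite mulrC ler_wpM2r ?expR_ge0// lef_pV2.
Qed.

Lemma has_deriv_E1 x : 0 < x -> has_deriv E1 x (- (expR (- x) / x)).
Proof.
move=> x0; have x20 : 0 < x / 2 by rewrite divr_gt0.
apply: (has_deriv_integral_itvcy (a := x / 2)).
- by rewrite ltr_pdivrMr// ltr_pMr// ltr1n.
- exact: integrable_E1.
- exact: continuous_expRN_div.
Qed.

Lemma E1_ge0 x : 0 < x -> 0 <= E1 x.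
Proof.
move=> x0; apply: Rintegral_ge0 => t /=; rewrite in_itv/= andbT => xt.
by rewrite divr_ge0 ?expR_ge0// (le_trans (ltW x0)).
Qed.

Lemma E1_le x : 0 < x -> E1 x <= x^-1 * expR (- x).
Proof.
move=> x0; have [fi <-] := has_intZ x^-1 (measurable_itv _) (has_int_expRN (ltW x0)).
apply: le_Rintegral => //; first exact: integrable_E1.
move=> t /=; rewrite in_itv/= andbT => xt; have t0 := lt_le_trans x0 xt.
by rewrite mulrC ler_wpM2r ?expR_ge0// lef_pV2.
Qed.

Lemma sinhc2_ge0 t : 0 <= t -> 0 <= sinhc2 t.
Proof.
by move=> t0; rewrite divr_ge0// subr_ge0 ler_expR ge0_cp.
Qed.

(** Multiply [expR (- 2 t) >= 1 - 2 t] by [expR t]; at 0 the left side is 0 by division by zero. *)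
Lemma sinhc2_le t : 0 <= t -> sinhc2 t <= 2 * expR t.
Proof.
rewrite le_eqVlt => /predU1P[<-|t0].
  by rewrite /sinhc2 invr0 mulr0 mulr_ge0 ?expR_ge0.
rewrite /sinhc2 ler_pdivrMr// lerBlDr -lerBlDl.
have := expR_ge1Dx (- (t *+ 2)).
rewrite -(ler_pM2l (expR_gt0 t)) -expRD.
have -> : t + - (t *+ 2) = - t by rewrite mulr2n; ring.
apply: le_trans; rewrite mulr2n; lra.
Qed.

Lemma continuous_sinhc2 t : 0 < t -> {for t, continuous sinhc2}.
Proof.
move=> t0; apply: has_deriv_continuous; apply: has_derivM; last first.
  by apply: has_deriv_inv; rewrite gt_eqF.
apply: has_derivB; last exact: has_deriv_expRN.
by apply: has_deriv_expR; exact: has_deriv_id.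
Qed.

Lemma measurable_sinhc2 y : measurable_fun (`[0, y]%classic : set R) sinhc2.
Proof.
apply: (measurable_funS (E := `[0, +oo[%classic : set R)) => //.
  exact: subset_itvl.
(* Continuity is only known away from 0, so the point 0 is split off. *)
rewrite -(@setU1itv _ _ _ 0 false)//; apply/measurable_funU => //; split.
  exact: measurable_fun_set1.
exact: measurable_fun_gt0 continuous_sinhc2 _.
Qed.

Lemma integrable_sinhc2 y : mu.-integrable `[0, y] (EFin \o sinhc2).
Proof.
apply: measurable_bounded_integrable => //.
- by rewrite /= lebesgue_measure_itv/=; case: ifPn => // _; rewrite -EFinB ltry.
- exact: measurable_sinhc2.
- exists (2 * expR y); split; first by rewrite num_real.
  move=> M yM t /=; rewrite in_itv/= => /andP[t0 ty].
  rewrite ger0_norm ?sinhc2_ge0//; apply: le_trans (ltW yM).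
  by apply: (le_trans (sinhc2_le t0)); rewrite ler_pM2l// ler_expR.
Qed.

Lemma has_deriv_shi2 y : 0 < y -> has_deriv shi2 y (sinhc2 y).
Proof.
move=> y0; apply: (has_deriv_integral_itvcc (u := y + 1)).
- by rewrite y0 ltrDl ltr01.
- exact: integrable_sinhc2.
- exact: continuous_sinhc2.
Qed.

Lemma shi2_ge0 y : 0 <= shi2 y.
Proof.
by apply: Rintegral_ge0 => t /=; rewrite in_itv/= => /andP[t0 _]; exact: sinhc2_ge0.
Qed.

(** The range avoids the pole: once the cut-off is below [x] it removes nothing, and the limit is
    that of an eventually constant function. *)
Lemma EiN x : 0 < x -> Ei (- x) = - E1 x.
Proof.
move=> x0; rewrite /Ei opprK; congr (- _); apply/cvg_lim => //.
apply: cvg_near_cst; near=> e; rewrite /Defs.Rint /E1 /Rintegral; congr fine.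
congr (integral mu _ _); apply/seteqP; split => t /=; rewrite in_itv/= andbT; first by case.
move=> xt; split=> //; apply: le_trans (ler_norm _); apply: le_trans xt.
near: e; exact: nbhs_right_le.
Unshelve. all: by end_near. Qed.

(** Reflecting the negative part of the cut-off range onto [[e, y]] pairs [expR (- t) / t] with
    [- expR t / t]. The pole cancels into [- sinhc2], which is integrable down to 0, so the
    principal value exists. *)
Lemma EiE y : 0 < y -> Ei y = shi2 y - E1 y.
Proof.
move=> y0; rewrite /Ei -[RHS]opprK opprB; congr (- _); apply/cvg_lim => //.
(* The form that the cut-off integral is shown to take for small [e]; its limit is continuity at 0
   of the integral of [sinhc2]. *)
have H : E1 y - (shi2 y - \int[mu]_(t in `[0, e]) sinhc2 t) @[e --> 0^'+] --> E1 y - shi2 y.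
  apply: cvgB; first exact: cvg_cst.
  rewrite -[X in _ --> X]subr0; apply: cvgB; first exact: cvg_cst.
  apply: cvg_at_right_filter.
  exact: (parameterized_integral_cvg_left (ltr01 : 0 < 1 :> R) (integrable_sinhc2 1)).
apply: cvg_trans H; apply: near_eq_cvg; near=> e.
have e0 : 0 < e by near: e; exact: nbhs_right_gt.
have ey : e <= y by near: e; exact: nbhs_right_le.
have -> : [set t | - y <= t /\ e <= `|t|] = `[- y, - e]%classic `|` `[e, +oo[%classic.
  apply/seteqP; split => t /=; rewrite !in_itv/= andbT.
    move=> [yt]; case: (ger0P t) => t0 et; first by right.
    by left; rewrite yt lerNr.
  move=> [/andP[yt te]|et]; split => //.
  - by rewrite -normrN; apply: le_trans (ler_norm _); rewrite lerNr.
  - by apply: le_trans et; rewrite (le_trans _ (ltW e0))// oppr_le0 ltW.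
  - exact: le_trans (ler_norm _).
have cG (t : R) : t != 0 -> {for t, continuous (fun t => expR (- t) / t)}.
  move=> t0; apply: has_deriv_continuous; apply: has_derivM; first exact: has_deriv_expRN.
  exact: has_deriv_inv.
have iA : mu.-integrable `[- y, - e] (EFin \o (fun t => expR (- t) / t)).
  apply: continuous_compact_integrable; first exact: segment_compact.
  apply: continuous_in_subspaceT => t /set_mem /=; rewrite in_itv/= => /andP[_ te].
  by apply: cG; rewrite lt_eqF// (le_lt_trans te)// oppr_lt0.
have ie (f : R -> R) : (forall t, 0 < t -> {for t, continuous f}) ->
    mu.-integrable `[e, y] (EFin \o f).
  move=> cf; apply: continuous_compact_integrable; first exact: segment_compact.
  apply: continuous_in_subspaceT => t /set_mem /=; rewrite in_itv/= => /andP[et _].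
  by apply: cf; exact: lt_le_trans et.
rewrite /Defs.Rint integral_setU//; first last.
- apply/disj_setPS => t [] /=; rewrite !in_itv/= andbT => /andP[_ te] et.
  have := le_trans et te; rewrite leNgt => /negP; apply.
  by rewrite (lt_trans _ e0)// oppr_lt0.
- apply/measurable_funU => //; split; first exact: (measurable_int mu).
  exact: (measurable_int mu (integrable_E1 e0)).
rewrite fineD; last 2 first.
- exact: integrable_fin_num.
- by apply: integrable_fin_num => //; exact: integrable_E1.
rewrite [X in _ = _ + X](_ : _ = E1 e)// integration_by_substitution_oppr//; last first.
  apply: continuous_in_subspaceT => t /set_mem /=; rewrite in_itv/= => /andP[_ te].
  by apply: cG; rewrite lt_eqF// (le_lt_trans te)// oppr_lt0.
have -> : E1 e = E1 y + \int[mu]_(t in `[e, y]) (expR (- t) / t).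
  by rewrite [E1 y](Rintegral_itvcyE ey (integrable_E1 e0)) subrK.
rewrite /shi2 Rintegral_itvB ?bnd_simp ?(ltW e0)//; last exact: integrable_sinhc2.
rewrite Rintegral_itv_obnd_cbnd; last first.
  apply: integrableS (integrable_sinhc2 y) => //.
  by apply: subset_itvr; rewrite bnd_simp ltW.
rewrite (_ : fine _ = \int[mu]_(t in `[e, y]) (- (expR t / t))); last first.
  rewrite /Rintegral; congr fine; apply: eq_integral => t _ /=.
  by rewrite opprK invrN mulrN.
have ce (t : R) : 0 < t -> {for t, continuous (fun t => - (expR t / t))}.
  move=> t0; apply: has_deriv_continuous; apply: has_derivN; apply: has_derivM.
    by apply: has_deriv_expR; exact: has_deriv_id.
  by apply: has_deriv_inv; rewrite gt_eqF.
rewrite addrCA; congr (_ + _).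
rewrite -RintegralD//; [|exact: ie ce|exact: ie continuous_expRN_div].
rewrite -mulN1r -RintegralZl//; last exact: ie continuous_sinhc2.
apply: eq_Rintegral => t _; rewrite /sinhc2 mulN1r mulrBl; ring.
Unshelve. all: by end_near. Qed.

End exponential_integral.

(** * Power series of [shi2] and the double series as a tail integral *)

Section shi_series.
Context {R : realType}.
Notation mu := (@lebesgue_measure R).
Implicit Types (x y t : R) (m n : nat).

(** Passage between real series and extended-real sums, where nonnegative series are exchanged with
    integrals by [integral_nneseries]. *)
Lemma nneseries_cvg (a : nat -> R) (l : R) : (forall m, 0 <= a m) ->
  series a @ \oo --> l <-> (\sum_(m <oo) (a m)%:E = l%:E)%E.
Proof.
move=> a0.
have E : (fun n => \sum_(0 <= m < n) (a m)%:E)%E = EFin \o series a.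
  by apply/funext => n; rewrite /= /series/= sumEFin.
split=> [al|al].
  apply/cvg_lim => //; rewrite E; apply/fine_cvgP; split => //.
  exact: nearW.
have : (fun n => \sum_(0 <= m < n) (a m)%:E)%E @ \oo --> l%:E.
  rewrite -al; apply: is_cvg_nneseries => n _ _; exact: a0.
by rewrite E => /fine_cvg.
Qed.

Lemma cvg_sinh_series t :
  series (fun m => 2 * t ^+ (2 * m).+1 / (2 * m).+1`!%:R) @ \oo -->
  expR t - expR (- t).
Proof.
(* The even terms cancel, so the first [n] odd terms are a difference of exponential partial sums of
   length [2 n]. *)
have -> : series (fun m => 2 * t ^+ (2 * m).+1 / (2 * m).+1`!%:R) =
   (fun n => series (exp_coeff t) (2 * n)%N - series (exp_coeff (- t)) (2 * n)%N).
  apply/funext; elim => [|n IH].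
    by rewrite muln0 /series/= !big_geq// subrr.
  rewrite seriesSr IH mulnS !addSn !add0n !seriesSr /exp_coeff/=.
  have E0 : (- t) ^+ (2 * n) = t ^+ (2 * n) by rewrite !exprM sqrrN.
  have E1 : (- t) ^+ (2 * n).+1 = - t ^+ (2 * n).+1 by rewrite exprS E0 mulNr -exprS.
  rewrite E0 E1; move: (_%:R^-1) (_%:R^-1) (t ^+ _) (t ^+ _) (series _ _) (series _ _).
  by move=> a b c d e f; ring.
apply: cvgB.
  apply: (@cvg_comp _ _ _ (fun n => 2 * n)%N (series (exp_coeff t)) _ \oo).
    by apply/cvgnyPge => A; near=> n; rewrite (leq_trans _ (leq_pmull n _))//; near: n; exact: nbhs_infty_ge.
  exact: is_cvg_series_exp_coeff.
apply: (@cvg_comp _ _ _ (fun n => 2 * n)%N (series (exp_coeff (- t))) _ \oo).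
  by apply/cvgnyPge => A; near=> n; rewrite (leq_trans _ (leq_pmull n _))//; near: n; exact: nbhs_infty_ge.
exact: is_cvg_series_exp_coeff.
Unshelve. all: by end_near. Qed.

Lemma cvg_sinhc2_series t : 0 < t ->
  series (fun m => 2 * t ^+ (2 * m) / (2 * m).+1`!%:R) @ \oo --> sinhc2 t.
Proof.
move=> t0.
have -> : series (fun m => 2 * t ^+ (2 * m) / (2 * m).+1`!%:R) =
    (fun n => series (fun m => 2 * t ^+ (2 * m).+1 / (2 * m).+1`!%:R) n / t).
  apply/funext => n; rewrite /series/= mulr_suml; apply: eq_bigr => m _.
  rewrite exprS; have := fact_neq0 (R := R) (2 * m).+1; have := lt0r_neq0 t0.
  by move: ((2 * m).+1`!%:R : R) => c t_neq0 c0; field; rewrite t_neq0 c0.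
by apply: cvgM; [exact: cvg_sinh_series|exact: cvg_cst].
Qed.

Lemma has_int_pow y n : 0 < y -> has_int `[0, y] (fun t => t ^+ n) (y ^+ n.+1 / n.+1%:R).
Proof.
move=> y0; rewrite -[X in has_int _ _ X]subr0.
have {2}-> : 0 = (0 : R) ^+ n.+1 / n.+1%:R by rewrite expr0n/= mul0r.
apply: (has_int_FTC (F := fun t => t ^+ n.+1 / n.+1%:R)) => // t _.
  by apply: has_deriv_continuous; exact: has_derivXn.
apply: eq_has_deriv; first by apply: has_derivZr; exact: has_derivXn.
by rewrite /= mulrAC mulfV ?mul1r// pnatr_eq0.
Qed.

(** Termwise integration of the series of [sinhc2], carried out on []0, y]]: at 0 that series sums
    to 2, not to the default value. *)
Lemma shi2_series y : 0 < y ->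
  series (fun m => 2 / ((2 * m).+1%:R * (2 * m).+1`!%:R) * y ^+ (2 * m).+1) @ \oo --> shi2 y.
Proof.
move=> y0.
have pos m t : 0 <= t -> 0 <= 2 / (2 * m).+1`!%:R * t ^+ (2 * m).
  by move=> t0; rewrite mulr_ge0 ?exprn_ge0.
apply/nneseries_cvg.
  by move=> m; rewrite mulr_ge0 ?exprn_ge0// ltW.
have <- : (\int[mu]_(t in `[0%R, y]) (sinhc2 t)%:E)%E = (shi2 y)%:E.
  rewrite /shi2 /Rintegral fineK//; apply: integrable_fin_num => //.
  exact: integrable_sinhc2.
rewrite -integral_itv_obnd_cbnd; last first.
  apply/measurable_EFinP; apply: measurable_fun_gt0; first exact: continuous_sinhc2.
  exact: subset_itvl.
rewrite [RHS](_ : _ = \int[mu]_(t in `]0%R, y])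
    (\sum_(m <oo) (2 / (2 * m).+1`!%:R * t ^+ (2 * m))%:E))%E; last first.
  apply: eq_integral; move=> t /set_mem /=; rewrite in_itv/= => /andP[t0 _]; apply/esym/nneseries_cvg.
    by move=> m; apply: pos; exact: ltW.
  apply: cvg_trans (cvg_sinhc2_series t0); apply: near_eq_cvg; apply: nearW => n.
  by rewrite /series/=; apply: eq_bigr => m _; rewrite mulrAC.
rewrite integral_nneseries//; last 2 first.
- by move=> m; apply/measurable_EFinP; apply: measurable_funM => //.
- by move=> m t /=; rewrite in_itv/= => /andP[t0 _]; rewrite lee_fin pos// ltW.
apply: eq_eseriesr => m _; have [fi _] := has_int_pow (2 * m) y0.
have H := has_intZ (2 / (2 * m).+1`!%:R) (measurable_itv _) (has_int_pow (2 * m) y0).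
rewrite integral_itv_obnd_cbnd; last first.
  by apply/measurable_EFinP; apply: measurable_funM => //.
rewrite (has_intE _ H)//; congr (_%:E).
have := fact_neq0 (R := R) (2 * m).+1; have : (2 * m).+1%:R != 0 :> R by rewrite pnatr_eq0.
move: ((2 * m).+1`!%:R : R) ((2 * m).+1%:R : R) => c e e0 c0.
by field; rewrite e0 c0.
Qed.

Lemma series_inv_odd_sq_le n : \sum_(0 <= m < n) 2 / (2 * m + 1)%:R ^+ 2 <= 4 :> R.
Proof.
(* The strengthened bound makes the induction work: [2 / (2 n + 1) ^ 2] is at most the increment
   [4 / (n + 1) - 4 / (n + 2)]. *)
suff : \sum_(0 <= m < n) 2 / (2 * m + 1)%:R ^+ 2 <= 4 - 4 / n.+1%:R :> R.
  by move/le_trans; apply; rewrite gerBl.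
elim: n => [|n IH]; first by rewrite big_geq// divr1 subrr.
rewrite big_nat_recr//=; apply: (le_trans (lerD IH (lexx _))).
rewrite natrD natrM -!natr1.
have n0 : 0 <= n%:R :> R by [].
move: (n%:R : R) n0 => {IH} z z0; rewrite -subr_ge0.
have z1 : z + 1 != 0 by rewrite gt_eqF// ltr_wpDl.
have z2 : z + 1 + 1 != 0 by rewrite gt_eqF// ltr_wpDl// addr_ge0.
have z3 : 2 * z + 1 != 0 by rewrite gt_eqF// ltr_wpDl// mulr_ge0.
rewrite (_ : _ - _ = (14 * z ^+ 2 + 10 * z) / ((z + 1) * (z + 1 + 1) * (2 * z + 1) ^+ 2)).
  by rewrite divr_ge0 ?mulr_ge0 ?addr_ge0 ?mulr_ge0 ?exprn_ge0 ?addr_ge0 ?mulr_ge0.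
by field; rewrite z1 z2 z3.
Qed.

(** Each truncated exponential lies between 0 and 1, so the partial sums increase and stay below
    those of [2 / (2 m + 1) ^ 2]. *)
Lemma cvg_dser_t x : 0 <= x ->
  series (fun m => 2 / (2 * m + 1)%:R ^+ 2 * exp_trunc (2 * m) x) @ \oo --> dser_t x.
Proof.
move=> x0; set a := (fun m => _ * _).
have a0 m : 0 <= a m by rewrite mulr_ge0 ?exp_trunc_ge0// divr_ge0// exprn_ge0.
have -> : dser_t x = limn (series a).
  rewrite /dser_t; congr (limn (series _)); apply/funext => m.
  rewrite /a /exp_trunc big_mkord mulrCA mulrA mulr_sumr.
  by apply: eq_bigr => l _; rewrite invfM; ring.
apply: nondecreasing_is_cvgn.
  by apply/nondecreasing_seqP => n; rewrite seriesSr lerDl; exact: a0.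
exists 4 => _ [n _ <-]; apply: le_trans (series_inv_odd_sq_le n).
apply: ler_sum => m _; rewrite ler_piMr ?divr_ge0 ?exprn_ge0//.
by rewrite exp_trunc_le1.
Qed.

Lemma dserE x y : 0 <= x -> 0 <= y -> dser x y = dser_t y - dser_t x.
Proof.
move=> x0 y0; apply/cvg_lim => //.
apply: cvg_trans (cvgB (cvg_dser_t y0) (cvg_dser_t x0)).
apply: near_eq_cvg; apply: nearW => n.
rewrite fctE /series/= -sumrB; apply: eq_bigr => m _.
rewrite /exp_trunc -mulrBr !mulr_sumr -sumrB mulr_sumr big_mkord.
by apply: eq_bigr => l _; rewrite [in RHS]invfM; ring.
Qed.

(** Expand [shi2] in its power series. Since (2m+1) (2m+1)! = (2m+1)^2 (2m)!, term m is 2 / (2m+1)^2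
    times the Gamma(2m+1, 1) density, whose tail is [exp_trunc (2 * m)]. This gives the double
    series an integral meaning. *)
Lemma has_int_dser_t x : 0 < x ->
  has_int `[x, +oo[ (fun y => expR (- y) * shi2 y / y) (dser_t x).
Proof.
move=> x0; have cva := cvg_dser_t (ltW x0).
have a0 m : 0 <= 2 / (2 * m + 1)%:R ^+ 2 * exp_trunc (2 * m) x.
  by rewrite mulr_ge0 ?exp_trunc_ge0 ?ltW// divr_ge0// exprn_ge0.
have cf y : 0 < y -> {for y, continuous (fun y => expR (- y) * shi2 y / y)}.
  move=> y0; apply: has_deriv_continuous; apply: has_derivM.
    by apply: has_derivM; [exact: has_deriv_expRN|exact: has_deriv_shi2].
  by apply: has_deriv_inv; rewrite gt_eqF.
have sub : `[x, +oo[%classic `<=` `]0, +oo[%classic.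
  by apply: subset_itvr; rewrite bnd_simp.
apply: ge0_has_int => //.
- exact: measurable_fun_gt0 cf sub.
- move=> y /sub /=; rewrite in_itv/= andbT => y0.
  by rewrite divr_ge0 ?(ltW y0)// mulr_ge0 ?expR_ge0 ?shi2_ge0.
pose g m y := 2 / (2 * m + 1)%:R ^+ 2 * (y ^+ (2 * m) * expR (- y) / (2 * m)`!%:R).
have g0 m y : 0 < y -> 0 <= g m y.
  move=> y0; rewrite mulr_ge0// ?divr_ge0 ?exprn_ge0//.
  by rewrite mulr_ge0 ?expR_ge0// exprn_ge0// ltW.
rewrite [LHS](_ : _ = \int[mu]_(y in `[x, +oo[) (\sum_(m <oo) (g m y)%:E))%E; last first.
  apply: eq_integral; move=> y /set_mem /sub /=; rewrite in_itv/= andbT => y0; apply/esym/nneseries_cvg.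
    by move=> m; exact: g0.
  have H : (fun n => series (fun m => 2 / ((2 * m).+1%:R * (2 * m).+1`!%:R) * y ^+ (2 * m).+1) n *
      (expR (- y) / y)) @ \oo --> shi2 y * (expR (- y) / y).
    by apply: cvgM; [exact: shi2_series|exact: cvg_cst].
  rewrite [X in _ --> X](_ : _ = shi2 y * (expR (- y) / y)); last by ring.
  apply: cvg_trans H; apply: near_eq_cvg; apply: nearW => n.
  rewrite /series/= mulr_suml; apply: eq_bigr => m _; rewrite /g addn1 factS natrM exprS.
  have := fact_neq0 (R := R) (2 * m); have : (2 * m).+1%:R != 0 :> R by rewrite pnatr_eq0.
  have := lt0r_neq0 y0.
  move: ((2 * m)`!%:R : R) ((2 * m).+1%:R : R) => c e y_neq0 e0 c0.
  by field; rewrite e0 c0 y_neq0.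
rewrite integral_nneseries//; last 2 first.
- move=> m; apply/measurable_EFinP; apply: measurable_fun_gt0 sub => y y0.
  apply: has_deriv_continuous; apply: has_derivZ; apply: has_derivZr.
  by apply: has_derivM; [exact: has_derivXn|exact: has_deriv_expRN].
- by move=> m y /sub /=; rewrite in_itv/= andbT lee_fin; exact: g0.
rewrite -((nneseries_cvg _ a0).1 cva); apply: eq_eseriesr => m _.
by rewrite (has_intE _ (has_intZ _ _ (has_int_gamma_itvcy (2 * m) (ltW x0)))).
Qed.

Lemma has_deriv_dser_t x : 0 < x ->
  has_deriv dser_t x (- (expR (- x) * shi2 x / x)).
Proof.
move=> x0; have x20 : 0 < x / 2 by rewrite divr_gt0.
apply: (has_deriv_near (f := fun y => \int[mu]_(t in `[y, +oo[) (expR (- t) * shi2 t / t))).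
  near=> y; have [|_ <-//] := @has_int_dser_t y.
  by near: y; exact: lt_nbhsr.
apply: (has_deriv_integral_itvcy (a := x / 2)).
- by rewrite ltr_pdivrMr// ltr_pMr// ltr1n.
- by have [] := has_int_dser_t x20.
- apply: has_deriv_continuous; apply: has_derivM.
    by apply: has_derivM; [exact: has_deriv_expRN|exact: has_deriv_shi2].
  by apply: has_deriv_inv; rewrite gt_eqF.
Unshelve. all: by end_near. Qed.

Lemma cvgy_dser_t : dser_t x @[x --> +oo] --> (0 : R).
Proof.
have [fi _] := has_int_dser_t (ltr01 : 0 < 1 :> R).
apply: cvg_trans (cvg_integral_itvcy fi); apply: near_eq_cvg; near=> x.
have [|_ <-//] := @has_int_dser_t x.
by near: x; exact: nbhs_pinfty_gt.
Unshelve. all: by end_near. Qed.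

End shi_series.

(** * Primitives of x^n e^x Ei(-x) for integer n *)

Section Psi_primitives.
Context {R : realType}.
Implicit Types (x u v : R) (m n : nat).

(** The function [expR x * Ei (- x)] for positive [x], written through [E1] so that no principal
    value is involved. *)
Definition expEi x : R := - (expR x * E1 x).

Lemma expEiE x : 0 < x -> expR x * Ei (- x) = expEi x.
Proof. by move=> x0; rewrite EiN// mulrN. Qed.

Lemma has_deriv_expEi x : 0 < x -> has_deriv expEi x (expEi x + x^-1).
Proof.
move=> x0; apply: eq_has_deriv.
  apply: has_derivN; apply: has_derivM; last exact: has_deriv_E1.
  by apply: has_deriv_expR; exact: has_deriv_id.
by rewrite /expEi mulr1 mulrN opprD opprK mulrA expRxMexpNx_1 mul1r.
Qed.

Lemma expEi_bound x : 0 < x -> - x^-1 <= expEi x <= 0.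
Proof.
move=> x0; rewrite lerN2 oppr_le0 mulr_ge0 ?expR_ge0 ?E1_ge0// andbT.
rewrite -[leRHS]mulr1 -(expRxMexpNx_1 x) mulrCA ler_pM2l ?expR_gt0//.
exact: E1_le.
Qed.

(* [- E1] is a primitive of [expR (- x) / x], so one integration by parts
   reduces [expEi x / x] to [expR (- x) * shi2 x / x], whose tail integral is the
   double series [dser_t]. *)
Definition PsiM1 x : R := - E1 x * shi2 x + E1 x ^+ 2 / 2 + dser_t x.

Lemma has_deriv_PsiM1 x : 0 < x -> has_deriv PsiM1 x (x^-1 * expEi x).
Proof.
move=> x0; apply: eq_has_deriv.
  apply: has_derivD; last exact: has_deriv_dser_t.
  apply: has_derivD.
    apply: has_derivM; last exact: has_deriv_shi2.
    by apply: has_derivN; exact: has_deriv_E1.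
  by apply: has_derivZr; apply: has_derivX; exact: has_deriv_E1.
by rewrite /expEi /sinhc2 /= expr1; field; rewrite gt_eqF.
Qed.

Lemma shi2_le x : 0 < x -> shi2 x <= expR x * 2.
Proof.
move=> x0; have H : has_int `[0, x] (fun t => 2 * expR t) (2 * expR x - 2 * expR 0).
  apply: (has_int_FTC (F := fun t => 2 * expR t)) => // t _; last first.
    by apply: has_derivZ; exact: is_derive_expR.
  by apply: has_deriv_continuous; apply: has_derivZ; exact: is_derive_expR.
have [fi fE] := H.
apply: (@le_trans _ _ (2 * expR x - 2 * expR 0)).
  rewrite -fE; apply: le_Rintegral => //; first exact: integrable_sinhc2.
  by move=> t /=; rewrite in_itv/= => /andP[t0 _]; exact: sinhc2_le.
by rewrite mulrC gerBl mulr_ge0 ?expR_ge0.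
Qed.

Lemma cvgy_PsiM1 : PsiM1 x @[x --> +oo] --> (0 : R).
Proof.
rewrite -[X in _ --> X]addr0; apply: cvgD; last exact: cvgy_dser_t.
rewrite -[X in _ --> X]addr0; apply: cvgD.
  rewrite -oppr0; under eq_fun do rewrite mulNr; apply: cvgN.
  (* In the product of the bounds [E1_le] and [shi2_le] the exponentials cancel. *)
  apply: (@squeeze_cvgr _ _ _ _ (fun=> 0) (fun x => 2 * x^-1)); last 2 first.
  - exact: cvg_cst.
  - by rewrite -[X in _ --> X](mulr0 2); apply: cvgM; [exact: cvg_cst|exact: cvgy_inv].
  near=> x; have x0 : 0 < x by near: x; exact: nbhs_pinfty_gt.
  apply/andP; split; first exact: mulr_ge0 (E1_ge0 x0) (shi2_ge0 x).
  apply: (le_trans (ler_pM (E1_ge0 x0) (shi2_ge0 x) (E1_le x0) (shi2_le x0))).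
  rewrite [leLHS](_ : _ = 2 * x^-1 * (expR x * expR (- x))); last by ring.
  by rewrite expRxMexpNx_1 mulr1.
have cE1 : E1 x @[x --> +oo] --> (0 : R).
  apply: (@squeeze_cvgr _ _ _ _ (fun=> 0) (fun x => x^-1)); last 2 first.
  - exact: cvg_cst.
  - exact: cvgy_inv.
  near=> x; have x0 : 0 < x by near: x; exact: nbhs_pinfty_gt.
  rewrite E1_ge0//=; apply: (le_trans (E1_le x0)).
  by rewrite ler_piMr ?invr_ge0 ?(ltW x0)// expR_le1 oppr_le0 ltW.
rewrite -[X in _ --> X](mul0r (2^-1)); apply: cvgM; last exact: cvg_cst.
by rewrite -[X in _ --> X](mul0r 0); apply: cvgM.
Unshelve. all: by end_near. Qed.

(** Since [expEi] has derivative [expEi x + 1 / x], integration by parts gives a primitive at [n] as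
    [x ^ n * expEi x - x ^ n / n] minus [n] times a primitive at [n - 1]; this is the solution of
    that recurrence. The index runs opposite to the one in [Psi]. *)
Definition Psi_pos n x : R := (-1) ^+ n * n`!%:R *
  (\sum_(0 <= j < n.+1) (-1) ^+ j / j`!%:R * (x ^+ j * expEi x)
   - \sum_(0 <= j < n) (-1) ^+ j.+1 / (j.+1%:R * j.+1`!%:R) * x ^+ j.+1 - ln x).

(** The same integration by parts run downwards from [PsiM1], for the exponent [- (m + 1)]. *)
Definition Psi_neg m x : R :=
  (PsiM1 x - \sum_(0 <= j < m) j`!%:R * (x ^- j.+1 * (expEi x + j.+1%:R^-1))) / m`!%:R.

Lemma has_deriv_Psi_pos n x : 0 < x -> has_deriv (Psi_pos n) x (x ^+ n * expEi x).
Proof.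
move=> x0; have xn0 : x != 0 by rewrite gt_eqF.
(* Without the factor (-1)^n n!, passing from [n] to [n + 1] only adds summands. *)
pose A n x := \sum_(0 <= j < n.+1) (-1) ^+ j / j`!%:R * (x ^+ j * expEi x)
   - \sum_(0 <= j < n) (-1) ^+ j.+1 / (j.+1%:R * j.+1`!%:R) * x ^+ j.+1 - ln x.
suff dA : has_deriv (A n) x ((-1) ^+ n / n`!%:R * (x ^+ n * expEi x)).
  apply: eq_has_deriv; first by apply: has_derivZ; exact: dA.
  rewrite mulrA [X in X * _](_ : _ = 1) ?mul1r//.
  rewrite mulrACA -exprMn mulrNN mulr1 expr1n mul1r divff//; exact: fact_neq0.
elim: n => [|n IH].
  have -> : A 0 = fun x => expEi x - ln x.
    by apply/funext => y; rewrite /A big_nat1 big_geq// subr0 !expr0 fact0 divr1 !mul1r.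
  apply: eq_has_deriv.
    by apply: has_derivB; [exact: has_deriv_expEi|exact: has_deriv_ln].
  by rewrite !expr0 fact0 divr1 !mul1r addrK.
have -> : A n.+1 = fun x => A n x + (-1) ^+ n.+1 / n.+1`!%:R *
    (x ^+ n.+1 * expEi x - n.+1%:R^-1 * x ^+ n.+1).
  apply/funext => y; rewrite /A big_nat_recr//= [in X in _ - X - _ = _]big_nat_recr//=.
  by rewrite invfM; ring.
apply: eq_has_deriv.
  apply: has_derivD IH _; apply: has_derivZ; apply: has_derivB.
    by apply: has_derivM; [exact: has_derivXn|exact: has_deriv_expEi].
  by apply: has_derivZ; exact: has_derivXn.
rewrite /= factS natrM !exprS.
have := fact_neq0 (R := R) n; have : n.+1%:R != 0 :> R by rewrite pnatr_eq0.
move: (n`!%:R : R) (n.+1%:R : R) ((-1) ^+ n) (x ^+ n) => a b c e b0 a0.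
by field; rewrite xn0 b0 a0.
Qed.

Lemma has_deriv_Psi_neg m x : 0 < x ->
  has_deriv (Psi_neg m) x (x ^- m.+1 * expEi x).
Proof.
move=> x0; have xn0 : x != 0 by rewrite gt_eqF.
pose A m x := PsiM1 x - \sum_(0 <= j < m) j`!%:R * (x ^- j.+1 * (expEi x + j.+1%:R^-1)).
suff dA : has_deriv (A m) x (m`!%:R * (x ^- m.+1 * expEi x)).
  apply: eq_has_deriv; first by apply: has_derivZr; exact: dA.
  by rewrite mulrAC mulfV ?mul1r ?fact_neq0.
elim: m => [|m IH].
  have -> : A 0 = PsiM1 by apply/funext => y; rewrite /A big_geq// subr0.
  by rewrite fact0 mul1r expr1; exact: has_deriv_PsiM1.
have -> : A m.+1 = fun x => A m x - m`!%:R * (x ^- m.+1 * (expEi x + m.+1%:R^-1)).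
  by apply/funext => y; rewrite /A big_nat_recr//= opprD addrA.
apply: eq_has_deriv.
  apply: has_derivB IH _; apply: has_derivZ; apply: has_derivM.
    by apply: has_derivV; [rewrite expf_neq0|exact: has_derivXn].
  by apply: has_derivD; [exact: has_deriv_expEi|exact: has_deriv_cst].
rewrite /= factS natrM !exprS.
have : m.+1%:R != 0 :> R by rewrite pnatr_eq0.
have : x ^+ m != 0 by rewrite expf_neq0.
move: (m`!%:R : R) (m.+1%:R : R) (x ^+ m) => a b c c0 b0.
by field; rewrite xn0 b0 c0.
Qed.

(** Because the primitive vanishes at infinity, [Psit] is the improper integral from [u] to
    infinity, with no constant left over. *)
Lemma cvgy_Psi_neg m : Psi_neg m x @[x --> +oo] --> (0 : R).
Proof.
have cg : expEi x @[x --> +oo] --> (0 : R).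
  apply: (@squeeze_cvgr _ _ _ _ (fun x => - x^-1) (fun=> 0)); last 2 first.
  - by rewrite -oppr0; apply: cvgN; exact: cvgy_inv.
  - exact: cvg_cst.
  near=> x; have x0 : 0 < x by near: x; exact: nbhs_pinfty_gt.
  exact: expEi_bound.
rewrite -[X in _ --> X](mul0r (m`!%:R^-1)); apply: cvgM; last exact: cvg_cst.
rewrite -[X in _ --> X]subr0; apply: cvgB; first exact: cvgy_PsiM1.
elim: m => [|m IH].
  by under eq_fun do rewrite big_geq//; exact: cvg_cst.
rewrite (_ : (fun x => _) = (fun x =>
    \sum_(0 <= j < m) j`!%:R * (x ^- j.+1 * (expEi x + j.+1%:R^-1)) +
    m`!%:R * (x ^- m.+1 * (expEi x + m.+1%:R^-1)))); last first.
  by apply/funext => x; rewrite big_nat_recr.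
rewrite -[X in _ --> X]addr0; apply: cvgD => //.
rewrite -[X in _ --> X](mulr0 (m`!%:R)); apply: cvgM; first exact: cvg_cst.
rewrite -[X in _ --> X](mul0r (0 + m.+1%:R^-1)); apply: cvgM; last first.
  by apply: cvgD => //; exact: cvg_cst.
elim: m {IH} => [|m IH].
  by rewrite (_ : (fun x => _) = fun x => x^-1)//; exact: cvgy_inv.
rewrite (_ : (fun x => _) = fun x => x^-1 * x ^- m.+1); last first.
  by apply/funext => x; rewrite exprS invfM.
by rewrite -[X in _ --> X](mul0r 0); apply: cvgM => //; exact: cvgy_inv.
Unshelve. all: by end_near. Qed.

Definition Psi_prim (n : int) : R -> R :=
  match n with Posz n => Psi_pos n | Negz m => Psi_neg m end.

Lemma has_deriv_Psi_prim (n : int) x : 0 < x ->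
  has_deriv (Psi_prim n) x (x ^ n * expEi x).
Proof.
by case: n => [n|m] x0; [exact: has_deriv_Psi_pos|exact: has_deriv_Psi_neg].
Qed.

Lemma sum_nat_rev1 m (F : nat -> R) :
  \sum_(1 <= k < m.+1) F k = \sum_(0 <= j < m) F (m - j)%N.
Proof.
rewrite big_nat_rev/= big_add1/=; apply: eq_bigr => j _.
by rewrite add1n !subSS.
Qed.

Lemma exprzN_sub m j x : (j < m)%N -> x ^ (Negz m + (m - j)%N%:Z) = x ^- j.+1.
Proof.
by move=> jm; rewrite (_ : Negz m + _ = Negz j)//; rewrite !NegzE; lia.
Qed.

(** Identifies [Psi n u v] as the integral of [x ^ n * expR x * Ei (- x)] from [u] to [v]. Where
    sums occur their index is reversed, and the products of [Ei] come from
    [Ei y = shi2 y - E1 y]. *)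
Lemma Psi_primE (n : int) u v : 0 < u -> 0 < v ->
  Psi n u v = Psi_prim n v - Psi_prim n u.
Proof.
move=> u0 v0; case: n => [[|n]|[|m]].
- rewrite /= /Psi_pos !big_nat1 !big_geq// !expr0 fact0 divr1 !mul1r !subr0 !expEiE//.
  by rewrite ln_div// ; ring.
- set N := n.+1.
  rewrite /= -/N /Psi_pos ln_div//.
  rewrite [X in X - _ - _](_ : _ = (-1) ^+ N * N`!%:R *
    (\sum_(0 <= j < N.+1) (-1) ^+ j / j`!%:R * (v ^+ j * expEi v - u ^+ j * expEi u))); last first.
    rewrite big_nat_rev/= mulr_sumr big_nat [RHS]big_nat; apply: eq_bigr => j /andP[_ jN].
    (* Signs are compared through parity, which turns the truncated difference in the exponent into
       a sum. *)
    rewrite add0n subSS subKn// -!mulrA !expEiE// -signr_odd oddB// signr_addb !signr_odd.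
    ring.
  rewrite [X in _ - X - _](_ : _ = (-1) ^+ N * N`!%:R *
    (\sum_(0 <= j < N) (-1) ^+ j.+1 / (j.+1%:R * j.+1`!%:R) * (v ^+ j.+1 - u ^+ j.+1))); last first.
    rewrite big_nat_rev/= mulr_sumr big_nat [RHS]big_nat; apply: eq_bigr => j /andP[_ jN].
    rewrite add0n subKn// -signr_odd oddB// signr_addb !signr_odd.
    ring.
  under eq_bigr do rewrite mulrBr; rewrite sumrB.
  under [\sum_(0 <= j < N) _ * (_ - _)]eq_bigr do rewrite mulrBr; rewrite sumrB.
  ring.
- rewrite /= /Psi_neg !big_geq// fact0 !divr1 /PsiM1 !EiN// !EiE// dserE ?ltW//; by field.
- set N := m.+1; rewrite [RHS]/= /Psi_neg.
  rewrite /= -/N !sum_nat_rev1 !EiN// !EiE// dserE ?ltW//.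
  have fN := fact_neq0 (R := R) N.
  rewrite [X in X + _ + _ + _ + _](_ : _ = - (N`!%:R)^-1 *
     \sum_(0 <= j < N) j`!%:R * (v ^- j.+1 * expEi v - u ^- j.+1 * expEi u)); last first.
    rewrite mulr_sumr big_nat [RHS]big_nat; apply: eq_bigr => j /andP[_ jN].
    by rewrite !exprzN_sub// subKn 1?ltnW// /expEi; ring.
  rewrite [X in _ + X + _ + _](_ : _ = - (N`!%:R)^-1 *
     \sum_(0 <= j < N) j`!%:R * (v ^- j.+1 / j.+1%:R - u ^- j.+1 / j.+1%:R)); last first.
    rewrite mulr_sumr big_nat [RHS]big_nat; apply: eq_bigr => j /andP[_ jN].
    rewrite !exprzN_sub// subKn 1?ltnW//.
    rewrite (_ : Negz N + (N - j)%N%:Z = - (j.+1%:Z)) ?rmorphN/= -?pmulrn; last by lia.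
    by rewrite mulrN invrN mulrN invfM -mulrBl; ring.
  under [\sum_(0 <= j < N) _ * (_ / _ - _)]eq_bigr do rewrite mulrBr.
  under [\sum_(0 <= j < N) _ * (_ * _ - _ * expEi _)]eq_bigr do rewrite mulrBr.
  under [\sum_(0 <= j < N) _ * (_ * (expEi v + _))]eq_bigr do rewrite !mulrDr.
  under [\sum_(0 <= j < N) _ * (_ * (expEi u + _))]eq_bigr do rewrite !mulrDr.
  rewrite !sumrB !big_split /PsiM1 /=.
  by field.
Qed.

Lemma Psit_primE m u : (0 < m)%N -> 0 < u -> Psit (Negz m) u = - Psi_neg m u.
Proof.
move=> m0 u0; rewrite /Psit /Psi_neg.
have -> : (`|Negz m| - 1)%N = m by lia.
rewrite !sum_nat_rev1 !EiN// !EiE//.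
rewrite [\sum_(0 <= j < m) _ * (_ * (_ + _))](_ : _ =
  (\sum_(0 <= j < m) j`!%:R * u ^- j.+1) * expEi u +
  \sum_(0 <= j < m) j`!%:R * (u ^- j.+1 / j.+1%:R)); last first.
  by rewrite mulr_suml -big_split; apply: eq_bigr => j _ /=; ring.
rewrite [\sum_(0 <= j < m) (_ * _ ^ _)](_ : _ = \sum_(0 <= j < m) j`!%:R * u ^- j.+1); last first.
  by rewrite big_nat [RHS]big_nat; apply: eq_bigr => j /andP[_ jm]; rewrite exprzN_sub// subKn 1?ltnW.
rewrite [\sum_(0 <= j < m) (_ / (_ * _%:~R))](_ : _ = - (m`!%:R)^-1 *
   \sum_(0 <= j < m) j`!%:R * (u ^- j.+1 / j.+1%:R)); last first.
  rewrite mulr_sumr big_nat [RHS]big_nat; apply: eq_bigr => j /andP[_ jm].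
  rewrite !exprzN_sub// subKn 1?ltnW//.
  rewrite (_ : Negz m + (m - j)%N%:Z = - (j.+1%:Z)) ?rmorphN/= -?pmulrn; last by lia.
  by rewrite mulrN invrN mulrN invfM; ring.
have fm := fact_neq0 (R := R) m.
by rewrite /PsiM1 /expEi; field.
Qed.

End Psi_primitives.

(** * Integrals of C / (1 + C s)^q against e^(-s) *)

Section expint_transform.
Context {R : realType}.
Notation mu := (@lebesgue_measure R).
Implicit Types (C x p c s : R) (q : nat).

Lemma ge0_integral_affine (G : R -> R) p c : 0 < c ->
  (forall t, p <= t -> {for t, continuous G}) ->
  (forall t, p <= t -> 0 <= G t) ->
  (\int[mu]_(t in `[p, +oo[) (G t)%:E =
   \int[mu]_(s in `[0%R, +oo[) (c * G (p + c * s))%:E)%E.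
Proof.
move=> c0 cG G0; pose F s := p + c * s.
have dF s : has_deriv F s c.
  apply: eq_has_deriv.
    by apply: has_derivD; [exact: has_deriv_cst|apply: has_derivZ; exact: has_deriv_id].
  by rewrite add0r mulr1.
have F' : F^`()%classic = cst c.
  by apply/funext => s; rewrite derive1E; have [_ ->] := dF s.
have F0 : F 0 = p by rewrite /F mulr0 addr0.
rewrite -{1}F0 (@increasing_ge0_integration_by_substitutiony _ F G 0).
- by apply: eq_integral => s _ /=; rewrite F' mulrC.
- by move=> s t _ _; rewrite /F ltrD2l ltr_pM2l.
- by rewrite F' => s _; exact: cst_continuous.
- by rewrite F'; exact: is_cvg_cst.
- by rewrite F'; exact: is_cvg_cst.
- split; first by move=> s _; have [] := dF s.
  by apply: cvg_at_right_filter; exact: has_deriv_continuous (dF 0).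
- apply/cvgryPgt => A; near=> s; rewrite /F -ltrBlDl mulrC -ltr_pdivrMr//.
  by near: s; apply: nbhs_pinfty_gt; exact: num_real.
- rewrite F0; apply: continuous_in_subspaceT => t /set_mem /=.
  by rewrite in_itv/= andbT; exact: cG.
- by rewrite F0 => t; rewrite in_itv/= andbT => /ltW; exact: G0.
Unshelve. all: by end_near. Qed.

(** For [C > 0] this is [expR (1 / C) * Eq_int q (1 / C)]. The factor [C] in the numerator makes it
    0 at [C = 0], a value that occurs at [Z = 0]. *)
Definition expint q C : R :=
  \int[mu]_(s in `]0, +oo[) (C / (1 + C * s) ^+ q * expR (- s)).

Lemma affine_gt0 C s : 0 <= C -> 0 <= s -> 0 < 1 + C * s.
Proof. by move=> C0 s0; rewrite ltr_pwDl// mulr_ge0. Qed.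

Lemma has_deriv_affineVX q C s : 0 <= C -> 0 <= s ->
  has_deriv (fun s => ((1 + C * s) ^+ q)^-1) s (- (q%:R * C / (1 + C * s) ^+ q.+1)).
Proof.
move=> C0 s0; have h := affine_gt0 C0 s0; apply: eq_has_deriv.
  apply: has_derivV; first by rewrite expf_neq0// gt_eqF.
  apply: has_derivX; apply: has_derivD; first exact: has_deriv_cst.
  by apply: has_derivZ; exact: has_deriv_id.
rewrite add0r mulr1; case: q => [|q]; first by rewrite !mul0r oppr0 mul0r.
rewrite /= (exprS _ q.+1) (exprS _ q); set t := 1 + _ in h *.
have t0 := lt0r_neq0 h; have : t ^+ q != 0 by rewrite expf_neq0.
move: (t ^+ q) (q.+1%:R : R) => u v u0.
by field; rewrite u0 t0.
Qed.

Lemma has_int_expint_cy q C : 0 <= C ->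
  has_int `[0, +oo[ (fun s => C / (1 + C * s) ^+ q * expR (- s)) (expint q C).
Proof.
move=> C0.
have fi : mu.-integrable `[0, +oo[ (EFin \o (fun s => C / (1 + C * s) ^+ q * expR (- s))).
  have [fi _] := has_intZ C (measurable_itv _) (has_int_expRN (lexx (0 : R))).
  apply: le_integrable fi => //.
    apply/measurable_EFinP; apply: subspace_continuous_measurable_fun => //.
    apply: continuous_in_subspaceT => s /set_mem /=; rewrite in_itv/= andbT => s0.
    apply: has_deriv_continuous; apply: has_derivM; last exact: has_deriv_expRN.
    by apply: has_derivZ; exact: has_deriv_affineVX.
  move=> s /=; rewrite in_itv/= andbT => s0.
  have h := affine_gt0 C0 s0.
  have hq : 1 <= (1 + C * s) ^+ q by rewrite exprn_ege1// lerDl mulr_ge0.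
  have hq0 := lt_le_trans ltr01 hq.
  by rewrite lee_fin !normrM ler_wpM2r// ler_piMr// normfV (gtr0_norm hq0) invf_le1.
split=> //; rewrite /expint Rintegral_itv_obnd_cbnd//.
by apply: integrableS fi => //; apply: subset_itvr; rewrite bnd_simp.
Qed.

Lemma has_int_expint q C : 0 <= C ->
  has_int `]0, +oo[ (fun s => C / (1 + C * s) ^+ q * expR (- s)) (expint q C).
Proof. by move=> C0; apply: has_int_itvoy; exact: has_int_expint_cy. Qed.

(** Integration by parts: the combined integrand is the derivative of
    [- (1 + C s) ^ (- q) * expR (- s)], which rises from -1 to 0. *)
Lemma expint_rec q C : 0 < C -> expint q C / C + q%:R * expint q.+1 C = 1.
Proof.
move=> C0.
have H : has_int `[0, +oo[ (fun s => C^-1 * (C / (1 + C * s) ^+ q * expR (- s)) +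
    q%:R * (C / (1 + C * s) ^+ q.+1 * expR (- s))) (expint q C / C + q%:R * expint q.+1 C).
  rewrite [expint q C / C]mulrC.
  by apply: has_intD => //; apply: has_intZ => //; apply: has_int_expint_cy; exact: ltW.
have [_ <-] := H; pose F s := - (((1 + C * s) ^+ q)^-1 * expR (- s)).
have [||||_ ->] := @has_int_FTCy R 0 0 (fun s => C^-1 * (C / (1 + C * s) ^+ q * expR (- s)) +
    q%:R * (C / (1 + C * s) ^+ q.+1 * expR (- s))) F.
- move=> s s0; have h := affine_gt0 (ltW C0) s0.
  by rewrite addr_ge0// !mulr_ge0 ?invr_ge0 ?exprn_ge0 ?expR_ge0// ltW.
- move=> s s0; have D r : has_deriv (fun s => C / (1 + C * s) ^+ r * expR (- s)) s
      (C * - (r%:R * C / (1 + C * s) ^+ r.+1) * expR (- s) + C / (1 + C * s) ^+ r * - expR (- s)).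
    apply: has_derivM; last exact: has_deriv_expRN.
    by apply: has_derivZ; apply: has_deriv_affineVX => //; exact: ltW.
  by apply: has_deriv_continuous; apply: has_derivD; apply: has_derivZ; exact: D.
- move=> s s0; apply: eq_has_deriv.
    apply: has_derivN; apply: has_derivM; last exact: has_deriv_expRN.
    by apply: has_deriv_affineVX => //; exact: ltW.
  have t0 := lt0r_neq0 (affine_gt0 (ltW C0) s0); have c0 := lt0r_neq0 C0.
  rewrite exprS; set t := 1 + C * s in t0 *.
  have : t ^+ q != 0 by rewrite expf_neq0.
  move: (t ^+ q) => u u0.
  by field; rewrite u0 t0.
- rewrite -oppr0; apply: cvgN.
  apply: (@squeeze_cvgr _ _ _ _ (fun=> 0) (fun s => expR (- s))); last 2 first.
  + exact: cvg_cst.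
  + exact: cvgr_expR.
  near=> s; have s0 : 0 <= s by near: s; exact: nbhs_pinfty_ge.
  have h := affine_gt0 (ltW C0) s0.
  rewrite mulr_ge0 ?expR_ge0 ?invr_ge0 ?exprn_ge0 ?(ltW h)//= ler_piMl ?expR_ge0//.
  by rewrite invf_le1 ?exprn_gt0// exprn_ege1// lerDl mulr_ge0// ltW.
- by rewrite /F mulr0 addr0 expr1n invr1 mul1r oppr0 expR0 opprK add0r.
Unshelve. all: by end_near. Qed.

(** Substitute [t = 1 + C s]. *)
Lemma expint_Eq_int q C : 0 < C -> expint q C = expR C^-1 * Eq_int q C^-1.
Proof.
move=> C0; have [fi E] := has_intZ (expR (- C^-1)) (measurable_itv _) (has_int_expint_cy q (ltW C0)).
rewrite /Eq_int /Defs.Rint (@ge0_integral_affine _ 1 C)//.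
- rewrite (_ : fine _ = expR (- C^-1) * expint q C).
    by rewrite mulrA expRxMexpNx_1 mul1r.
  rewrite -E /Rintegral; congr fine; apply: eq_integral => s _; congr (_%:E).
  rewrite (_ : C^-1 * (1 + C * s) = C^-1 + s) ?opprD ?expRD; last by field; rewrite gt_eqF.
  ring.
- move=> t t1; apply: has_deriv_continuous; apply: has_derivM; last first.
    by apply: has_derivV; [rewrite expf_neq0// gt_eqF// (lt_le_trans ltr01)|exact: has_derivXn].
  by apply: has_deriv_expR; apply: has_derivN; apply: has_derivZ; exact: has_deriv_id.
- by move=> t t1; rewrite divr_ge0 ?expR_ge0// exprn_ge0// (le_trans ler01).
Qed.

(** Substitute [t = 1 / C + s]. *)
Lemma expint1 C : 0 < C -> expint 1 C = - expEi C^-1.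
Proof.
move=> C0; have [fi E] := has_intZ (expR (- C^-1)) (measurable_itv _) (has_int_expint_cy 1 (ltW C0)).
have x0 : 0 < C^-1 by rewrite invr_gt0.
rewrite /expEi opprK /E1 /Rintegral (@ge0_integral_affine _ _ 1)//.
- rewrite [X in _ = _ * X](_ : fine _ = expR (- C^-1) * expint 1 C).
    by rewrite mulrA expRxMexpNx_1 mul1r.
  rewrite -E /Rintegral; congr fine; apply: eq_integral => s /set_mem /=.
  rewrite in_itv/= andbT => s0; congr (_%:E).
  have := lt0r_neq0 (affine_gt0 (ltW C0) s0); have := lt0r_neq0 C0.
  rewrite !mul1r opprD expRD expr1 => c0 h0; field.
  by rewrite h0 c0.
- by move=> t xt; apply: continuous_expRN_div; exact: lt_le_trans xt.
- by move=> t xt; rewrite divr_ge0 ?expR_ge0// (le_trans (ltW x0)).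
Qed.

(** Iterates [expint_rec] down to order 1, where the exponential integral remains; the terms
    collected on the way are rational in [C] and lead to [I3]. *)
Lemma expint_closed q C : 0 < C -> (0 < q)%N ->
  expint q C = (- C^-1) ^+ (q - 1) / (q - 1)`!%:R * expint 1 C +
    \sum_(0 <= s < (q - 1)) (- C^-1) ^+ s * (q - s - 2)`!%:R / (q - 1)`!%:R.
Proof.
move=> C0; case: q => // q _; rewrite subn1 /=; elim: q => [|q IH].
  by rewrite big_geq// expr0 fact0 divr1 mul1r addr0.
have q0 : q.+1%:R != 0 :> R by rewrite pnatr_eq0.
have -> : expint q.+2 C = (1 - C^-1 * expint q.+1 C) / q.+1%:R.
  by rewrite -[X in X - _](expint_rec q.+1 C0) [C^-1 * _]mulrC addrAC subrr add0r mulrAC mulfV// mul1r.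
rewrite IH big_nat_recl//= subn0 subn2/= expr0 mul1r.
have f0 := fact_neq0 (R := R) q.
rewrite (_ : \sum_(0 <= i < q) (- C^-1) ^+ i.+1 * _ / _ = - C^-1 / q.+1%:R *
   \sum_(0 <= s < q) (- C^-1) ^+ s * (q.+1 - s - 2)`!%:R / q`!%:R); last first.
  rewrite mulr_sumr; apply: eq_bigr => s _; rewrite !subSS exprS factS natrM.
  by rewrite invfM; ring.
rewrite factS natrM exprS; move: (\sum_(_ <= _ < _) _) (expint 1 C) (_ ^+ q) => u v w.
move: (q.+1%:R : R) q0 (q`!%:R : R) f0 => {IH} e e0 d d0.
by field; rewrite e0 d0 gt_eqF.
Qed.

End expint_transform.

(** * The integrals over [0, 1] behind [I1], [I2] and [I3] *)

Section Theta_integral.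
Context {R : realType}.
Notation mu := (@lebesgue_measure R).
Implicit Types (a b z : R).

Lemma has_deriv_invM a b z : a * z + b != 0 ->
  has_deriv (fun z => (a * z + b)^-1) z (- a / (a * z + b) ^+ 2).
Proof.
move=> h; apply: has_derivV => //; apply: eq_has_deriv.
  by apply: has_derivD; [apply: has_derivZ; exact: has_deriv_id|exact: has_deriv_cst].
by rewrite mulr1 addr0.
Qed.

Lemma ex_has_deriv_exprz (f : R -> R) (n : int) z df : f z != 0 ->
  has_deriv f z df -> exists d, has_deriv (fun z => f z ^ n) z d.
Proof.
move=> fz0 fd; case: n => n.
  by exists (n%:R * f z ^+ n.-1 * df); exact: has_derivX.
eexists; apply: has_derivV; first by rewrite expf_neq0.
by apply: has_derivX; exact: fd.
Qed.

(** With [x = 1 / (a z + b)] one has [dx = - a x ^ 2 dz], hence the shift of the exponent by 2. *)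
Lemma has_deriv_Psi_prim_inv (n : int) a b z : 0 < a * z + b ->
  has_deriv (fun z => - Psi_prim n ((a * z + b)^-1)) z
    (a * (a * z + b)^-1 ^ (n + 2) * expEi ((a * z + b)^-1)).
Proof.
move=> h; have h0 := lt0r_neq0 h; apply: eq_has_deriv.
  apply: has_derivN; apply: (has_deriv_chain (f := Psi_prim n)).
    by apply: has_deriv_Psi_prim; rewrite invr_gt0.
  exact: has_deriv_invM.
by rewrite expfzDr ?invr_eq0// -exprnP exprVn; ring.
Qed.

Lemma continuous_expEi_inv (n : int) a b z : 0 < a * z + b ->
  {for z, continuous (fun z => a * (a * z + b)^-1 ^ n * expEi ((a * z + b)^-1))}.
Proof.
move=> h; have h0 := lt0r_neq0 h.
have dg : has_deriv (fun z => expEi ((a * z + b)^-1)) z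
    ((expEi ((a * z + b)^-1) + (a * z + b)^-1^-1) * (- a / (a * z + b) ^+ 2)).
  apply: (has_deriv_chain (f := @expEi R)); last exact: has_deriv_invM.
  by apply: has_deriv_expEi; rewrite invr_gt0.
have [|d dn] := @ex_has_deriv_exprz _ n z _ _ (has_deriv_invM h0).
  by rewrite invr_eq0.
by apply: has_deriv_continuous; apply: has_derivM dg; apply: has_derivZ; exact: dn.
Qed.

(** The ends [z = 0] and [z = 1] go to [1 / b] and [1 / (a + b)]; the minus sign of the primitive
    absorbs the reversal. *)
Lemma has_int_Psi_term (n : int) a b : 0 < a -> 0 < b ->
  has_int `[0, 1] (fun z => a * (a * z + b)^-1 ^ (n + 2) * expEi ((a * z + b)^-1))
    (Psi n (a + b)^-1 b^-1).
Proof.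
move=> a0 b0; rewrite Psi_primE ?invr_gt0// ?addr_gt0//.
have pos z : 0 <= z <= 1 -> 0 < a * z + b.
  by move=> /andP[z0 _]; rewrite ltr_wpDl// mulr_ge0// ltW.
have H := @has_int_FTC R 0 1 _ (fun z => - Psi_prim n ((a * z + b)^-1)) ltr01
  (fun z h => @continuous_expEi_inv (n + 2) a b z (pos z h))
  (fun z h => @has_deriv_Psi_prim_inv n a b z (pos z h)).
by move: H; rewrite mulr1 mulr0 add0r opprK [- _ + _]addrC.
Qed.

(** The case [b = 0]: now [z = 0] corresponds to infinite [x], so the improper [Psit] replaces
    [Psi]. The exponent of [x] is [- (m + 1) + 2], which gives the power [m - 1] of [a z]. *)
Lemma has_int_Psit_term a m : 0 < a -> (1 < m)%N ->
  has_int `[0, 1] (fun z => a * (a * z) ^+ m.-1 * expEi ((a * z)^-1))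
    (Psit (Negz m) a^-1).
Proof.
move=> a0 m1; have m0 := ltnW m1; rewrite Psit_primE ?invr_gt0//.
set f := fun z => _.
have fE z : f z = a * (a * z + 0)^-1 ^ (Negz m + 2) * expEi ((a * z + 0)^-1).
  rewrite /f addr0 (_ : Negz m + 2 = - (m.-1)%:Z); last by lia.
  by rewrite -exprnN exprVn invrK.
have cf z : 0 < z -> {for z, continuous f}.
  move=> z0; rewrite (funext fE); apply: continuous_expEi_inv.
  by rewrite addr0 mulr_gt0.
(* At 0 the primitive is given its limit, 0 by [cvgy_Psi_neg]; the formula itself would divide by
   zero there. *)
pose P z := if z <= 0 then 0 else - Psi_prim (Negz m) ((a * z + 0)^-1).
have Pnear z : 0 < z -> \near z, P z = - Psi_prim (Negz m) ((a * z + 0)^-1).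
  move=> z0; near=> y; rewrite /P ifF//; apply/negbTE; rewrite -ltNge.
  by near: y; exact: lt_nbhsr.
have dP z : 0 < z -> has_deriv P z (f z).
  move=> z0; apply: (has_deriv_near (Pnear _ z0)); rewrite fE.
  by apply: has_deriv_Psi_prim_inv; rewrite addr0 mulr_gt0.
have f0 : f 0 = 0 by rewrite /f mulr0 expr0n -subn1 subn_eq0 leqNgt m1/= mulr0 mul0r.
have -> : - Psi_neg m a^-1 = P 1 - P 0.
  by rewrite /P lexx ler10 subr0 mulr1 addr0.
apply: has_int_FTC2 => //.
- apply/continuous_within_itvP => //; split.
  + by move=> z; rewrite in_itv/= => /andP[z0 _]; exact: cf.
  + have H0 : a * (a * z) ^+ m @[z --> 0^'+] --> (0 : R).
      have E : a * (a * 0) ^+ m = 0 by rewrite mulr0 expr0n gtn_eqF ?mulr0.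
      have dH : has_deriv (fun z => a * (a * z) ^+ m) 0 (a * (m%:R * (a * 0) ^+ m.-1 * (a * 1))).
        by apply: has_derivZ; apply: has_derivX; apply: has_derivZ; exact: has_deriv_id.
      rewrite -[X in _ --> X]E; apply: cvg_at_right_filter.
      exact: has_deriv_continuous dH.
    (* The bounds are [- 1 / x <= expEi x <= 0] at [x = 1 / (a z)]; the lower one supplies the extra
       factor [a z]. *)
    rewrite f0; apply: (@squeeze_cvgr _ _ _ _ (fun z => - (a * (a * z) ^+ m)) (fun=> 0)); last 2 first.
    * by rewrite -[X in _ --> X]oppr0; apply: cvgN.
    * exact: cvg_cst.
    near=> z; have z0 : 0 < z by near: z; exact: nbhs_right_gt.
    have az : 0 < a * z by exact: mulr_gt0.
    have iaz : 0 < (a * z)^-1 by rewrite invr_gt0.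
    have /andP[gl gr] := expEi_bound iaz.
    have c0 : 0 <= a * (a * z) ^+ m.-1 by rewrite mulr_ge0 ?exprn_ge0// ltW.
    rewrite /f mulr_ge0_le0// andbT.
    have -> : - (a * (a * z) ^+ m) = a * (a * z) ^+ m.-1 * - (a * z).
      by rewrite -{1}(prednK m0) exprS; ring.
    by rewrite ler_wpM2l// -[a * z in leLHS]invrK.
  + by apply: cvg_at_left_filter; exact: cf.
- by move=> z; rewrite in_itv/= => /andP[z0 _]; exact: dP.
- have -> : P 0 = - 0 by rewrite /P lexx oppr0.
  have H : - Psi_prim (Negz m) ((a * z + 0)^-1) @[z --> 0^'+] --> - (0 : R).
    apply: cvgN; apply: (@cvg_comp _ _ _ (fun z => (a * z + 0)^-1) (Psi_neg m) _ (pinfty_nbhs R)).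
      apply/cvgrVy.
        near=> z; rewrite addr0 mulr_gt0//; near: z; exact: nbhs_right_gt.
      have E : a * 0 + 0 = 0 by rewrite mulr0 addr0.
      have dH : has_deriv (fun z => a * z + 0) 0 (a * 1 + 0).
        apply: has_derivD; last exact: has_deriv_cst.
        by apply: has_derivZ; exact: has_deriv_id.
      rewrite -[X in _ --> X]E; apply: cvg_at_right_filter.
      exact: has_deriv_continuous dH.
    exact: cvgy_Psi_neg.
  apply: cvg_trans H; apply: near_eq_cvg; near=> z.
  rewrite /P ifF//; apply/negbTE; rewrite -ltNge; near: z; exact: nbhs_right_gt.
- by apply: cvg_at_left_filter; exact: has_deriv_continuous (dP _ ltr01).
Unshelve. all: by end_near. Qed.

Lemma expr_onem_sum n z : (1 - z) ^+ n = \sum_(0 <= t < n.+1) 'C(n, t)%:R * (-1) ^+ t * z ^+ t.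
Proof.
rewrite exprBn big_mkord; apply: eq_bigr => i _.
by rewrite expr1n mulr1 -mulr_natl mulrA.
Qed.

(** Expanding [(1 - z) ^ (M - 2)] raises the power of [a z] to [M - 1 + t], which is the index
    [- M - 1 - t] of [Psit]. *)
Lemma has_int_I1 M a : 0 < a -> (1 < M)%N ->
  has_int `[0, 1] (fun z => (1 - z) ^+ (M - 2) * (a * z) ^+ (M - 1) * expEi ((a * z)^-1))
    (I1 M a).
Proof.
move=> a0 M1.
apply: (eq_has_int (g := fun z => \sum_(0 <= t < (M - 2).+1)
    'C(M - 2, t)%:R * (-1) ^+ t / a ^+ t.+1 *
      (a * (a * z) ^+ (M + t).-1 * expEi ((a * z)^-1)))) => //.
  move=> z _; rewrite expr_onem_sum !mulr_suml; apply: eq_bigr => t _.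
  rewrite (_ : (M + t).-1 = (M - 1 + t)%N); last by lia.
  rewrite exprD [(a * z) ^+ t]exprMn exprS.
  have at0 : a ^+ t != 0 by rewrite expf_neq0// gt_eqF.
  by field; rewrite at0 gt_eqF.
apply: has_int_sum => // t _; apply: has_intZ => //.
rewrite (_ : - M%:Z - 1 - t%:Z = Negz (M + t)%N); last by lia.
by apply: has_int_Psit_term => //; rewrite (leq_trans M1)// leq_addr.
Qed.

(** After [(1 - z) ^ (M - 2)] is expanded, the powers of [a z] are written as powers of [C - b] with
    [C = a z + b] and expanded again, so that only powers of [C] are left for [has_int_Psi_term].
    Hence the double binomial sum. *)
Lemma has_int_I2 M a b p q : 0 < a -> 0 < b -> (0 < p)%N -> (1 < M)%N ->
  has_int `[0, 1] (fun z => (1 - z) ^+ (M - 2) * (a * z) ^+ (p - 1) *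
      ((a * z + b) ^ (2 - q%:Z) * expEi ((a * z + b)^-1)))
    (I2 M a b p q).
Proof.
move=> a0 b0 p0 M1.
apply: (eq_has_int (g := fun z => \sum_(0 <= r < (M - 2).+1) \sum_(0 <= t < (p - 1 + r).+1)
    ('C(M - 2, r)%:R * 'C(p - 1 + r, t)%:R *
     (-1) ^ (p%:Z - 1 - t%:Z) * b ^+ (p - 1 + r - t) / a ^+ r.+1 *
     (a * (a * z + b)^-1 ^ ((q%:Z - 4 - t%:Z) + 2) * expEi ((a * z + b)^-1))))) => //.
  move=> z /=; rewrite in_itv/= => /andP[z0 _].
  set C := a * z + b; have C0 : 0 < C by rewrite ltr_wpDl// mulr_ge0// ltW.
  have Cn0 := lt0r_neq0 C0.
  rewrite expr_onem_sum !mulr_suml; apply: eq_bigr => r _.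
  have -> : 'C(M - 2, r)%:R * (-1) ^+ r * z ^+ r * (a * z) ^+ (p - 1) *
     (C ^ (2 - q%:Z) * expEi C^-1) = 'C(M - 2, r)%:R * (-1) ^+ r / a ^+ r *
     (C - b) ^+ (p - 1 + r) * (C ^ (2 - q%:Z) * expEi C^-1).
    rewrite /C addrK exprD [(a * z) ^+ r]exprMn.
    have ar0 : a ^+ r != 0 by rewrite expf_neq0// gt_eqF.
    by field.
  have -> : (C - b) ^+ (p - 1 + r) = (-1) ^+ (p - 1 + r) * (b - C) ^+ (p - 1 + r).
    by rewrite -exprMn mulN1r opprB.
  rewrite exprBn !mulr_sumr mulr_suml [RHS]big_mkord.
  apply: eq_bigr => t _.
  have -> : C^-1 ^ (q%:Z - 4 - t%:Z + 2) = C ^+ t * C ^ (2 - q%:Z).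
    rewrite exprz_inv (_ : - (q%:Z - 4 - t%:Z + 2) = t%:Z + (2 - q%:Z)); last by lia.
    by rewrite expfzDr.
  have -> : (-1) ^ (p%:Z - 1 - t%:Z) = (-1) ^+ (p - 1) * (-1) ^+ t :> R.
    rewrite (_ : p%:Z - 1 - t%:Z = (p - 1)%N%:Z + - t%:Z); last by lia.
    by rewrite expfzDr ?oppr_eq0 ?oner_eq0// -exprnN -exprnP invr_sign.
  rewrite exprD -mulr_natl exprS.
  have sr : (-1) ^+ r * (-1) ^+ r = 1 :> R by rewrite -expr2 sqrr_sign.
  have ar0 : a ^+ r != 0 by rewrite expf_neq0// gt_eqF.
  transitivity ((-1) ^+ r * (-1) ^+ r * ('C(M - 2, r)%:R / a ^+ r * (-1) ^+ (p - 1) *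
    ('C(p - 1 + r, t)%:R * ((-1) ^+ t * b ^+ (p - 1 + r - t) * C ^+ t)) *
    (C ^ (2 - q%:Z) * expEi C^-1))); first by ring.
  by rewrite sr; field; rewrite ar0 gt_eqF.
apply: has_int_sum => // r _; apply: has_int_sum => // t _; apply: has_intZ => //.
exact: has_int_Psi_term.
Qed.

Lemma Gamma_fn_nat n : Gamma_fn (n.+1%:R : R) = n`!%:R.
Proof.
have [_ E] := has_int_itvoy (has_int_gamma_rate n (ltr01 : 0 < 1 :> R)).
rewrite expr1n divr1 in E; rewrite -E /Gamma_fn /Defs.Rint.
congr fine; apply: eq_integral => t /set_mem /=; rewrite in_itv/= andbT => t0.
by rewrite -natr1 addrK powR_mulrn ?ltW// mul1r.
Qed.

(** Euler's integral with second parameter [p + t] and third [p + t + 1]: the power of one minus the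
    variable disappears, and the Gamma quotient equals [p + t], cancelling the divisor in [I3]. *)
Lemma has_int_I3 M a b p s : 0 < a -> 0 < b -> (0 < p)%N -> (1 < M)%N ->
  has_int `[0, 1] (fun z => (1 - z) ^+ (M - 2) * (a * z) ^+ (p - 1) *
      (a * z + b) ^ (1 - s%:Z)) (I3 M a b p s).
Proof.
move=> a0 b0 p0 M1.
apply: (eq_has_int (g := fun z => \sum_(0 <= t < (M - 2).+1)
    'C(M - 2, t)%:R * (-1) ^+ t * a ^+ (p - 1) / b ^ (s%:Z - 1) *
    (z ^+ (p + t - 1) * (1 + a / b * z) ^ (1 - s%:Z)))) => //.
  move=> z /=; rewrite in_itv/= => /andP[z0 _].
  have -> : a * z + b = b * (1 + a / b * z) by field; rewrite gt_eqF.
  rewrite expfzMl expr_onem_sum !mulr_suml; apply: eq_bigr => t _.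
  rewrite (_ : (p + t - 1)%N = (p - 1 + t)%N); last by lia.
  by rewrite exprD exprMn -[1 - s%:Z]opprB -invr_expz; ring.
have bp0 z : 0 <= z <= 1 -> 0 < 1 + a / b * z.
  by move=> /andP[z0 _]; rewrite ltr_pwDl// mulr_ge0// divr_ge0// ltW.
apply: has_int_sum => // t _.
have n0 : (p + t)%:R != 0 :> R by rewrite pnatr_eq0 -lt0n addn_gt0 p0.
have -> : 'C(M - 2, t)%:R * (-1) ^+ t * a ^+ (p - 1) / (b ^ (s%:Z - 1) * (p + t)%:R) *
     hyp2F1 (s%:R - 1) (p + t)%:R (p + t + 1)%:R (- (a / b)) =
   'C(M - 2, t)%:R * (-1) ^+ t * a ^+ (p - 1) / b ^ (s%:Z - 1) *
    \int[mu]_(z in `[0, 1]) (z ^+ (p + t - 1) * (1 + a / b * z) ^ (1 - s%:Z)).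
  rewrite /hyp2F1.
  have -> : (p + t + 1)%:R - (p + t)%:R = 1 :> R by rewrite natrD addrC addKr.
  have -> : Gamma_fn ((p + t + 1)%:R : R) = (p + t)%:R * Gamma_fn ((p + t)%:R : R).
    by rewrite addn1 -(prednK p0) addSn !Gamma_fn_nat factS natrM.
  have g1 : Gamma_fn (1 : R) = 1 by rewrite (Gamma_fn_nat 0).
  have gn0 : Gamma_fn ((p + t)%:R : R) != 0.
    by rewrite -(prednK p0) addSn Gamma_fn_nat fact_neq0.
  rewrite (_ : Defs.Rint _ _ = \int[mu]_(z in `[0, 1]) (z ^+ (p + t - 1) * (1 + a / b * z) ^ (1 - s%:Z))).
    rewrite g1 mulr1; move: (Rintegral _ _ _) => I.
    have := expfz_neq0 (s%:Z - 1) (lt0r_neq0 b0).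
    move: (b ^ _) (Gamma_fn (p + t)%:R) gn0 => u v v0 u0.
    move: ((p + t)%:R : R) n0 => w w0.
    by field; rewrite u0 v0 w0.
  rewrite /Defs.Rint /Rintegral; congr fine; apply: eq_integral => z /set_mem /=.
  rewrite in_itv/= => z01; have /andP[z0 z1] := z01; congr (_%:E).
  (* The exponent is 0, and [powRr0] gives 1 also at [z = 1], where the base is 0. *)
  rewrite subrr powRr0 mulr1 mulNr opprK opprB.
  have -> : (p + t)%:R - 1 = (p + t - 1)%:R :> R by rewrite natrB// addn_gt0 p0.
  rewrite powR_mulrn//; congr (_ * _).
  have -> : 1 - s%:R = (1 - s%:Z)%:~R :> R by rewrite intrB -pmulrn.
  by rewrite powR_intmul// ltW// bp0.
apply: has_intZ => //; split => //.
apply: continuous_compact_integrable; first exact: segment_compact.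
apply: continuous_in_subspaceT => z /set_mem /=; rewrite in_itv/= => z01.
have h := lt0r_neq0 (bp0 z z01).
have dh : has_deriv (fun z => 1 + a / b * z) z (0 + a / b * 1).
  by apply: has_derivD; [exact: has_deriv_cst|apply: has_derivZ; exact: has_deriv_id].
have [d dn] := @ex_has_deriv_exprz (fun z => 1 + a / b * z) (1 - s%:Z) z _ h dh.
apply: has_deriv_continuous; apply: has_derivM; first exact: has_derivXn.
exact: dn.
Qed.

End Theta_integral.

(** * Partial fractions and the average over the Beta law *)

Section mean_log.
Context {R : realType}.
Notation mu := (@lebesgue_measure R).
Implicit Types (a b s z A C : R).

(* [mean_log M A b] is the expectation of [ln (1 + A X + (A + b) Y)] for
   independent X ~ Gamma(1), Y ~ Gamma(M - 1), by partial fractions of the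
   Laplace transform of [A X + (A + b) Y]. *)
Definition mean_log M A b : R :=
  \sum_(1 <= p < M) (-1) ^+ (p - 1) * (A + b) * A ^+ (p - 1) / b ^+ p *
      \sum_(1 <= q < (M - p).+1) expint q (A + b)
  + (- A / b) ^+ (M - 1) * expint 1 A.

(** With [C = A + b], the splitting of [1 / ((1 + A s) (1 + C s))] as [(C / b) / (1 + C s) - (A / b)
    / (1 + A s)] has coefficients adding up to 1, so it also splits the constant 1. It removes one
    factor [1 + C s] at a time. *)
Lemma partial_fractions M A b s : 0 <= A -> 0 < b -> 0 < s -> (0 < M)%N ->
  (1 - ((1 + A * s) * (1 + (A + b) * s) ^+ (M - 1))^-1) / s =
  \sum_(1 <= p < M) (-1) ^+ (p - 1) * (A + b) * A ^+ (p - 1) / b ^+ p *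
      \sum_(1 <= q < (M - p).+1) (A + b) / (1 + (A + b) * s) ^+ q
  + (- A / b) ^+ (M - 1) * (A / (1 + A * s)).
Proof.
move=> A0 b0 s0; case: M => // L _; rewrite subn1 /=; set C := A + b.
have bn0 := lt0r_neq0 b0; have sn0 := lt0r_neq0 s0.
have hA := lt0r_neq0 (affine_gt0 A0 (ltW s0)).
have hC : 1 + C * s != 0 by rewrite gt_eqF// affine_gt0// ?ltW// ltr_wpDl.
(* A geometric sum in [1 / (1 + C s)]. *)
have Q n : (1 - (1 + C * s) ^- n) / s = \sum_(1 <= q < n.+1) C / (1 + C * s) ^+ q.
  elim: n => [|n IH]; first by rewrite big_geq// expr0 invr1 subrr mul0r.
  rewrite big_nat_recr//= -IH exprS.
  have : (1 + C * s) ^+ n != 0 by rewrite expf_neq0.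
  by move: (_ ^+ n) => t t0; rewrite /C in hC *; field; rewrite sn0 t0 hC.
elim: L => [|L IH].
  by rewrite big_geq// !expr0 mulr1 mul1r add0r; field; rewrite sn0 hA.
have -> : (1 - ((1 + A * s) * (1 + C * s) ^+ L.+1)^-1) / s =
    C / b * ((1 - (1 + C * s) ^- L.+1) / s) +
    - A / b * ((1 - ((1 + A * s) * (1 + C * s) ^+ L)^-1) / s).
  rewrite exprS; have : (1 + C * s) ^+ L != 0 by rewrite expf_neq0.
  by move: (_ ^+ L) => t t0; rewrite /C in hC *; field; rewrite sn0 t0 hC hA bn0.
rewrite IH Q big_add1 /= [in RHS]big_nat_recl//= mulrDr addrA; congr (_ + _); last first.
  by rewrite exprS mulrA.
congr (_ + _); first by rewrite !expr0 expr1 !mul1r mulr1 subSS subn0.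
rewrite mulr_sumr [in RHS]big_add1/=; apply: eq_bigr => p _.
rewrite !subn1/= !subSS !exprS; have : b ^+ p != 0 by rewrite expf_neq0.
by move: (b ^+ p) (\sum_(_ <= _ < _) _) => t u t0; field; rewrite t0 bn0.
Qed.

Lemma has_int_mean_log M A b : 0 <= A -> 0 < b -> (0 < M)%N ->
  has_int `]0, +oo[
    (fun s => (1 - ((1 + A * s) * (1 + (A + b) * s) ^+ (M - 1))^-1) / s * expR (- s))
    (mean_log M A b).
Proof.
move=> A0 b0 M0; have C0 : 0 <= A + b by rewrite addr_ge0// ltW.
apply: (eq_has_int (g := fun s =>
   \sum_(1 <= p < M) (-1) ^+ (p - 1) * (A + b) * A ^+ (p - 1) / b ^+ p *
      (\sum_(1 <= q < (M - p).+1) ((A + b) / (1 + (A + b) * s) ^+ q * expR (- s)))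
  + (- A / b) ^+ (M - 1) * (A / (1 + A * s) ^+ 1 * expR (- s)))) => //.
  move=> s /=; rewrite in_itv/= andbT => s0.
  rewrite partial_fractions// mulrDl expr1 mulr_suml; congr (_ + _); last by rewrite -[LHS]mulrA.
  by apply: eq_bigr => p _; rewrite -[LHS]mulrA mulr_suml.
apply: has_intD => //; last by apply: has_intZ => //; exact: has_int_expint.
apply: has_int_sum => // p _; apply: has_intZ => //.
by apply: has_int_sum => // q _; exact: has_int_expint.
Qed.

(** At [A = 0] only [p = 1] survives, with coefficient [b / b = 1]. This is the subtracted term of
    the first user, whose [S2] is 0. *)
Lemma mean_log0 M b : 0 < b -> (0 < M)%N ->
  mean_log M 0 b = expR b^-1 * \sum_(1 <= q < M) Eq_int q b^-1.
Proof.
move=> b0; case: M => // -[_|M _]; first by rewrite /mean_log !big_geq// mulr0 add0r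
  expr0 mul1r /expint; under eq_Rintegral do rewrite !mul0r; rewrite /Rintegral integral0.
rewrite /mean_log big_ltn// [X in _ + X + _]big1_seq ?addr0; last first.
  move=> p /andP[_]; rewrite mem_index_iota => /andP[p0 _].
  by rewrite expr0n subn_eq0 leqNgt p0/= mulr0 !mul0r.
rewrite !subn1 /= !expr0 mul1r mulr1 add0r expr1 oppr0 mul0r expr0n/= mul0r addr0.
rewrite mulfV ?gt_eqF// mul1r mulr_sumr.
by apply: eq_bigr => q _; rewrite expint_Eq_int.
Qed.

(** The weight is the Beta(1, [M - 1]) density, and [ln 2] undoes the normalisation inside [Theta].
    After [expint_closed], the exponential integrals at [A = a z], those at [A + b] and the rational
    terms give [I1], [I2] and [I3]. *)
Lemma has_int_mean_log_onem M a b : 0 < a -> 0 < b -> (1 < M)%N ->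
  has_int `[0, 1] (fun z => (M - 1)%:R * (1 - z) ^+ (M - 2) * mean_log M (a * z) b)
    (ln 2 * Theta M a b).
Proof.
move=> a0 b0 M1; have ln2 : ln 2 != 0 :> R by rewrite gt_eqF// ln_gt0// ltr1n.
rewrite /Theta mulrA mulfV// mul1r.
apply: (eq_has_int (g := fun z =>
  (-1) ^+ M * (M - 1)%:R / b ^+ (M - 1) *
    ((1 - z) ^+ (M - 2) * (a * z) ^+ (M - 1) * expEi ((a * z)^-1))
  + \sum_(1 <= p < M) \sum_(1 <= q < (M - p).+1)
      ((-1) ^+ (p + q + 1) * (M - 1)%:R / (((q - 1)`!)%:R * b ^+ p) *
       ((1 - z) ^+ (M - 2) * (a * z) ^+ (p - 1) *
         ((a * z + b) ^ (2 - q%:Z) * expEi ((a * z + b)^-1))))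
  + \sum_(1 <= p < M) \sum_(2 <= q < (M - p).+1) \sum_(0 <= s < (q - 1))
      ((-1) ^+ (p + s - 1) * ((q - s - 2)`!)%:R * (M - 1)%:R /
        (((q - 1)`!)%:R * b ^+ p) * ((1 - z) ^+ (M - 2) * (a * z) ^+ (p - 1) *
         (a * z + b) ^ (1 - s%:Z))))) => //; last first.
  apply: has_intD => //; first apply: has_intD => //.
  - by apply: has_intZ => //; exact: has_int_I1.
  - apply: has_int_sum => // p; rewrite mem_index_iota => /andP[p0 _].
    apply: has_int_sum => // q _; apply: has_intZ => //; exact: has_int_I2.
  - apply: has_int_sum => // p; rewrite mem_index_iota => /andP[p0 _].
    apply: has_int_sum => // q _; apply: has_int_sum => // s _.
    apply: has_intZ => //; exact: has_int_I3.
move=> z /=; rewrite in_itv/= => /andP[z0 z1].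
have A0 : 0 <= a * z by rewrite mulr_ge0// ltW.
have C0 : 0 < a * z + b by rewrite ltr_wpDl.
rewrite /mean_log; move: A0 C0; set A := a * z; set C := A + b => A0 C0.
have Cn0 := lt0r_neq0 C0.
have -> : (- A / b) ^+ (M - 1) * expint 1 A =
    (-1) ^+ M / b ^+ (M - 1) * (A ^+ (M - 1) * expEi A^-1).
  (* [expint1] asks for [A > 0]; at [A = 0] both sides vanish because [M - 1 > 0]. *)
  move: A0; rewrite le_eqVlt => /predU1P[<-|A0].
    by rewrite oppr0 mul0r expr0n subn_eq0 leqNgt M1/= !mul0r mulr0.
  rewrite expint1// mulNr -[- (A / b)]mulN1r exprMn exprMn exprVn.
  have -> : (-1) ^+ M = (-1) ^+ (M - 1) * -1 :> R by rewrite -exprSr -addn1 subnK// ltnW.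
  by ring.
(* [expint_closed] in integer powers of [C], so that the outer factor [C] of [mean_log] merges into
   the exponents [2 - q] and [1 - s]. *)
have E q : (0 < q)%N -> expint q C = (-1) ^+ (q.-1).+1 / (q - 1)`!%:R * (C ^ (1 - q%:Z) * expEi C^-1) +
    \sum_(0 <= s < (q - 1)) (-1) ^+ s * (q - s - 2)`!%:R / (q - 1)`!%:R * C ^ (- s%:Z).
  move=> q0; rewrite expint_closed// expint1//; congr (_ + _).
    rewrite (_ : 1 - q%:Z = - (q.-1)%:Z); last by lia.
    by rewrite -exprnN -[- C^-1]mulN1r exprMn exprVn subn1 exprS; ring.
  by apply: eq_bigr => s _; rewrite -[- C^-1]mulN1r exprMn exprVn -exprnN; ring.
rewrite mulrDr addrC -[RHS]addrA; congr (_ + _); first by ring.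
rewrite mulr_sumr -big_split/=; rewrite big_nat [RHS]big_nat; apply: eq_bigr => p /andP[p0 pM].
(* At [q = 1] the inner sum is empty, so this range may start at 1 and be merged with the other sum
   over [q]. *)
rewrite [X in _ = _ + X](_ : _ = \sum_(1 <= q < (M - p).+1) \sum_(0 <= s < (q - 1))
      ((-1) ^+ (p + s - 1) * ((q - s - 2)`!)%:R * (M - 1)%:R /
        (((q - 1)`!)%:R * b ^+ p) * ((1 - z) ^+ (M - 2) * A ^+ (p - 1) *
         C ^ (1 - s%:Z)))); last first.
  by rewrite [in RHS]big_ltn ?ltnS ?subn_gt0// [X in _ = X + _]big_geq ?add0r.
rewrite -big_split/= !mulr_sumr [LHS]big_nat [RHS]big_nat; apply: eq_bigr => q /andP[q0 _].
rewrite E//; clearbody C; rewrite !mulrDr; congr (_ + _).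
  have -> : C ^ (2 - q%:Z) = C * C ^ (1 - q%:Z).
    by rewrite -{2}[C]expr1z -expfzDr//; congr (_ ^ _); lia.
  rewrite prednK//; have -> : (p + q + 1 = p - 1 + q + 2)%N by lia.
  by rewrite 2!exprD sqrrN expr1n invfM; ring.
rewrite !mulr_sumr; apply: eq_bigr => s _.
have -> : C ^ (1 - s%:Z) = C * C ^ (- s%:Z) by rewrite expfzDr// expr1z.
have -> : (p + s - 1 = p - 1 + s)%N by lia.
by rewrite exprD invfM; ring.
Qed.

End mean_log.

Lemma measurable_inv (R : realType) : measurable_fun [set: R] (fun x : R => x^-1).
Proof.
have -> : [set: R] = (`]-oo, 0[%classic `|` [set 0]) `|` `]0, +oo[%classic.
  apply/seteqP; split => // x _ /=; rewrite !in_itv/= andbT.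
  by case: (ltgtP x 0) => [?|?|->]; [left; left|right|left; right].
apply/measurable_funU; [exact: measurableU|by []|split].
  apply/measurable_funU => //; split; last exact: measurable_fun_set1.
  apply: open_continuous_measurable_fun; first exact: interval_open.
  move=> x; rewrite inE/= in_itv/= => x0; apply: has_deriv_continuous.
  by apply: has_deriv_inv; rewrite lt_eqF.
apply: measurable_fun_gt0 => // x x0; apply: has_deriv_continuous.
by apply: has_deriv_inv; rewrite gt_eqF.
Qed.

(** * Expectations computed from laws and independence *)

Section transfer.
Context {R : realType}.

Import HBNNSimple.

(** The density is known only through the measure of sets, so the formula is carried from indicators
    to simple functions, and then to [f] by monotone convergence. *)
Lemma ge0_integral_density d (T : measurableType d)
    (mu nu : {measure set T -> \bar R}) (p : T -> R) (f : T -> \bar R) :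
  measurable_fun [set: T] p -> (forall x, 0 <= p x) ->
  (forall A, measurable A -> nu A = (\int[mu]_(x in A) (p x)%:E)%E) ->
  measurable_fun [set: T] f -> (forall x, (0 <= f x)%E) ->
  (\int[nu]_x f x = \int[mu]_x (f x * (p x)%:E))%E.
Proof.
move=> mp p0 nuE mf f0; pose h := nnsfun_approx measurableT mf.
have mpE : measurable_fun [set: T] (EFin \o p) by exact/measurable_EFinP.
have hf x : (EFin \o h n) x @[n --> \oo] --> f x by exact: cvg_nnsfun_approx.
have nd x : nondecreasing_seq (fun n => (EFin \o h n) x).
  by move=> a b ab; rewrite lee_fin; exact/lefP/nd_nnsfun_approx.
transitivity (limn (fun n => \int[nu]_x (h n x)%:E)%E).
  rewrite -monotone_convergence//.
  - by apply: eq_integral => x _; apply/esym/cvg_lim => //; exact: hf.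
  - by move=> n; exact/measurable_EFinP.
  - by move=> n x _; rewrite lee_fin.
  - by move=> x _; exact: nd.
transitivity (limn (fun n => \int[mu]_x ((h n x)%:E * (p x)%:E))%E); last first.
  rewrite -monotone_convergence//.
  - apply: eq_integral => x _; apply/cvg_lim => //.
    by apply: cvgeZr => //; exact: hf.
  - by move=> n; apply: emeasurable_funM => //; exact/measurable_EFinP.
  - by move=> n x _; rewrite mule_ge0 ?lee_fin.
  - by move=> x _ a b ab; rewrite lee_wpmul2r ?lee_fin//; have := nd x _ _ ab; rewrite lee_fin.
congr (limn _); apply/funext => n.
have mh y : measurable (h n @^-1` [set y]) by exact: measurable_funPTI.
transitivity (\sum_(y \in range (h n)) \int[nu]_x (y * \1_(h n @^-1` [set y]) x)%:E)%E.
  rewrite -ge0_integral_fsum//; first by apply: eq_integral => x _; rewrite fimfunE -fsumEFin.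
    by move=> y; apply/measurable_EFinP; apply: measurable_funM.
  by move=> y x _; exact: nnfun_muleindic_ge0.
transitivity (\sum_(y \in range (h n))
    \int[mu]_x ((y * \1_(h n @^-1` [set y]) x)%:E * (p x)%:E))%E; last first.
  rewrite -ge0_integral_fsum//.
  - apply: eq_integral => x _; rewrite [in RHS]fimfunE -fsumEFin// ge0_mule_fsuml// => y.
    exact: nnfun_muleindic_ge0.
  - move=> y; apply: emeasurable_funM => //; apply/measurable_EFinP.
    exact: measurable_funM.
  - by move=> y x _; rewrite mule_ge0 ?lee_fin//; exact: nnfun_muleindic_ge0.
apply: eq_fsbigr => y /set_mem [x0 _ <-{y}].
have y0 : 0 <= h n x0 by [].
under eq_integral do rewrite EFinM.
rewrite ge0_integralZl_EFin// ?integral_indic// ?setIT; last first.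
  exact/measurable_EFinP.
under [RHS]eq_integral do rewrite EFinM -muleA.
rewrite [RHS]ge0_integralZl_EFin//; last 2 first.
- by move=> x _; rewrite mule_ge0 ?lee_fin.
- by apply: emeasurable_funM => //; exact/measurable_EFinP.
rewrite nuE//; congr (_ * _)%E; rewrite [LHS]integral_mkcond; apply: eq_integral => x _.
rewrite /= patchE indicE; case: ifPn => _; first by rewrite mul1e.
by rewrite mul0e.
Qed.

Lemma ge0_integral_law d d' (Om : measurableType d) (T : measurableType d')
    (P : probability Om R) (X : Om -> T) (mX : measurable_fun [set: Om] X)
    (nu : {measure set T -> \bar R}) (f : T -> \bar R) :
  (forall A, measurable A -> P (X @^-1` A) = nu A) ->
  measurable_fun [set: T] f -> (forall x, (0 <= f x)%E) ->
  (\int[P]_w f (X w) = \int[nu]_x f x)%E.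
Proof.
move=> PX mf f0.
pose Xm : {mfun Om >-> T} := HB.pack X (isMeasurableFun.Build _ _ _ _ _ mX).
transitivity (\int[distribution P Xm]_x f x)%E.
  by rewrite ge0_integral_distribution.
by apply: eq_measure_integral => A mA _; exact: PX.
Qed.

Lemma ge0_integral_eq_law d1 d2 d (Om1 : measurableType d1) (Om2 : measurableType d2)
    (T : measurableType d) (P : probability Om1 R) (Q : probability Om2 R)
    (X : Om1 -> T) (Y : Om2 -> T) (f : T -> \bar R) :
  measurable_fun [set: Om1] X -> measurable_fun [set: Om2] Y ->
  (forall A, measurable A -> P (X @^-1` A) = Q (Y @^-1` A)) ->
  measurable_fun [set: T] f -> (forall x, (0 <= f x)%E) ->
  (\int[P]_w f (X w) = \int[Q]_w f (Y w))%E.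
Proof.
move=> mX mY PQ mf f0.
pose Ym : {mfun Om2 >-> T} := HB.pack Y (isMeasurableFun.Build _ _ _ _ _ mY).
rewrite (@ge0_integral_law _ _ _ _ P X mX (distribution Q Ym))//.
by rewrite ge0_integral_distribution.
Qed.

(** Independence makes the law of the pair agree with the product law on rectangles, hence
    everywhere by uniqueness of product measures; Tonelli gives the iterated form over two copies of
    the sample point. *)
Lemma ge0_integral_indep d d1 d2 (Om : measurableType d) (T1 : measurableType d1)
    (T2 : measurableType d2) (P : probability Om R) (U : Om -> T1) (W : Om -> T2)
    (F : T1 * T2 -> \bar R) :
  measurable_fun [set: Om] U -> measurable_fun [set: Om] W ->
  (forall A C, measurable A -> measurable C ->
    P (U @^-1` A `&` W @^-1` C) = (P (U @^-1` A) * P (W @^-1` C))%E) ->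
  measurable_fun [set: T1 * T2] F -> (forall x, (0 <= F x)%E) ->
  (\int[P]_w F (U w, W w) = \int[P]_w \int[P]_w' F (U w, W w'))%E.
Proof.
move=> mU mW indep mF F0.
pose Um : {mfun Om >-> T1} := HB.pack U (isMeasurableFun.Build _ _ _ _ _ mU).
pose Wm : {mfun Om >-> T2} := HB.pack W (isMeasurableFun.Build _ _ _ _ _ mW).
have mUW : measurable_fun [set: Om] (fun w => (U w, W w)) by exact: measurable_fun_pair.
pose UWm : {mfun Om >-> (T1 * T2)%type} :=
  HB.pack (fun w => (U w, W w)) (isMeasurableFun.Build _ _ _ _ _ mUW).
rewrite (@ge0_integral_law _ _ _ _ P _ mUW (distribution P Um \x distribution P Wm)%E)//; last first.
  move=> A mA; apply/esym.
  apply: (@product_measure_unique _ _ _ _ _ (distribution P Um) (distribution P Wm)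
    (distribution P UWm)) => //.
rewrite fubini_tonelli1// (@ge0_integral_distribution _ _ _ _ _ P Um)//.
- apply: eq_integral => w _; rewrite /= /fubini_F ge0_integral_distribution//.
  exact: measurableT_comp.
- exact: measurable_fun_fubini_tonelli_F.
- by move=> x; apply: integral_ge0.
Qed.

End transfer.

(** * The logarithm as an integral of exponentials *)

Section log_laplace.
Context {R : realType}.
Notation mu := (@lebesgue_measure R).
Implicit Types (s w : R).

Lemma log_laplace_integrand_ge0 w s : 0 <= w -> 0 < s -> 0 <= (1 - expR (- (s * w))) / s * expR (- s).
Proof.
move=> w0 s0; rewrite mulr_ge0 ?expR_ge0// divr_ge0 ?(ltW s0)// subr_ge0.
by rewrite expR_le1 oppr_le0 mulr_ge0// ltW.
Qed.

(** Write [(1 - expR (- s w)) / s] as the integral of [expR (- s v)] over [v] in [[0, w]] and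
    exchange the order: the integral over [s] becomes [1 / (1 + v)]. *)
Lemma integral_log_laplace w : 0 <= w ->
  (\int[mu]_(s in `]0%R, +oo[) ((1 - expR (- (s * w))) / s * expR (- s))%:E =
   (ln (1 + w))%:E)%E.
Proof.
rewrite le_eqVlt => /predU1P[<-|w0].
  rewrite addr0 ln1 integral0_eq// => s _.
  by rewrite mulr0 oppr0 expR0 subrr !mul0r.
pose D1 : set (measurableTypeR R) := `]0, +oo[%classic.
pose D2 : set (measurableTypeR R) := `[0, w]%classic.
have mD1 : measurable D1 by exact: measurable_itv.
have mD2 : measurable D2 by exact: measurable_itv.
pose F (x : measurableTypeR R * measurableTypeR R) : \bar R :=
  (\1_D1 x.1 * \1_D2 x.2 * expR (- ((1 + x.2) * x.1)))%:E.
have mF : measurable_fun setT F.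
  apply/measurable_EFinP; apply: measurable_funM.
    apply: measurable_funM.
      exact: (measurableT_comp (measurable_indic mD1)).
    exact: (measurableT_comp (measurable_indic mD2)).
  apply: measurableT_comp => //; apply: measurableT_comp => //.
  by apply: measurable_funM => //; apply: measurable_funD.
have F0 x : (0 <= F x)%E by rewrite lee_fin !mulr_ge0 ?expR_ge0.
have := @fubini_tonelli _ _ _ _ R mu mu F mF F0.
rewrite [LHS](_ : _ = \int[mu]_(s in D1) ((1 - expR (- (s * w))) / s * expR (- s))%:E)%E; last first.
  rewrite [RHS]integral_mkcond; apply: eq_integral => s _; rewrite patchE.
  case: ifPn => [/set_mem /= s1|s1]; last first.
    by rewrite integral0_eq// => v _; rewrite /F /= indicE (negbTE s1) !mul0r.
  have s0 : 0 < s by move: s1; rewrite /D1/= in_itv/= andbT.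
  pose P v := - s^-1 * expR (- ((1 + v) * s)).
  have dP v : has_deriv P v (expR (- ((1 + v) * s))).
    apply: eq_has_deriv.
      apply: has_derivZ; apply: has_deriv_expR; apply: has_derivN; apply: has_derivZr.
      by apply: has_derivD; [exact: has_deriv_cst|exact: has_deriv_id].
    by field; rewrite gt_eqF.
  have := @has_intE R D2 _ _ mD2 (@has_int_FTC R 0 w _ P w0 (fun v _ => _) (fun v _ => dP v)).
  rewrite (_ : P w - P 0 = (1 - expR (- (s * w))) / s * expR (- s)); last first.
    rewrite /P addr0 mul1r mulrDl opprD expRD mul1r [w * s]mulrC; ring.
  move=> <-; last first.
    move=> v; apply: has_deriv_continuous; apply: has_deriv_expR; apply: has_derivN; apply: has_derivZr.
    by apply: has_derivD; [exact: has_deriv_cst|exact: has_deriv_id].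
  rewrite [RHS]integral_mkcond; apply: eq_integral => v _; rewrite patchE /F/= indicE.
  rewrite mem_set// mul1r indicE; case: ifPn => _; first by rewrite mul1r.
  by rewrite mul0r.
move=> ->.
have dl (v : R) : 0 <= v -> has_deriv (fun v => ln (1 + v)) v ((1 + v)^-1).
  move=> v0; have v1 : 0 < 1 + v by rewrite ltr_pwDl.
  apply: (eq_has_deriv _ (mulr1 _)); apply: (has_deriv_chain (f := @ln R)); first exact: has_deriv_ln.
  by apply: (eq_has_deriv _ (add0r _)); apply: has_derivD; [exact: has_deriv_cst|exact: has_deriv_id].
have H : has_int D2 (fun v => (1 + v)^-1) (ln (1 + w) - ln (1 + 0)).
  apply: (has_int_FTC (F := fun v => ln (1 + v))) => // v /andP[v0 _]; last exact: dl.
  have v1 : 1 + v != 0 by rewrite gt_eqF// ltr_pwDl.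
  apply: has_deriv_continuous; apply: (has_derivV (f := fun v => 1 + v)) => //.
have := has_intE mD2 H; rewrite addr0 ln1 subr0 => <-.
rewrite [RHS]integral_mkcond; apply: eq_integral => v _; rewrite patchE.
case: ifPn => [/set_mem /= v1|v1]; last first.
  by rewrite integral0_eq// => s _; rewrite /F /= indicE [\1_D2 _]indicE (negbTE v1) mulr0 mul0r.
have v0 : 0 <= v by move: v1; rewrite /D2/= in_itv/= => /andP[].
have G := has_int_itvoy (has_int_gamma_rate 0 (ltr_pwDl ltr01 v0)).
have := has_intE mD1 G; rewrite fact0 expr1 mul1r => <-.
rewrite [RHS]integral_mkcond; apply: eq_integral => s _; rewrite patchE /F/= [\1_D2 _]indicE.
rewrite (mem_set v1) mulr1 indicE; case: ifPn => _; first by rewrite !mul1r.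
by rewrite mul0r.
Qed.

End log_laplace.

(** * Laplace transform and mean logarithm of a gamma sum *)

Section gamma_sum.
Context {R : realType} (M : nat) d (Om : measurableType d) (Q : probability Om R) (X Y : Om -> R).
Hypotheses (M1 : (1 < M)%N) (mX : measurable_fun [set: Om] X) (mY : measurable_fun [set: Om] Y).
Hypothesis lawX : forall A : set R, measurable A ->
  Q (X @^-1` A) = (\int[lebesgue_measure]_(x in A) (gamma_pdf 1 x)%:E)%E.
Hypothesis lawY : forall A : set R, measurable A ->
  Q (Y @^-1` A) = (\int[lebesgue_measure]_(y in A) (gamma_pdf (M - 1) y)%:E)%E.
Hypothesis indepXY : forall A C : set R, measurable A -> measurable C ->
  Q (X @^-1` A `&` Y @^-1` C) = (Q (X @^-1` A) * Q (Y @^-1` C))%E.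
Notation mu := (@lebesgue_measure R).

Lemma gamma_pdf_ge0 k (x : R) : 0 <= gamma_pdf k x.
Proof.
by rewrite /gamma_pdf; case: ifPn => // x0; rewrite divr_ge0// mulr_ge0 ?expR_ge0// exprn_ge0.
Qed.

Lemma measurable_gamma_pdf k : measurable_fun [set: R] (gamma_pdf k : R -> R).
Proof.
have -> : (gamma_pdf k : R -> R) =
    (fun x => x ^+ (k - 1) * expR (- x) / (k - 1)`!%:R) \_ `[0, +oo[%classic.
  by apply/funext => x; rewrite /gamma_pdf patchE mem_setE in_itv/= andbT.
apply/measurable_restrict => //; rewrite setTI.
apply: measurable_funM => //; apply: measurable_funM; first exact: measurable_funX.
exact: measurableT_comp.
Qed.

Lemma ge0_integral_gamma_law k (U : Om -> R) (f : R -> \bar R) :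
  measurable_fun [set: Om] U ->
  (forall A : set R, measurable A ->
    Q (U @^-1` A) = (\int[mu]_(x in A) (gamma_pdf k x)%:E)%E) ->
  measurable_fun [set: R] f -> (forall x, (0 <= f x)%E) ->
  (\int[Q]_w f (U w) =
   \int[mu]_(x in `[0%R, +oo[) (f x * (x ^+ (k - 1) * expR (- x) / (k - 1)`!%:R)%:E))%E.
Proof.
move=> mU lawU mf f0.
have mU' : @measurable_fun _ _ Om (measurableTypeR R) setT U by exact: mU.
pose Um : {mfun Om >-> measurableTypeR R} := HB.pack U (isMeasurableFun.Build _ _ _ _ _ mU').
transitivity (\int[distribution Q Um]_x f x)%E; first by rewrite ge0_integral_distribution.
rewrite (@ge0_integral_density _ _ _ mu (distribution Q Um) (gamma_pdf k))//.
- rewrite [RHS]integral_mkcond; apply: eq_integral => x _; rewrite patchE /gamma_pdf mem_setE in_itv/= andbT.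
  by case: ifPn => // _; rewrite mule0.
- exact: measurable_gamma_pdf.
- by move=> x; exact: gamma_pdf_ge0.
Qed.

Lemma laplace_gamma_law k (U : Om -> R) (t : R) : (0 < k)%N -> 0 <= t ->
  measurable_fun [set: Om] U ->
  (forall A : set R, measurable A ->
    Q (U @^-1` A) = (\int[mu]_(x in A) (gamma_pdf k x)%:E)%E) ->
  (\int[mu]_(x in `[0%R, +oo[)
     ((expR (- (t * x)))%:E * (x ^+ (k - 1) * expR (- x) / (k - 1)`!%:R)%:E) = (((1 + t) ^+ k)^-1)%:E)%E.
Proof.
move=> k0 t0 mU lawU; have t1 : 0 < 1 + t by rewrite ltr_pwDl.
have H := has_intZ ((k - 1)`!%:R^-1) (measurable_itv _) (has_int_gamma_rate (k - 1) t1).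
rewrite (_ : ((1 + t) ^+ k)^-1 = (k - 1)`!%:R^-1 * ((k - 1)`!%:R / (1 + t) ^+ (k - 1).+1)).
  rewrite -(has_intE _ H)//; apply: eq_integral => x _; rewrite -EFinM; congr (_%:E).
  by rewrite mulrDl mul1r opprD expRD; ring.
by rewrite mulrA mulVf ?fact_neq0// mul1r subn1 prednK.
Qed.

(** Regroup [A (X + Y) + b Y] as [A X + (A + b) Y] and use independence. The absolute values keep
    the exponent nonpositive everywhere and disappear on the support of the gamma densities. *)
Lemma laplace_gamma_sum (s A b : R) : 0 <= s -> 0 <= A -> 0 <= b ->
  (\int[Q]_w (expR (- (s * (A * `|X w + Y w| + b * `|Y w|))))%:E =
   (((1 + A * s) * (1 + (A + b) * s) ^+ (M - 1))^-1)%:E)%E.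
Proof.
move=> s0 A0 b0.
pose F (x : measurableTypeR R * measurableTypeR R) : \bar R :=
  (expR (- (s * (A * `|x.1 + x.2| + b * `|x.2|))))%:E.
have mF : measurable_fun setT F.
  apply/measurable_EFinP; apply: measurableT_comp => //; apply: measurableT_comp => //.
  apply: measurable_funM => //; apply: measurable_funD; apply: measurable_funM => //.
    by apply: measurableT_comp => //; exact: measurable_funD.
  exact: measurableT_comp.
have F0 x : (0 <= F x)%E by rewrite lee_fin expR_ge0.
rewrite [LHS](@ge0_integral_indep _ _ _ _ _ _ _ Q X Y F)//.
pose p k (x : R) := x ^+ (k - 1) * expR (- x) / (k - 1)`!%:R.
have mFx w : measurable_fun [set: R] (fun y => F (w, y)).
  exact: measurableT_comp (pair1_measurable _).
rewrite (@ge0_integral_gamma_law 1 X (fun x => \int[Q]_w F (x, Y w))%E)//; last 2 first.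
- apply: (@measurable_fun_fubini_tonelli_F _ _ _ _ R Q
    (fun z : measurableTypeR R * Om => F (z.1, Y z.2))) => //.
  apply: (measurableT_comp mF); apply: measurable_fun_pair => //.
  exact: measurableT_comp.
- by move=> x; apply: integral_ge0.
transitivity (\int[mu]_(x in `[0%R, +oo[) ((((1 + (A + b) * s) ^+ (M - 1))^-1)%:E *
    ((expR (- (s * A * x)))%:E * (p 1 x)%:E)))%E.
  apply: eq_integral => x /set_mem /=; rewrite in_itv/= andbT => x0.
  rewrite muleA; congr (_ * _)%E.
  rewrite (@ge0_integral_gamma_law (M - 1) Y (fun y => F (x, y)))//.
  have C0 : 0 <= (A + b) * s by rewrite mulr_ge0// addr_ge0.
  rewrite muleC -(@laplace_gamma_law (M - 1) Y)// ?subn_gt0//.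
  rewrite -ge0_integralZl_EFin ?expR_ge0//.
  - apply: eq_integral => y /set_mem /=; rewrite in_itv/= andbT => y0.
    rewrite muleA; congr (_ * _)%E; rewrite -EFinM /F /=; congr (_%:E).
    by rewrite !ger0_norm ?addr_ge0// -expRD; congr expR; ring.
  - by move=> y /=; rewrite in_itv/= andbT => y0;
    rewrite -EFinM lee_fin !mulr_ge0 ?expR_ge0 ?invr_ge0 ?exprn_ge0.
  - apply/measurable_EFinP; apply: measurable_funM.
      by apply: measurableT_comp => //; apply: measurableT_comp => //; exact: measurable_funM.
    apply: measurable_funM => //; apply: measurable_funM; first exact: measurable_funX.
    by apply: measurableT_comp.
have sA0 : 0 <= s * A by rewrite mulr_ge0.
rewrite ge0_integralZl_EFin//; last 3 first.
- by move=> y /=; rewrite in_itv/= andbT => y0;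
    rewrite -EFinM lee_fin !mulr_ge0 ?expR_ge0 ?invr_ge0 ?exprn_ge0.
- apply/measurable_EFinP; apply: measurable_funM.
    by apply: measurableT_comp => //; apply: measurableT_comp => //; exact: measurable_funM.
  apply: measurable_funM => //; apply: measurable_funM; first exact: measurable_funX.
  by apply: measurableT_comp.
- by rewrite invr_ge0 exprn_ge0// addr_ge0// mulr_ge0// addr_ge0.
rewrite /p (@laplace_gamma_law 1 X)// -EFinM expr1 [s * A]mulrC -invfM.
by congr EFin; congr GRing.inv; exact: mulrC.
Qed.

Lemma mean_log_gamma_sum (A b : R) : 0 <= A -> 0 < b ->
  (\int[Q]_w (ln (1 + (A * `|X w + Y w| + b * `|Y w|)))%:E = (mean_log M A b)%:E)%E.
Proof.
move=> A0 b0; pose W w := A * `|X w + Y w| + b * `|Y w|.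
have W0 w : 0 <= W w by rewrite addr_ge0// mulr_ge0// ltW.
have mW : measurable_fun [set: Om] W.
  apply: measurable_funD; apply: measurable_funM => //.
    by apply: measurableT_comp => //; exact: measurable_funD.
  exact: measurableT_comp.
pose D1 : set (measurableTypeR R) := `]0, +oo[%classic.
pose F (x : Om * measurableTypeR R) : \bar R :=
  (\1_D1 x.2 * ((1 - expR (- (x.2 * W x.1))) / x.2 * expR (- x.2)))%:E.
have mD1 : measurable D1 by exact: measurable_itv.
have mF : measurable_fun setT F.
  apply/measurable_EFinP; apply: measurable_funM.
    exact: (measurableT_comp (measurable_indic mD1)).
  apply: measurable_funM; last by apply: measurableT_comp => //; exact: measurableT_comp.
  apply: measurable_funM; last by apply: (measurableT_comp (@measurable_inv R)).
  apply: measurable_funB => //; apply: measurableT_comp => //; apply: measurableT_comp => //.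
  by apply: measurable_funM => //; exact: measurableT_comp.
have F0 x : (0 <= F x)%E.
  rewrite lee_fin indicE; case: (boolP (_ \in _)) => [/set_mem|]; last by rewrite mul0r.
  by rewrite /D1/= in_itv/= andbT mul1r => s0; exact: log_laplace_integrand_ge0.
transitivity (\int[Q]_w \int[mu]_s F (w, s))%E.
  apply: eq_integral => w _; rewrite -(integral_log_laplace (W0 w)) [LHS]integral_mkcond.
  by apply: eq_integral => s _; rewrite patchE /F/= indicE; case: ifPn => _; rewrite ?mul1r ?mul0r.
rewrite (@fubini_tonelli _ _ _ _ R Q mu F mF F0).
rewrite -(has_intE _ (has_int_mean_log A0 b0 (ltnW M1)))// [RHS]integral_mkcond.
apply: eq_integral => s _; rewrite patchE; case: ifPn => [/set_mem /= s1|s1]; last first.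
  by rewrite integral0_eq// => w _; rewrite /F/= indicE (negbTE s1) mul0r.
have s0 : 0 < s by move: s1; rewrite in_itv/= andbT.
have := laplace_gamma_sum (ltW s0) A0 (ltW b0); set phi := (_ * _)^-1 => L.
have mE : measurable_fun [set: Om] (fun w => expR (- (s * W w))).
  by apply: measurableT_comp => //; apply: measurableT_comp => //; exact: measurable_funM.
have E1 w : expR (- (s * W w)) <= 1 by rewrite expR_le1 oppr_le0 mulr_ge0// ltW.
transitivity (\int[Q]_w ((s^-1 * expR (- s))%:E * (1 - expR (- (s * W w)))%:E))%E.
  apply: eq_integral => w _; rewrite /F/= indicE mem_set// mul1r -EFinM; congr (_%:E); ring.
rewrite ge0_integralZl_EFin//; last 3 first.
- by move=> w _; rewrite lee_fin subr_ge0.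
- by apply/measurable_EFinP; exact: measurable_funB.
- by rewrite mulr_ge0 ?expR_ge0// invr_ge0 ltW.
(* The Laplace transform is added to this integral instead of being subtracted: both integrands are
   nonnegative and sum to 1. *)
have -> : (\int[Q]_w (1 - expR (- (s * W w)))%:E = (1 - phi)%:E)%E.
  have : (\int[Q]_w (1 - expR (- (s * W w)))%:E + phi%:E = 1)%E.
    rewrite -L -ge0_integralD//.
    - rewrite (eq_integral (cst 1%E)); first by rewrite integral_cst// mul1e; exact: probability_setT.
      by move=> w _; rewrite -EFinD subrK.
    - by move=> w _; rewrite lee_fin subr_ge0.
    - by apply/measurable_EFinP; exact: measurable_funB.
    - exact/measurable_EFinP.
  by move=> /(congr1 (fun x => (x - phi%:E)%E)); rewrite addeK// => ->.
by rewrite -EFinM; congr (_%:E); ring.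
Qed.

End gamma_sum.

(** * The Beta(1, b) law *)

Section beta_law.
Context {R : realType} d (Om : measurableType d) (P : probability Om R).
Notation mu := (@lebesgue_measure R).

Lemma ge0_integral_beta_law b (U : Om -> R) (f : R -> \bar R) :
  (0 < b)%N -> measurable_fun [set: Om] U ->
  (forall A : set R, measurable A -> P (U @^-1` A) = beta_prob 1 b A) ->
  measurable_fun [set: R] f -> (forall x, (0 <= f x)%E) ->
  (\int[P]_w f (U w) = \int[mu]_(x in `[0%R, 1%R]) (f x * (b%:R * (1 - x) ^+ (b - 1))%:E))%E.
Proof.
move=> b0 mU lawU mf f0.
have mU' : @measurable_fun _ _ Om (measurableTypeR R) setT U by exact: mU.
pose Um : {mfun Om >-> measurableTypeR R} := HB.pack U (isMeasurableFun.Build _ _ _ _ _ mU').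
transitivity (\int[distribution P Um]_x f x)%E; first by rewrite ge0_integral_distribution.
rewrite (@ge0_integral_density _ _ _ mu (distribution P Um) (beta_pdf 1 b))//.
- rewrite [RHS]integral_mkcond; apply: eq_integral => x _.
  rewrite patchE /beta_pdf patchE; case: ifPn => // _; last by rewrite mul0r mule0.
  case: b b0 {lawU} => // b _.
  by rewrite beta_fun1Sn XMonemX0n invrK mulrC subn1.
- exact: measurable_beta_pdf.
- by move=> x; exact: beta_pdf_ge0.
- by move=> A mA; rewrite integral_beta_pdf//; exact: lawU.
Qed.

Lemma beta_law_ge0 b (U : Om -> R) : measurable_fun [set: Om] U ->
  (forall A : set R, measurable A -> P (U @^-1` A) = beta_prob 1 b A) ->
  {ae P, forall w, 0 <= U w}.
Proof.
move=> mU lawU; exists (U @^-1` `]-oo, 0[%classic); split.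
- by rewrite -[_ @^-1` _]setTI; exact: mU.
- rewrite lawU// -integral_beta_pdf// integral0_eq// => x /=.
  rewrite in_itv/= => x0; rewrite /beta_pdf patchE ifF ?mul0r//.
  by apply/negbTE/negP => /set_mem /=; rewrite in_itv/= leNgt x0.
- by move=> w /= /negP; rewrite in_itv/= -ltNge.
Qed.

Lemma mean_beta_law b (U : Om -> R) : (0 < b)%N -> measurable_fun [set: Om] U ->
  (forall A : set R, measurable A -> P (U @^-1` A) = beta_prob 1 b A) ->
  (\int[P]_w (`|U w|)%:E = (b.+1%:R^-1)%:E)%E.
Proof.
move=> b0 mU lawU.
rewrite (ge0_integral_beta_law (f := fun x => (`|x|)%:E) b0 mU lawU)//; last first.
  by apply/measurable_EFinP; exact: normr_measurable.
case: b b0 {lawU} => // b _; rewrite subn1 /=.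
have d1 m (x : R) : has_deriv (fun x => (1 - x) ^+ m) x (m%:R * (1 - x) ^+ m.-1 * (0 - 1)).
  by apply: has_derivX; apply: has_derivB; [exact: has_deriv_cst|exact: has_deriv_id].
(* Integration by parts of [x] against the density [(b + 1) (1 - x) ^ b]. *)
pose F (x : R) := - (x * (1 - x) ^+ b.+1) - b.+2%:R^-1 * (1 - x) ^+ b.+2.
have dF x : has_deriv F x (x * (b.+1%:R * (1 - x) ^+ b)).
  apply: eq_has_deriv.
    apply: has_derivB; last by apply: has_derivZ; exact: d1.
    by apply: has_derivN; apply: has_derivM; [exact: has_deriv_id|exact: d1].
  rewrite /= exprS; have : b.+2%:R != 0 :> R by rewrite pnatr_eq0.
  by move: b.+2%:R b.+1%:R (_ ^+ b) => u v t u0; field.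
have -> : b.+2%:R^-1 = F 1 - F 0.
  by rewrite /F subrr subr0 !expr0n /= !expr1n; move: (_^-1) => v; ring.
have H : has_int `[0, 1] (fun x : R => x * (b.+1%:R * (1 - x) ^+ b)) (F 1 - F 0).
  apply: has_int_FTC => // x _; apply: has_deriv_continuous.
  by apply: has_derivM; [exact: has_deriv_id|apply: has_derivZ; exact: d1].
rewrite -(has_intE (measurable_itv _) H); apply: eq_integral => x /set_mem /=.
by rewrite in_itv/= => /andP[x0 _]; rewrite -EFinM ger0_norm.
Qed.

End beta_law.

(** * Mean logarithms under the quantization model *)

Section rate_integrals.
Context {R : realType} (M : nat) d (Om : measurableType d) (P : probability Om R).
Context (U1 U2 Z : Om -> R) d' (Om' : measurableType d') (Q : probability Om' R) (X Y : Om' -> R).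
Context (delta u : R).
Hypotheses (M1 : (1 < M)%N) (delta0 : 0 < delta) (u0 : 0 < u).
Hypotheses (mU1 : measurable_fun [set: Om] U1) (mU2 : measurable_fun [set: Om] U2)
  (mZ : measurable_fun [set: Om] Z).
Hypotheses (mX : measurable_fun [set: Om'] X) (mY : measurable_fun [set: Om'] Y).
Hypothesis lawX : forall A : set R, measurable A ->
  Q (X @^-1` A) = (\int[lebesgue_measure]_(x in A) (gamma_pdf 1 x)%:E)%E.
Hypothesis lawY : forall A : set R, measurable A ->
  Q (Y @^-1` A) = (\int[lebesgue_measure]_(y in A) (gamma_pdf (M - 1) y)%:E)%E.
Hypothesis indepXY : forall A C : set R, measurable A -> measurable C ->
  Q (X @^-1` A `&` Y @^-1` C) = (Q (X @^-1` A) * Q (Y @^-1` C))%E.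
Hypothesis lawU : forall A : set (R * R), measurable A ->
  P ((fun w => (U1 w, U2 w)) @^-1` A) =
  Q ((fun w => (delta * Y w, X w + (1 - delta) * Y w)) @^-1` A).
Hypothesis lawZ : forall A : set R, measurable A -> P (Z @^-1` A) = beta_prob 1 (M - 1) A.
Hypothesis indepZ : forall (A : set R) (C : set (R * R)), measurable A -> measurable C ->
  P (Z @^-1` A `&` (fun w => (U1 w, U2 w)) @^-1` C) =
  (P (Z @^-1` A) * P ((fun w => (U1 w, U2 w)) @^-1` C))%E.

Let b0 : 0 < u * delta. Proof. exact: mulr_gt0. Qed.

(** Here [U1] stands for [G T] and [U2] for [G (1 - T)]. The pair [(U1 + U2, U1)] has the joint law
    of [(X + Y, delta Y)], so the quantization error enters only through the product [u * delta]. *)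
Lemma mean_log_quantized (A : R) : 0 <= A ->
  (\int[P]_w (ln (1 + (A * `|U1 w + U2 w| + u * `|U1 w|)))%:E = (mean_log M A (u * delta))%:E)%E.
Proof.
move=> A0; rewrite -(mean_log_gamma_sum M1 mX mY lawX lawY indepXY A0 b0).
pose F (x : measurableTypeR R * measurableTypeR R) : \bar R :=
  (ln (1 + (A * `|x.1 + x.2| + u * `|x.1|)))%:E.
have mF : measurable_fun setT F.
  apply/measurable_EFinP; apply: measurableT_comp => //.
  apply: measurable_funD => //; apply: measurable_funD; apply: measurable_funM => //.
    by apply: measurableT_comp => //; exact: measurable_funD.
  exact: measurableT_comp.
have F0 x : (0 <= F x)%E.
  by rewrite lee_fin ln_ge0// lerDl addr_ge0// mulr_ge0// ltW.
rewrite [LHS](@ge0_integral_eq_law R _ _ _ _ _ _ P Q (fun w => (U1 w, U2 w))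
  (fun w => (delta * Y w, X w + (1 - delta) * Y w)) F)//.
- apply: eq_integral => w _; rewrite /F /=; congr (ln (1 + (_ + _)))%:E.
    by congr (_ * `|_|); ring.
  by rewrite normrM gtr0_norm// mulrA.
- exact: measurable_fun_pair.
- apply: measurable_fun_pair; first exact: measurable_funM.
  by apply: measurable_funD => //; exact: measurable_funM.
Qed.

(** Conditioning on the independent [Z]: given [Z = z], [mean_log_quantized] applies with
    [A = a z]. *)
Lemma integral_log_beta (a : R) : 0 <= a ->
  (\int[P]_w (ln (1 + (a * `|Z w| * `|U1 w + U2 w| + u * `|U1 w|)))%:E =
   \int[lebesgue_measure]_(z in `[0%R, 1%R])
     (mean_log M (a * z) (u * delta) * ((M - 1)%:R * (1 - z) ^+ (M - 2)))%:E)%E.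
Proof.
move=> a0.
pose F (x : measurableTypeR R * (measurableTypeR R * measurableTypeR R)) : \bar R :=
  (ln (1 + (a * `|x.1| * `|x.2.1 + x.2.2| + u * `|x.2.1|)))%:E.
have mF : measurable_fun setT F.
  have m21 : measurable_fun setT
      (fun x : measurableTypeR R * (measurableTypeR R * measurableTypeR R) => x.2.1).
    exact: (measurableT_comp measurable_fst measurable_snd).
  have m22 : measurable_fun setT
      (fun x : measurableTypeR R * (measurableTypeR R * measurableTypeR R) => x.2.2).
    exact: (measurableT_comp measurable_snd measurable_snd).
  apply/measurable_EFinP; apply: measurableT_comp => //.
  apply: measurable_funD => //; apply: measurable_funD; last first.
    by apply: measurable_funM => //; exact: measurableT_comp.
  apply: measurable_funM.
    by apply: measurable_funM => //; exact: measurableT_comp.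
  by apply: measurableT_comp => //; exact: measurable_funD.
have F0 x : (0 <= F x)%E.
  by rewrite lee_fin ln_ge0// lerDl addr_ge0// !mulr_ge0// ltW.
rewrite [LHS](@ge0_integral_indep R _ _ _ _ _ _ P Z (fun w => (U1 w, U2 w)) F)//; last first.
  exact: measurable_fun_pair.
rewrite (@ge0_integral_beta_law _ _ _ P (M - 1) Z (fun z => \int[P]_w F (z, (U1 w, U2 w)))%E)//.
- rewrite -subnDA addn1; apply: eq_integral => z /set_mem /=; rewrite in_itv/= => /andP[z0 _].
  rewrite [in RHS]EFinM; congr (_ * _)%E; rewrite -mean_log_quantized ?mulr_ge0//.
  by apply: eq_integral => w _; rewrite /F/= (ger0_norm z0).
- by rewrite subn_gt0.
- apply: (@measurable_fun_fubini_tonelli_F _ _ _ _ R P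
    (fun z : measurableTypeR R * Om => F (z.1, (U1 z.2, U2 z.2)))) => //.
  apply: (measurableT_comp mF); apply: measurable_fun_pair => //.
  apply: measurable_fun_pair; exact: measurableT_comp.
- by move=> z; exact: integral_ge0.
Qed.

Lemma integral_log_Theta (a : R) : 0 < a ->
  (\int[P]_w (ln (1 + (a * `|Z w| * `|U1 w + U2 w| + u * `|U1 w|)))%:E =
   (ln 2 * Theta M a (u * delta))%:E)%E.
Proof.
move=> a0; rewrite integral_log_beta ?(ltW a0)//.
rewrite -(has_intE _ (has_int_mean_log_onem a0 b0 M1))//.
by apply: eq_integral => z _; rewrite mulrC.
Qed.

Lemma integral_log_Eq_int :
  (\int[P]_w (ln (1 + u * `|U1 w|))%:E =
   (expR (u * delta)^-1 * \sum_(1 <= q < M) Eq_int q (u * delta)^-1)%:E)%E.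
Proof.
rewrite -mean_log0// ?(ltnW M1)// -mean_log_quantized//.
by apply: eq_integral => w _; rewrite mul0r add0r.
Qed.

End rate_integrals.

(** * Tangent-line bound for the conditional rate *)

Section tangent.
Context {R : realType}.
Implicit Types (xi A g u U : R).

Definition rate_slope xi A g u : R := g * A / ((xi + g * u) * (xi + A + g * u)).

Lemma rate_slope_ge0 xi A g u : 0 < xi -> 0 <= A -> 0 <= g -> 0 <= u ->
  0 <= rate_slope xi A g u.
Proof.
move=> x0 A0 g0 u0; rewrite /rate_slope divr_ge0 ?mulr_ge0// ?addr_ge0 ?(ltW x0) ?mulr_ge0//.
Qed.

(** A bound free of the random [xi], [A] and [g], so that the expected slope is finite and can be
    cancelled. *)
Lemma rate_slope_le xi A g u : 0 < xi -> 0 <= A -> 0 <= g -> 0 < u ->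
  rate_slope xi A g u <= u^-1.
Proof.
move=> x0 A0 g0 u0; have gu0 : 0 <= g * u by rewrite mulr_ge0// ltW.
rewrite /rate_slope ler_pdivrMr; last first.
  by rewrite mulr_gt0// ltr_wpDr// ltr_wpDr.
rewrite ler_pdivlMl//; have -> : u * (g * A) = (g * u) * A by ring.
by nra.
Qed.

(* [-rate_slope] is the derivative of the convex function
   [U |-> ln (1 + A / (xi + g U))] at [u]. *)
Lemma rate_tangent xi A g u U : 0 < xi -> 0 <= A -> 0 <= g -> 0 <= u -> 0 <= U ->
  ln (xi + A + g * u) + u * rate_slope xi A g u <=
  ln (1 + A / (xi + g * U)) + (U * rate_slope xi A g u + ln (xi + g * u)).
Proof.
move=> x0 A0 g0 u0 U0.
have gu0 : 0 <= g * u by rewrite mulr_ge0.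
have gU0 : 0 <= g * U by rewrite mulr_ge0.
have p0 : 0 < xi + g * u by rewrite ltr_wpDr.
have P0 : 0 < xi + g * U by rewrite ltr_wpDr.
have q0 : 0 < xi + A + g * u by rewrite ltr_wpDr// ltr_wpDr.
have Q0 : 0 < xi + A + g * U by rewrite ltr_wpDr// ltr_wpDr.
have -> : 1 + A / (xi + g * U) = (xi + A + g * U) / (xi + g * U).
  by field; rewrite gt_eqF.
(* [ln y] is the rate at [u] minus the rate at [U]. The bound [ln y <= y - 1] leaves a rational
   inequality whose slack is a square times a positive factor or zero. *)
pose y := (xi + g * U) * (xi + A + g * u) / ((xi + A + g * U) * (xi + g * u)).
have y0 : 0 < y by rewrite divr_gt0// mulr_gt0.
have ly : ln y <= y - 1.
  have := @le_ln1Dx R (y - 1); rewrite (_ : 1 + (y - 1) = y); last by ring.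
  by apply; lra.
have ylnE : ln y = ln (xi + g * U) + ln (xi + A + g * u) - (ln (xi + A + g * U) + ln (xi + g * u)).
  by rewrite /y ln_div ?posrE ?mulr_gt0// !lnM ?posrE.
rewrite ln_div ?posrE//.
have : y - 1 <= (U - u) * rate_slope xi A g u.
  rewrite -subr_ge0 (_ : _ - _ = (g * (U - u)) ^+ 2 * A /
      ((xi + g * u) * (xi + A + g * u) * (xi + A + g * U))); last first.
    by rewrite /y /rate_slope; field; rewrite !gt_eqF.
  apply: divr_ge0; first by apply: mulr_ge0 => //; exact: sqr_ge0.
  by rewrite ltW// !mulr_gt0.
rewrite mulrBl; lra.
Qed.

End tangent.

(** In the application [W] is [(G, T, Z)] and [f] is the tangent slope; Tonelli factors the
    expectation. *)
Lemma mean_beta_law_indep (R : realType) d d2 (Om : measurableType d) (T2 : measurableType d2)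
    (P : probability Om R) (V : Om -> R) (W : Om -> T2) (f : T2 -> R) b :
  (0 < b)%N -> measurable_fun [set: Om] V -> measurable_fun [set: Om] W ->
  (forall A : set R, measurable A -> P (V @^-1` A) = beta_prob 1 b A) ->
  (forall (A : set R) C, measurable A -> measurable C ->
    P (V @^-1` A `&` W @^-1` C) = (P (V @^-1` A) * P (W @^-1` C))%E) ->
  measurable_fun [set: T2] f -> (forall x, 0 <= f x) ->
  (\int[P]_w (`|V w| * f (W w))%:E = (b.+1%:R^-1)%:E * \int[P]_w (f (W w))%:E)%E.
Proof.
move=> b0 mV mW lawV indep mf f0.
have mfW : measurable_fun [set: Om] (fun w => (f (W w))%:E).
  by apply/measurable_EFinP; exact: (measurableT_comp mf).
pose F (x : measurableTypeR R * T2) : \bar R := (`|x.1| * f x.2)%:E.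
have mF : measurable_fun setT F.
  apply/measurable_EFinP; apply: measurable_funM.
    exact: (measurableT_comp (@normr_measurable R setT)).
  exact: (measurableT_comp mf).
rewrite [LHS](@ge0_integral_indep R _ _ _ _ _ _ P V W F)//; last first.
  by move=> x; rewrite lee_fin mulr_ge0.
rewrite -(mean_beta_law b0 mV lawV) -ge0_integralZr//; last 2 first.
- by apply/measurable_EFinP; exact: measurableT_comp.
- by apply: integral_ge0 => w _; rewrite lee_fin.
apply: eq_integral => w _; rewrite -ge0_integralZl_EFin//.
by move=> x _; rewrite lee_fin.
Qed.

Lemma ge0_integralD_EFin (R : realType) d (T : measurableType d)
    (mu : {measure set T -> \bar R}) (f g : T -> R) :
  measurable_fun [set: T] f -> (forall x, 0 <= f x) ->
  measurable_fun [set: T] g -> (forall x, 0 <= g x) ->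
  (\int[mu]_x (f x + g x)%:E = \int[mu]_x (f x)%:E + \int[mu]_x (g x)%:E)%E.
Proof.
move=> mf f0 mg g0; rewrite -ge0_integralD//.
- by move=> x _; rewrite lee_fin.
- exact/measurable_EFinP.
- by move=> x _; rewrite lee_fin.
- exact/measurable_EFinP.
Qed.

(** * The lower bound on the ergodic rate *)

Unset Implicit Arguments.
Set Strict Implicit.

Theorem theorem1 (R : realType) (M N K : nat) (alpha : R)
  (d sigma2 P : 'I_N -> 'I_K -> R) (B : 'I_N -> 'I_K -> nat)
  (n : 'I_N) (k : 'I_K)
  (dO : measure_display) (Omega : measurableType dO) (Pr : probability Omega R)
  (G T Z : Omega -> R) (V : 'I_N -> Omega -> R)
  (dX : measure_display) (OmegaX : measurableType dX) (Q : probability OmegaX R)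
  (X Y : OmegaX -> R) :
  (2 <= N)%N -> (2 <= K)%N -> ((N - 1) * K < M)%N ->
  0 < alpha ->
  (forall i j, 0 < d i j) -> (forall i j, 0 < sigma2 i j) -> (forall i j, 0 < P i j) ->
  (* measurability of the random quantities *)
  measurable_fun setT G -> measurable_fun setT T -> measurable_fun setT Z ->
  (forall i, measurable_fun setT (V i)) ->
  measurable_fun setT X -> measurable_fun setT Y ->
  (* X ~ Gamma(1,1), Y ~ Gamma(M-1,1), X and Y independent *)
  (forall A : set R, measurable A ->
     Q (X @^-1` A) = (\int[lebesgue_measure]_(x in A) (gamma_pdf 1 x)%:E)%E) ->
  (forall A : set R, measurable A ->
     Q (Y @^-1` A) = (\int[lebesgue_measure]_(y in A) (gamma_pdf (M - 1) y)%:E)%E) ->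
  (forall A C : set R, measurable A -> measurable C ->
     Q (X @^-1` A `&` Y @^-1` C) = (Q (X @^-1` A) * Q (Y @^-1` C))%E) ->
  (* (G T, G (1 - T)) has the same joint law as (delta Y, X + (1 - delta) Y) *)
  (forall A : set (R * R), measurable A ->
     Pr ((fun w => (G w * T w, G w * (1 - T w))) @^-1` A) =
     Q ((fun w => (delta M B n k * Y w, X w + (1 - delta M B n k) * Y w)) @^-1` A)) ->
  (* Z ~ Beta(1, M-1), independent of (G, T) *)
  (forall A : set R, measurable A -> Pr (Z @^-1` A) = beta_prob 1 (M - 1) A) ->
  (forall (A : set R) (C : set (R * R)), measurable A -> measurable C ->
     Pr (Z @^-1` A `&` (fun w => (G w, T w)) @^-1` C) =
     (Pr (Z @^-1` A) * Pr ((fun w => (G w, T w)) @^-1` C))%E) ->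
  (* V_i ~ Beta(1, M-2) for i <> n, and (V_i)_{i <> n} independent of (G, T, Z) *)
  (forall i, i != n -> forall A : set R, measurable A ->
     Pr (V i @^-1` A) = beta_prob 1 (M - 2) A) ->
  (forall (A : 'I_N -> set R) (C : set (R * R * R)),
     (forall i, measurable (A i)) -> measurable C ->
     Pr ((\bigcap_(i in [set i | i != n]) (V i @^-1` A i)) `&`
         (fun w => (G w, T w, Z w)) @^-1` C) =
     (Pr (\bigcap_(i in [set i | i != n]) (V i @^-1` A i)) *
      Pr ((fun w => (G w, T w, Z w)) @^-1` C))%E) ->
  (* the ergodic rate E[log2 (1 + gamma_{n,k})] is at least R^{LB1}_{n,k} *)
  ((RLB1 M alpha d sigma2 P B n k)%:E <=
   \int[Pr]_w (log2 (1 + sinr alpha d sigma2 P n k (G w) (T w) (Z w) (fun i => V i w)))%:E)%E.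
Proof.
move=> N2 K2 MNK alpha0 d0 sigma0 P0 mG mT mZ mV mX mY lawX lawY indepXY lawGT lawZ indepZ lawV indepV.
(* At least one other cluster of at least two users forces [M > 2], so Beta(1, [M - 2]) has positive
   parameters. *)
have M2 : (2 < M)%N by nia.
have M1 : (1 < M)%N by exact: ltnW.
have gain_gt0 : 0 < gain alpha d sigma2 n k by rewrite divr_gt0// powR_gt0.
have delta_gt0 : 0 < delta M B n k :> R by rewrite powR_gt0.
have delta_le1 : delta M B n k <= 1 :> R.
  rewrite -(powRr0 (2 : R)) ler_powR ?ler1n// oppr_le0 divr_ge0//.
have M1n0 : (M - 1)%:R != 0 :> R by rewrite pnatr_eq0 subn_eq0 -ltnNge.
set dl := delta M B n k in lawGT delta_gt0 delta_le1.
set gn := gain alpha d sigma2 n k in gain_gt0.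
(* The interference is [G T] times the sum of the [c i * V i], and the weights add up to [S3]. *)
pose c i := gn * \sum_(l < K) P i l.
have c_ge0 i : 0 <= c i.
  by rewrite mulr_ge0 ?(ltW gain_gt0)//; apply: sumr_ge0 => j _; exact: ltW.
have S3E : S3 alpha d sigma2 P n k = \sum_(i < N | i != n) c i by rewrite /S3 mulr_sumr.
have S3_gt0 : 0 < S3 alpha d sigma2 P n k.
  have [i ni] : exists i : 'I_N, i != n.
    have [n0|n0] := eqVneq (n : nat) 0%N.
      by exists (Ordinal N2); rewrite -val_eqE /= n0.
    by exists (Ordinal (ltnW N2)); rewrite -val_eqE /= eq_sym.
  rewrite S3E (bigD1 i)//= ltr_wpDr ?sumr_ge0// mulr_gt0//.
  by rewrite (bigD1 k)//= ltr_wpDr// sumr_ge0// => j _; exact: ltW.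
(* The mean of that weighted sum, each Beta(1, [M - 2]) variable having mean [1 / (M - 1)]. *)
pose u := S3 alpha d sigma2 P n k / (M - 1)%:R.
have u_gt0 : 0 < u by rewrite divr_gt0// ltr0n subn_gt0.
have uE : u * dl = cnk M alpha d sigma2 P B n k by rewrite /u /cnk mulrAC.
pose s2 := S2 alpha d sigma2 P n k; pose a := gn * P n k.
have a_gt0 : 0 < a by rewrite mulr_gt0.
have s2_ge0 : 0 <= s2.
  by rewrite mulr_ge0 ?(ltW gain_gt0)//; apply: sumr_ge0 => j _; exact: ltW.
have S1E : S1 alpha d sigma2 P n k = s2 + a.
  rewrite /S1 /s2 /S2 /a -mulrDr; congr (_ * _).
  rewrite (bigD1 k)//= addrC; congr (_ + _); apply: eq_bigl => j.
  by rewrite ltn_neqAle andbC.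
pose U1 w := G w * T w; pose U2 w := G w * (1 - T w).
have mU1 : measurable_fun setT U1 by exact: measurable_funM.
have mU2 : measurable_fun setT U2.
  by apply: measurable_funM => //; exact: measurable_funB.
(* [(G T, G (1 - T))] is a measurable function of [(G, T)], which carries the independence over. *)
have indepZ' (A : set R) (C : set (R * R)) : measurable A -> measurable C ->
    Pr (Z @^-1` A `&` (fun w => (U1 w, U2 w)) @^-1` C) =
    (Pr (Z @^-1` A) * Pr ((fun w => (U1 w, U2 w)) @^-1` C))%E.
  move=> mA mC.
  pose psi (x : R * R) := (x.1 * x.2, x.1 * (1 - x.2)).
  have mpsi : measurable_fun setT psi.
    apply: measurable_fun_pair; apply: measurable_funM => //.
    exact: measurable_funB.
  apply: (indepZ A (psi @^-1` C) mA).
  by rewrite -[X in measurable X]setTI; exact: mpsi.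
pose h w := `|U1 w + U2 w|; pose g w := `|U1 w|; pose z w := `|Z w|.
(* Writing the subtracted part as [Theta] minus [RLB1] treats the first user and all the others at
   once. *)
have E0 : (\int[Pr]_w (ln (1 + (s2 * z w * h w + u * g w)))%:E =
    (ln 2 * (Theta M (S1 alpha d sigma2 P n k) (cnk M alpha d sigma2 P B n k)
      - RLB1 M alpha d sigma2 P B n k))%:E)%E.
  rewrite /RLB1; case: eqVneq => [k0|k0].
    rewrite opprB addrC subrK mulrA mulrA mulfV ?mul1r; last first.
      by rewrite gt_eqF// ln_gt0// ltr1n.
    have -> : (M - 1)%:R / (S3 alpha d sigma2 P n k * delta M B n k) = (u * dl)^-1.
      by rewrite uE /cnk invf_div.
    rewrite -(integral_log_Eq_int M1 delta_gt0 u_gt0 mU1 mU2 mX mY lawX lawY indepXY lawGT).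
    have -> : s2 = 0 by rewrite /s2 /S2 k0 big_pred0 ?mulr0// => j; rewrite ltn0.
    by apply: eq_integral => w _; rewrite !mul0r add0r.
  rewrite opprB addrC subrK -uE.
  rewrite -(integral_log_Theta M1 delta_gt0 u_gt0 mU1 mU2 mZ mX mY lawX lawY indepXY lawGT lawZ indepZ')//.
  rewrite mulr_gt0//; have k0' : (0 < k)%N by rewrite lt0n.
  rewrite (bigD1 (Ordinal (ltn_trans k0' (ltn_ord k))))//= ltr_wpDr// sumr_ge0// => j _.
  exact: ltW.
have E1 : (\int[Pr]_w (ln (1 + ((s2 + a) * z w * h w + u * g w)))%:E =
    (ln 2 * Theta M (S1 alpha d sigma2 P n k) (cnk M alpha d sigma2 P B n k))%:E)%E.
  rewrite S1E -uE.
  rewrite -(integral_log_Theta M1 delta_gt0 u_gt0 mU1 mU2 mZ mX mY lawX lawY indepXY lawGT lawZ indepZ')//.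
  by rewrite ltr_wpDl.
pose D2 := (measurableTypeR R * measurableTypeR R * measurableTypeR R)%type.
(* The slope at [u] as a function of [(G, T, Z)] alone, hence independent of every [V i]. *)
pose phi (x : D2) := rate_slope (1 + s2 * `|x.2| * `|x.1.1 * x.1.2 + x.1.1 * (1 - x.1.2)|)
  (a * `|x.2| * `|x.1.1 * x.1.2 + x.1.1 * (1 - x.1.2)|) `|x.1.1 * x.1.2| u.
have xi_gt0 (x y : R) : 0 < 1 + s2 * `|x| * `|y| by rewrite ltr_pwDl// mulr_ge0// mulr_ge0.
have A_ge0 (x y : R) : 0 <= a * `|x| * `|y| by rewrite mulr_ge0// mulr_ge0// ltW.
have phi0 x : 0 <= phi x by rewrite rate_slope_ge0// ltW.
have phi_le x : phi x <= u^-1 by rewrite rate_slope_le.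
have mphi : measurable_fun setT phi.
  have m3 : measurable_fun setT (fun x : D2 => `|x.2|).
    exact: (measurableT_comp (@normr_measurable R setT)).
  have m1 : measurable_fun setT (fun x : D2 => x.1.1).
    exact: (measurableT_comp measurable_fst measurable_fst).
  have m2 : measurable_fun setT (fun x : D2 => x.1.2).
    exact: (measurableT_comp measurable_snd measurable_fst).
  have m12 : measurable_fun setT (fun x : D2 => x.1.1 * x.1.2) by exact: measurable_funM.
  have mg : measurable_fun setT (fun x : D2 => `|x.1.1 * x.1.2|).
    exact: (measurableT_comp (@normr_measurable R setT)).
  have mh : measurable_fun setT (fun x : D2 => `|x.1.1 * x.1.2 + x.1.1 * (1 - x.1.2)|).
    apply: (measurableT_comp (@normr_measurable R setT)); apply: measurable_funD => //.
    by apply: measurable_funM => //; exact: measurable_funB.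
  have msh : measurable_fun setT (fun x : D2 => 1 + s2 * `|x.2| * `|x.1.1 * x.1.2 + x.1.1 * (1 - x.1.2)|).
    by apply: measurable_funD => //; apply: measurable_funM => //; exact: measurable_funM.
  have mah : measurable_fun setT (fun x : D2 => a * `|x.2| * `|x.1.1 * x.1.2 + x.1.1 * (1 - x.1.2)|).
    by apply: measurable_funM => //; exact: measurable_funM.
  have mgu : measurable_fun setT (fun x : D2 => `|x.1.1 * x.1.2| * u) by exact: measurable_funM.
  apply: measurable_funM; first exact: measurable_funM.
  apply: (measurableT_comp (@measurable_inv R)); apply: measurable_funM.
    exact: measurable_funD.
  by apply: measurable_funD => //; exact: measurable_funD.
pose W w := (G w, T w, Z w).
have mW : measurable_fun setT (W : Omega -> D2).
  by apply: measurable_fun_pair => //; exact: measurable_fun_pair.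
have mphiW : measurable_fun setT (fun w => phi (W w)) by exact: (measurableT_comp mphi).
(* Listing the other clusters turns the conditional sums into plain sums over a sequence. *)
pose r := [seq i <- index_enum 'I_N | i != n].
have rE (F : 'I_N -> R) : \sum_(i < N | i != n) F i = \sum_(i <- r) F i by rewrite big_filter.
pose U w := \sum_(i <- r) c i * `|V i w|.
have U0 w : 0 <= U w by apply: sumr_ge0 => i _; rewrite mulr_ge0.
have mU : measurable_fun setT U.
  apply: measurable_sum => i; apply: measurable_funM => //; exact: measurableT_comp.
(* The slope is at most [1 / u] on a probability space, so its mean is finite. *)
have [m phiE] : exists m, (\int[Pr]_w (phi (W w))%:E)%E = m%:E.
  exists (fine (\int[Pr]_w (phi (W w))%:E)%E); rewrite fineK// ge0_fin_numE; last first.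
    by apply: integral_ge0 => w _; rewrite lee_fin.
  apply: (@le_lt_trans _ _ (\int[Pr]_w (u^-1)%:E)%E).
    apply: ge0_le_integral => //.
    - by move=> w _; rewrite lee_fin.
    - exact/measurable_EFinP.
    - by move=> w _; rewrite lee_fin.
  rewrite integral_cst// [X in (_ * X)%E](_ : _ = 1%E) ?mule1 ?ltry//; exact: probability_setT.
(* The linear term of the tangent averages out: each [V i] is independent of the slope, and the
   weighted means add up to [u]. *)
have phiU : (\int[Pr]_w (U w * phi (W w))%:E = (u * m)%:E)%E.
  have V1 i : i != n -> (\int[Pr]_w (`|V i w| * phi (W w))%:E = ((M - 1)%:R^-1 * m)%:E)%E.
    move=> ni; have b0 : (0 < M - 2)%N by rewrite subn_gt0.
    have indi (A : set R) (C : set D2) : measurable A -> measurable C ->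
        Pr (V i @^-1` A `&` W @^-1` C) = (Pr (V i @^-1` A) * Pr (W @^-1` C))%E.
      (* Taking the whole line for every other index isolates a single [V i] in the joint
         independence. *)
      move=> mA mC; have := indepV (fun j => if j == i then A else setT) C _ mC.
      have -> : \bigcap_(j in [set j | j != n]) (V j @^-1` (if j == i then A else setT)) = V i @^-1` A.
        apply/seteqP; split => w /=.
          by move=> /(_ i ni)/=; rewrite eqxx.
        by move=> Aw j _ /=; case: eqP => // ->.
      by apply => j; case: eqP.
    apply: (etrans (mean_beta_law_indep b0 (mV i) mW (lawV i ni) indi mphi phi0)).
    by rewrite -(subSn M1) subSS phiE -EFinM.
  transitivity (\int[Pr]_w \sum_(i <- r) ((c i)%:E * (`|V i w| * phi (W w))%:E))%E.
    apply: eq_integral => w _; rewrite /U mulr_suml -sumEFin.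
    by apply: eq_bigr => i _; rewrite -mulrA EFinM.
  have mVphi i : measurable_fun setT (fun w => (`|V i w| * phi (W w))%:E).
    by apply/measurable_EFinP; apply: measurable_funM => //; exact: measurableT_comp.
  rewrite ge0_integral_sum//; last 2 first.
  - by move=> i; exact: emeasurable_funM.
  - by move=> i w _; rewrite -EFinM lee_fin mulr_ge0// mulr_ge0.
  rewrite (eq_big_seq (fun i => (c i * ((M - 1)%:R^-1 * m))%:E)).
    by rewrite sumEFin -mulr_suml -rE -S3E mulrA.
  move=> i; rewrite mem_filter => /andP[ni _]; rewrite ge0_integralZl_EFin//; first by rewrite V1.
  by move=> w _; rewrite lee_fin mulr_ge0.
pose f w := ln (1 + a * z w * h w / (1 + s2 * z w * h w + g w * U w)).
have f0 w : 0 <= f w.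
  rewrite ln_ge0// lerDl; apply: divr_ge0; first exact: A_ge0.
  apply: addr_ge0; first exact/ltW/xi_gt0.
  by apply: mulr_ge0 => //; exact: normr_ge0.
have mz : measurable_fun setT z by exact: measurableT_comp.
have mg : measurable_fun setT g by exact: measurableT_comp.
have mh : measurable_fun setT h by apply: measurableT_comp => //; exact: measurable_funD.
have mf : measurable_fun setT f.
  apply: measurableT_comp => //; apply: measurable_funD => //; apply: measurable_funM.
    by apply: measurable_funM => //; exact: measurable_funM.
  apply: (measurableT_comp (@measurable_inv R)); apply: measurable_funD.
    by apply: measurable_funD => //; apply: measurable_funM => //; exact: measurable_funM.
  exact: measurable_funM.
have mL s : measurable_fun setT (fun w => ln (1 + (s * z w * h w + u * g w))).
  apply: measurableT_comp => //; apply: measurable_funD => //; apply: measurable_funD.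
    by apply: measurable_funM => //; exact: measurable_funM.
  exact: measurable_funM.
have L0 s w : 0 <= s -> 0 <= ln (1 + (s * z w * h w + u * g w)).
  move=> s0; rewrite ln_ge0// lerDl; apply: addr_ge0.
    by rewrite !mulr_ge0// normr_ge0.
  by rewrite mulr_ge0 ?(ltW u_gt0)// normr_ge0.
have mUphi : measurable_fun setT (fun w => U w * phi (W w)) by exact: measurable_funM.
(* The tangent inequality integrated. The two copies of [u * m] are the means of [u * phi] and of
   [U * phi]; keeping both avoids subtracting integrals in the extended reals. *)
have jensen : ((ln 2 * Theta M (S1 alpha d sigma2 P n k) (cnk M alpha d sigma2 P B n k))%:E
    + (u * m)%:E <= \int[Pr]_w (f w)%:E + ((u * m)%:E +
    (ln 2 * (Theta M (S1 alpha d sigma2 P n k) (cnk M alpha d sigma2 P B n k)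
      - RLB1 M alpha d sigma2 P B n k))%:E))%E.
  have -> : (u * m)%:E = (\int[Pr]_w (u * phi (W w))%:E)%E.
    rewrite EFinM -phiE -ge0_integralZl_EFin// ?(ltW u_gt0)//; first by move=> w _; rewrite lee_fin.
    exact/measurable_EFinP.
  rewrite {2}(_ : \int[Pr]_w (u * phi (W w))%:E = \int[Pr]_w (U w * phi (W w))%:E)%E; last first.
    rewrite phiU EFinM -phiE -ge0_integralZl_EFin// ?(ltW u_gt0)//; first by move=> w _; rewrite lee_fin.
    exact/measurable_EFinP.
  have a1 w : 0 <= u * phi (W w) by rewrite mulr_ge0// ltW.
  have a2 w : 0 <= U w * phi (W w) by rewrite mulr_ge0.
  have sa : 0 <= s2 + a by rewrite addr_ge0// ltW.
  have muphi : measurable_fun setT (fun w => u * phi (W w)) by exact: measurable_funM.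
  have L0a w := L0 (s2 + a) w sa.
  have L0s w := L0 s2 w s2_ge0.
  rewrite -E0 -E1 -(ge0_integralD_EFin Pr (mL (s2 + a)) L0a muphi a1).
  rewrite -(ge0_integralD_EFin Pr mUphi a2 (mL s2) L0s).
  have mUL : measurable_fun setT (fun w => U w * phi (W w) + ln (1 + (s2 * z w * h w + u * g w))).
    exact: measurable_funD.
  have UL0 w : 0 <= U w * phi (W w) + ln (1 + (s2 * z w * h w + u * g w)) by exact: addr_ge0.
  rewrite -(ge0_integralD_EFin Pr mf f0 mUL UL0).
  apply: ge0_le_integral => //.
  - by move=> w _; rewrite lee_fin addr_ge0.
  - by apply/measurable_EFinP; exact: measurable_funD.
  - by apply/measurable_EFinP; exact: measurable_funD.
  move=> w _; rewrite !lee_fin.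
  have := @rate_tangent R (1 + s2 * z w * h w) (a * z w * h w) (g w) u (U w)
    (xi_gt0 _ _) (A_ge0 _ _) (normr_ge0 _) (ltW u_gt0) (U0 w).
  by rewrite /f /phi /= !mulrDl !addrA [u * g w]mulrC.
have ln2_gt0 : 0 < ln 2 :> R by rewrite ln_gt0// ltr1n.
suff -> : (\int[Pr]_w (log2 (1 + sinr alpha d sigma2 P n k (G w) (T w) (Z w) (fun i => V i w)))%:E =
    ((ln 2)^-1)%:E * \int[Pr]_w (f w)%:E)%E.
  have : (0 <= \int[Pr]_w (f w)%:E)%E by apply: integral_ge0 => w _; rewrite lee_fin.
  (* An infinite mean makes the bound trivial; otherwise [u * m] cancels in real arithmetic. *)
  move: jensen; case: (\int[Pr]_w (f w)%:E)%E => [I|_ _|//]; last first.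
    by rewrite gt0_muley ?leey// lte_fin invr_gt0.
  rewrite -!EFinD -EFinM !lee_fin => le_r _; rewrite ler_pdivlMl//; lra.
rewrite -ge0_integralZl_EFin//; last 3 first.
- by move=> w _; rewrite lee_fin.
- exact/measurable_EFinP.
- by rewrite invr_ge0 ltW.
(* Since the quantization factor lies in []0, 1]], a negative coordinate of the pair on the gamma
   side forces [X < 0] or [Y < 0], and both events are null. *)
have ae1 : {ae Pr, forall w, 0 <= U1 w /\ 0 <= U2 w}.
  pose A : set (R * R) := (`]-oo, 0[%classic `*` setT) `|` (setT `*` `]-oo, 0[%classic).
  have mA : measurable A by apply: measurableU; exact: measurableX.
  exists ((fun w => (U1 w, U2 w)) @^-1` A); split.
  - rewrite -[_ @^-1` _]setTI; exact: measurable_fun_pair.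
  - rewrite lawGT//; apply/eqP; rewrite eq_le measure_ge0 andbT.
    have n0 k' (U' : OmegaX -> R) : measurable_fun setT U' -> (forall A : set R, measurable A ->
        Q (U' @^-1` A) = (\int[lebesgue_measure]_(x in A) (gamma_pdf k' x)%:E)%E) ->
        Q (U' @^-1` `]-oo, 0[%classic) = 0%E.
      move=> mU' ->//; rewrite integral0_eq// => x /=; rewrite in_itv/= => x0.
      by rewrite /gamma_pdf leNgt x0.
    rewrite -(adde0 (0 : \bar R)%E) -{1}(n0 _ _ mX lawX) -(n0 _ _ mY lawY).
    have mXl : measurable (X @^-1` `]-oo, 0[%classic) by rewrite -[_ @^-1` _]setTI; exact: mX.
    have mYl : measurable (Y @^-1` `]-oo, 0[%classic) by rewrite -[_ @^-1` _]setTI; exact: mY.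
    apply: le_trans (measureU2 _ mXl mYl); apply: le_measure; rewrite ?inE.
    + rewrite -[_ @^-1` _]setTI; apply: measurable_fun_pair => //; first exact: measurable_funM.
      by apply: measurable_funD => //; exact: measurable_funM.
    + exact: measurableU.
    + move=> w -[[+ _]|[_ +]]; rewrite /= !in_itv/=.
        by rewrite pmulr_rlt0// => ?; right.
      case: (ltP (X w) 0) => [? _|X0]; first by left.
      case: (ltP (Y w) 0) => [? _|Y0]; first by right.
      by rewrite ltNge addr_ge0// mulr_ge0// subr_ge0.
  - move=> w /= /not_andP[]/negP; rewrite -ltNge => lt0.
      by left; split => //=; rewrite in_itv.
    by right; split => //=; rewrite in_itv.
have aeZ : {ae Pr, forall w, 0 <= Z w} := beta_law_ge0 mZ lawZ.
have aeV : {ae Pr, forall w, forall i, i != n -> 0 <= V i w}.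
  apply: filter_forall => i; have [->|ni] := eqVneq i n.
    by apply: aeW.
  by apply: filterS (beta_law_ge0 (mV i) (lawV i ni)).
apply: ae_eq_integral => //.
- apply/measurable_EFinP; apply: measurable_funM => //; apply: measurableT_comp => //.
  apply: measurable_funD => //; apply: measurable_funM.
    by apply: measurable_funM => //; exact: measurable_funM.
  apply: (measurableT_comp (@measurable_inv R)); apply: measurable_funD.
    by apply: measurable_funD => //; apply: measurable_funM => //; exact: measurable_funM.
  apply: measurable_funM; first by apply: measurable_funM => //; exact: measurable_funM.
  under eq_fun do rewrite rE.
  by apply: measurable_sum => i; exact: measurable_funM.
- by apply: emeasurable_funM => //; exact/measurable_EFinP.
(* Where all these signs are nonnegative the absolute values drop out, and [f] is the natural
   logarithm of one plus the true SINR. *)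
apply: filterS3 ae1 aeZ aeV => w [U10 U20] Z0 V0 _.
rewrite -EFinM /log2 mulrC; congr (_ * ln (1 + _))%:E.
have hE : h w = G w by rewrite /h ger0_norm ?addr_ge0// /U1 /U2; ring.
rewrite /f /sinr hE /z (ger0_norm Z0) -/s2 -/gn; congr (_ / (_ + _)).
- by rewrite /a mulrAC.
- by rewrite mulrAC.
rewrite /g (ger0_norm U10) /U /U1 -rE !mulr_sumr; apply: eq_bigr => i ni.
by rewrite /c (ger0_norm (V0 i ni)); ring.
Qed.
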